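(* Let $T$ be one of the nine algorithms described in the context, with quadratic field $K$, matrices $A_1,\dots,A_r$ and alphabet $\mathfrak A=\{1,\dots,r\}$. Let $\mathbf a=a_0a_1a_2\cdots\in\mathfrak A^\omega$ be a sequence that does not end in $\overline r$ (nor in $\overline1$, if $\det A_1=+1$), and let $0\le t_0<t_1<t_2<\cdots$ be an infinite sequence of times such that each word $a_{t_k}a_{t_k+1}\cdots a_{t_{k+1}}$ is a decreasing block. Let $w$ be a finite initial subword of $\mathbf a$, long enough that $h=\max\{l:t_l<\mathrm{length}(w)\}$ is defined, and let $\alpha\in K$ be any element having a $T$-symbolic orbit that starts with $w$. Then, for every $0\le k<h$, the strict inequality $$H\bigl(T^{t_k}(\alpha)\bigr)>H\bigl(T^{t_{k+1}}(\alpha)\bigr)$$ holds, with the only possible exception of the last index $k=h-1$, where equality may hold; this exception takes place if and only if $T^{t_{h-1}}(\alpha)=1$, and it forces $T^{t_h}(\alpha)=0$. Here $H$ denotes the absolute Weil height on $\mathrm P^1K$.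
   Context: **Matrices.** $\mathrm{PSL}_2^\pm R$ is the group of $2\times2$ matrices over $R$ with determinant $\pm1$, modulo $\pm1$; it acts on $\mathrm P^1\mathbb R$ by $\begin{bmatrix}a&b\\ c&d\end{bmatrix}*x=\frac{ax+b}{cx+d}$. Let $I_0=[0,\infty]\subset\mathrm P^1\mathbb R$. **Height.** For $\alpha=[\alpha_1,\alpha_2]\in\mathrm P^1K$, $H(\alpha)=\prod_P\max(|\alpha_1|_P,|\alpha_2|_P)$, the product over all places $P$ of $K$, with $|\cdot|_P$ normalized, for $K$ of degree $d$, by $|x|_P=|\sigma(x)|^{e/d}$ for the archimedean place of an embedding $\sigma$ ($e=1$ if real, $2$ if complex) and $|p|_P=p^{-[K_P:\mathbb Q_p]/d}$ for $P$ over a rational prime $p$. **The nine algorithms.** Let $\lambda_k=2\cos(\pi/k)$ and $\tau=(1+\sqrt5)/2$. Each algorithm is given by a quadratic field $K$ with integer ring $\mathbb O$ and a list $A_1,\dots,A_r\in\mathrm{PSL}_2^\pm\mathbb O$; the intervals $I_a=A_a*I_0$ cover $I_0$, meet at most in common endpoints, and are numbered in increasing order from $0$ to $\infty$. The map $T:I_0\to I_0$ is $x\mapsto A_a^{-1}*x$ on $I_a$ (a common endpoint of $I_a,I_{a+1}$ is mapped using $A_a^{-1}$; in all nine cases $T$ is continuous). (I) $(l,m,\infty)\in\{(2,5,\infty),(3,4,\infty),(3,5,\infty),(3,6,\infty)\}$, with $K=\mathbb Q(\sqrt5),\mathbb Q(\sqrt2),\mathbb Q(\sqrt5),\mathbb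 Q(\sqrt3)$ respectively. Let $F=\begin{bmatrix}0&1\\ 1&0\end{bmatrix}$, $Q=\begin{bmatrix}\lambda_l&1\\ -1&0\end{bmatrix}$, $R=\begin{bmatrix}0&1\\ -1&\lambda_m\end{bmatrix}$, $r=(l-1)(m-1)$. For $1\le i<m$, $1\le j<l$ and $a=(i-1)(l-1)+j$, put $A_a=R^iQ^j$ if $a$ is even and $A_a=R^iQ^jF$ if $a$ is odd. (II) $(l,\infty,\infty)$ with $l=4,5,6$, $K=\mathbb Q(\sqrt2),\mathbb Q(\sqrt5),\mathbb Q(\sqrt3)$ and $\beta=2+\sqrt2,\,2+\tau,\,2+\sqrt3$ respectively. Let $J=\begin{bmatrix}-1&0\\ 0&1\end{bmatrix}$, $P=\begin{bmatrix}-1&1\\ 0&1\end{bmatrix}$, $M=\begin{bmatrix}1&0\\ \beta&-1\end{bmatrix}$, $r=2l-1$. For $0\le q\le l-2$ put $A_{1+2q}=(MP)^qMJ$, $A_{2+2q}=(MP)^{q+1}J$; and $A_{2l-1}=(MP)^{l-1}MJ=\begin{bmatrix}1&1\\ 0&1\end{bmatrix}$. (III) $(4,m,\infty)$ with $m=6$, $K=\mathbb Q(\sqrt6)$, or $m=12$, $K=\mathbb Q(\sqrt3)$. Write $P_x=\begin{bmatrix}-1&x\\ 0&1\end{bmatrix}$, $M_x=\begin{bmatrix}1&0\\ x&-1\end{bmatrix}$. For $m=6$: $\alpha=3-\sqrt6$, $\beta=3+\sqrt6$, $\gamma=2-\sqrt6$, $\delta=-2-\sqrt6$. For $m=12$: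 $\alpha=1$, $\beta=2+\sqrt3$, $\gamma=1-\sqrt3$, $\delta=-1-\sqrt3$. Let $U_1=P_\gamma$, $U_2=P_\gamma M_\delta$, $U_3=P_\gamma M_\delta P_\gamma$; and, for $1\le j\le m-1$, $V_j=(M_\beta P_\alpha)^{j/2}$ if $j$ is even, $V_j=(M_\beta P_\alpha)^{(j-1)/2}M_\beta$ if $j$ is odd. Let $r=3(m-1)$, and put $(A_{3j-2},A_{3j-1},A_{3j})=(V_jU_3,V_jU_2,V_jU_1)$ if $j$ is odd, and $=(V_jU_1,V_jU_2,V_jU_3)$ if $j$ is even. **Symbolic orbits.** $\mathfrak A^\omega$ is the set of one-sided infinite sequences over $\mathfrak A$. A $T$-symbolic orbit of $x\in[0,\infty]$ is a sequence $c_0c_1\cdots\in\mathfrak A^\omega$ with $T^k(x)\in I_{c_k}$ for all $k\ge0$ (a point may have two). $\overline r=rrr\cdots$, $\overline1=111\cdots$. **The sets $E^\sharp$.** Let $'$ denote the nontrivial automorphism of $K$ and $\lor$ the maximum. A matrix $A=\begin{bmatrix}a&b\\ c&d\end{bmatrix}\in\mathrm{PSL}_2^\pm\mathbb O$ is positive if, up to multiplication by $-1$, all entries are $\ge0$, with at most one equal to $0$; we then write it with entries $\ge0$. All products of the $A_a$ used below are positive. For positive $A$ let $f_A(x)=\frac{(ax+b)\lor(cx+d)}{x\lor1}$ for $x\in[0,\infty]$ (with $f_A(\infty)=a\lor c$), $t(A)=(|a'|+|c'|)\lor(|b'|+|d'|)$, and $E^\sharp(A)=\{x\in[0,\infty]:f_A(x)>t(A)\}$.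 Closures and boundaries $\partial$ are taken in $[0,\infty]$. **Decreasing blocks.** A decreasing block is a finite word $b_0\cdots b_u$ over $\mathfrak A$ of length $u+1\ge2$ such that: (i) $b_0,b_u\ne r$; (ii) $I_{b_u}$ is contained in the closure of $E^\sharp(A)$, where $A=A_{b_0}\cdots A_{b_{u-1}}=\begin{bmatrix}a&b\\ c&d\end{bmatrix}$; (iii) if $A$ contains a $0$ entry and $\beta\in\partial E^\sharp(A)\cap\partial I_{b_u}$, then $t(A)\bigl(|a'\beta'+b'|\lor|c'\beta'+d'|\bigr)>|\beta'|\lor1$. *)

(* Defs.v *)
From HB Require Import structures.
From mathcomp Require Import all_boot all_order all_algebra all_field.
From mathcomp Require Import all_classical all_reals all_analysis.
From mathcomp Require Import complex.
Import Order.TTheory GRing.Theory Num.Theory.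
Import numFieldNormedType.Exports.

Set Implicit Arguments.
Unset Strict Implicit.
Unset Printing Implicit Defensive.

Local Open Scope classical_set_scope.
Local Open Scope ring_scope.

(* P^1 F = F + {oo}: [Some x] is the point [x, 1] and [None] is [1, 0].  For  *)
(* F = R the one-point compactification carries the usual topology.           *)
Definition P1 (F : Type) : Type := one_point_compactification F.

Definition mx2 {F : Type} (a b c d : F) : 'M[F]_2 :=
  \matrix_(i < 2, j < 2)
    if i == 0%N :> nat then (if j == 0%N :> nat then a else b)
    else (if j == 0%N :> nat then c else d).

(* Invariant under A |-> - A, so this is the action of PSL_2^{+-}.            *)
Definition moebius {F : fieldType} (A : 'M[F]_2) (x : P1 F) : P1 F :=
  let: (x1, x2) := if x is Some y then (y, 1) else (1, 0) in
  let u := A 0 0 * x1 + A 0 1 * x2 in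
  let v := A 1 0 * x1 + A 1 1 * x2 in
  if v == 0 then None else Some (u / v).

Definition I0 (R : realType) : set (P1 R) :=
  [set x | if x is Some y then 0 <= y else True].

Section Height.
Variables (R : realType) (K : fieldExtType rat).

Local Notation d := (\dim {:K}).

(* Each place is represented by its normalized function K -> R; distinct      *)
(* places have distinct functions.                                            *)
Definition real_embedding (phi : {rmorphism K -> R[i]}) : Prop :=
  forall x, complex.Im (phi x) = 0.

Definition arch_abs (phi : {rmorphism K -> R[i]}) (x : K) : R :=
  ComplexField.Normc.normc (phi x)
    `^ ((if `[< real_embedding phi >] then 1 else 2) / d%:R).

Definition nonarch_abs (v : K -> R) : Prop :=
  [/\ forall x, 0 <= v x,
      forall x, v x = 0 <-> x = 0,
      forall x y, v (x * y) = v x * v y &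
      forall x y, v (x + y) <= Num.max (v x) (v y)].

(* The elements of the completion K_P at v are the Cauchy sequences of K      *)
(* modulo null sequences; the closure Q_p of Q in it consists of the classes  *)
(* of the Cauchy sequences of rational numbers.                               *)
Definition cauchy_for (v : K -> R) (u : nat -> K) : Prop :=
  forall e : R, 0 < e ->
    exists N, forall m n, (N <= m)%N -> (N <= n)%N -> v (u m - u n) < e.

Definition null_for (v : K -> R) (u : nat -> K) : Prop :=
  (fun k => v (u k)) @ \oo --> (0 : R).

(* K_P is spanned over Q_p by (the classes of) n elements.                    *)
Definition spanned_by (v : K -> R) (n : nat) : Prop :=
  exists b : 'I_n -> nat -> K,
    (forall i, cauchy_for v (b i)) /\
    forall x, cauchy_for v x ->
      exists q : 'I_n -> nat -> rat,
        (forall i, cauchy_for v (fun k => (q i k)%:A)) /\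
        null_for v (fun k => x k - \sum_(i < n) q i k *: b i k).

(* [K_P : Q_p] = n                                                            *)
Definition local_degree (v : K -> R) (n : nat) : Prop :=
  spanned_by v n /\ forall m, spanned_by v m -> (n <= m)%N.

Definition places : set (K -> R) :=
  [set v | (exists phi, v = arch_abs phi) \/
    (nonarch_abs v /\
     exists p n, [/\ prime p, local_degree v n &
       v p%:R = p%:R `^ (- (n%:R / d%:R))])].

(* The product over an infinite set is the library's product over the indices *)
(* whose factor differs from 1.                                               *)
Definition height_coord (x1 x2 : K) : R :=
  \big[*%R/1]_(v \in places) Num.max (v x1) (v x2).

Definition weil_height (x : P1 K) : R :=
  if x is Some y then height_coord y 1 else height_coord 1 0.

End Height.

Inductive algorithm :=
  | I_2_5 | I_3_4 | I_3_5 | I_3_6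
  | II_4 | II_5 | II_6
  | III_6 | III_12.

(* K = Q(sqrt (radicand T))                                                   *)
Definition radicand (T : algorithm) : nat :=
  (match T with
  | I_2_5 => 5 | I_3_4 => 2 | I_3_5 => 5 | I_3_6 => 3
  | II_4 => 2 | II_5 => 5 | II_6 => 3
  | III_6 => 6 | III_12 => 3
  end)%N.

Definition nletters (T : algorithm) : nat :=
  let rI l m := ((l - 1) * (m - 1))%N in
  let rII l := (2 * l - 1)%N in
  let rIII m := (3 * (m - 1))%N in
  (match T with
  | I_2_5 => rI 2 5 | I_3_4 => rI 3 4 | I_3_5 => rI 3 5 | I_3_6 => rI 3 6
  | II_4 => rII 4 | II_5 => rII 5 | II_6 => rII 6
  | III_6 => rIII 6 | III_12 => rIII 12
  end)%N.

Section Algorithms.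
(* K is embedded in R by iota, and cj is its nontrivial automorphism.         *)
Variables (R : realType) (K : fieldExtType rat).
Variables (iota : {rmorphism K -> R}) (cj : {rmorphism K -> K}).

(* The element of K equal to the real number x.                               *)
Definition of_real (x : R) : K := xget 0 [set y | iota y = x].

Definition rt (n : nat) : K := of_real (Num.sqrt n%:R).
Definition lambda (k : nat) : K := of_real (2 * cos (pi / k%:R)).
Definition tau : K := (1 + rt 5) / 2.

Definition mxI (l m a : nat) : 'M[K]_2 :=
  let F := mx2 0 1 1 0 in
  let Q := mx2 (lambda l) 1 (- 1) 0 in
  let R := mx2 0 1 (- 1) (lambda m) in
  (* a = (i - 1)(l - 1) + j with 1 <= j < l *)
  let i := ((a - 1) %/ (l - 1) + 1)%N in
  let j := ((a - 1) %% (l - 1) + 1)%N in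
  if odd a then R ^+ i * Q ^+ j * F else R ^+ i * Q ^+ j.

Definition mxII (beta : K) (a : nat) : 'M[K]_2 :=
  let J := mx2 (- 1) 0 0 1 in
  let P := mx2 (- 1) 1 0 1 in
  let M := mx2 1 0 beta (- 1) in
  (* a = 1 + 2q or a = 2 + 2q *)
  let q := ((a - 1) %/ 2)%N in
  if odd a then (M * P) ^+ q * M * J else (M * P) ^+ q.+1 * J.

Definition mxIII (alpha beta gamma delta : K) (a : nat) : 'M[K]_2 :=
  let P x := mx2 (- 1) x 0 1 in
  let M x := mx2 1 0 x (- 1) in
  let U1 := P gamma in
  let U2 := P gamma * M delta in
  let U3 := P gamma * M delta * P gamma in
  (* a = 3j - 2 + s with s in {0, 1, 2} *)
  let j := ((a - 1) %/ 3 + 1)%N in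
  let s := ((a - 1) %% 3)%N in
  let V := if odd j then (M beta * P alpha) ^+ ((j - 1) %/ 2) * M beta
           else (M beta * P alpha) ^+ (j %/ 2) in
  V * nth 0 (if odd j then [:: U3; U2; U1] else [:: U1; U2; U3]) s.

(* A lift to a matrix of A_a, for 1 <= a <= nletters T.                       *)
Definition mxA (T : algorithm) (a : nat) : 'M[K]_2 :=
  match T with
  | I_2_5 => mxI 2 5 a | I_3_4 => mxI 3 4 a
  | I_3_5 => mxI 3 5 a | I_3_6 => mxI 3 6 a
  | II_4 => mxII (2 + rt 2) a
  | II_5 => mxII (2 + tau) a
  | II_6 => mxII (2 + rt 3) a
  | III_6 => mxIII (3 - rt 6) (3 + rt 6) (2 - rt 6) (- 2 - rt 6) a
  | III_12 => mxIII 1 (2 + rt 3) (1 - rt 3) (- 1 - rt 3) a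
  end.

Definition real_point (x : P1 K) : P1 R := omap iota x.

Definition itvA (T : algorithm) (a : nat) : set (P1 R) :=
  moebius (map_mx iota (mxA T a)) @` @I0 R.

Definition letter (T : algorithm) (a : nat) : bool := (0 < a <= nletters T)%N.

(* The map of the algorithm, on the K-rational points of [0, oo]; at a common *)
(* endpoint of two intervals the first of their two matrices is used.  The    *)
(* value outside [0, oo] is irrelevant.                                       *)
Definition Tmap (T : algorithm) (x : P1 K) : P1 K :=
  if [seq a <- seq.iota 1 (nletters T) | `[< itvA T a (real_point x) >]]
    is a :: _ then moebius (invmx (mxA T a)) x else x.

Definition symbolic_orbit (T : algorithm) (x : P1 K) (c : nat -> nat) : Prop :=
  forall k, letter T (c k) /\ itvA T (c k) (real_point (iter k (Tmap T) x)).

(* For A positive up to sign, its representative with entries >= 0.           *)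
Definition pos_rep (A : 'M[K]_2) : 'M[K]_2 :=
  if [forall i, forall j, 0 <= iota (A i j)] then A else - A.

Definition f_of (A : 'M[K]_2) (x : P1 R) : R :=
  let B := map_mx iota (pos_rep A) in
  if x is Some y then
    Num.max (B 0 0 * y + B 0 1) (B 1 0 * y + B 1 1) / Num.max y 1
  else Num.max (B 0 0) (B 1 0).

Definition conj_abs (x : K) : R := `|iota (cj x)|.

Definition t_of (A : 'M[K]_2) : R :=
  Num.max (conj_abs (A 0 0) + conj_abs (A 1 0))
          (conj_abs (A 0 1) + conj_abs (A 1 1)).

Definition E_sharp (A : 'M[K]_2) : set (P1 R) :=
  [set x | @I0 R x /\ t_of A < f_of A x].

(* [0, oo] is closed in P^1 R, so the closure in [0, oo] of a subset of       *)
(* [0, oo] is its closure in P^1 R; the boundary does depend on the ambient   *)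
(* space: 0 and oo are not boundary points of their neighbourhoods in [0, oo].*)
Definition closure_I0 (S : set (P1 R)) : set (P1 R) :=
  @closure (one_point_compactification R) S.
Definition boundary_I0 (S : set (P1 R)) : set (P1 R) :=
  closure_I0 S `&` closure_I0 (@I0 R `\` S).

(* In the last condition beta ranges over K: the boundary points of the       *)
(* interval of b_u are in P^1 K, and they are finite since b_u <> r.          *)
Definition decreasing_block (T : algorithm) (b : seq nat) : Prop :=
  let r := nletters T in
  let bu := last 0%N b in
  let A := \prod_(c <- take (size b).-1 b) mxA T c in
  [/\ (2 <= size b)%N /\ all (letter T) b,
      head 0%N b <> r /\ bu <> r,
      itvA T bu `<=` closure_I0 (E_sharp A) &
      (exists i j, A i j = 0) ->
      forall beta : K,
        (boundary_I0 (E_sharp A) `&` boundary_I0 (itvA T bu)) (Some (iota beta)) ->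
        t_of A * Num.max (conj_abs (A 0 0 * beta + A 0 1))
                         (conj_abs (A 1 0 * beta + A 1 1))
          > Num.max (conj_abs beta) 1].

End Algorithms.

(* Main.v *)
Require Import Defs.
From Stdlib Require Import ZArith.
From mathcomp Require Import ssrZ.
From HB Require Import structures.
From mathcomp Require Import all_boot all_order all_algebra all_field.
From mathcomp Require Import all_classical all_reals all_analysis.
From mathcomp Require Import complex.
From mathcomp Require Import zify ring lra.
Import Order.TTheory GRing.Theory Num.Theory.
Import numFieldNormedType.Exports.

(* Write [x = x_k], [y = x_(k+1)], so that [x = A y] where [A] is the product *)
(* of the matrices of the letters of the block, in [GL_2] of the integers.    *)
(* The finite places contribute equally to [H x] and [H y] once homogeneous   *)
(* coordinates are rescaled by the product formula, whence                    *)
(*   (H x / H y)^2 = f_A(y) * max(|a'y'+b'|, |c'y'+d'|) / max(|y'|, 1),       *)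
(* where the last quotient is at least [1 / t(A)], as one sees by applying    *)
(* the inverse of [A'], and [f_A(y) >= t(A)] because [y] lies in the closure  *)
(* of E^sharp.  In the case of equality [f_A(y) = t(A)].  Since [f_A]         *)
(* increases on [0, 1] and decreases on [1, oo], a point [y <> 0] is then a   *)
(* common boundary point of E^sharp and of the interval of the last letter,   *)
(* and either condition (iii) applies, or [|x'| = 1], so that [x = 1],        *)
(* [H y = 1], [y = 1], and E^sharp is empty.  There remains [y = 0], where    *)
(* [H x = 1] forces [x = 1]; the orbit of [0] cannot start a further block.   *)
(*                                                                            *)
(* For the product formula, the places above [p] are found from the fact that *)
(* the values of an absolute value at [x] and its conjugate are determined by *)
(* the trace and the norm of [x], and the product at [x] is the square root   *)
(* of the product at the norm of [x].                                         *)

Set Implicit Arguments.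
Unset Strict Implicit.
Unset Printing Implicit Defensive.

Local Open Scope ring_scope.

(** * Ultrametric absolute values *)

(** The argument compares the two ends of one block. By [orbit_prod] the block gives x = A y, and by
    [good_mx_prod] the matrix A is, up to sign, a non-negative integral matrix of determinant 1 or
    -1. The squared height splits into the archimedean factor [arch_size] and the squared finite
    factor [fin_size] ([height_coord_sq]). The finite factor is invariant under such matrices
    ([fin_size_GL]), and homogeneous coordinates may be rescaled freely by the product formula
    ([nonarch_product], [height_coordZ]). What remains is a comparison of real numbers: under the
    first embedding the size is multiplied by f_A(y), by condition (ii) at least t(A)
    ([closure_E_ge]); under the conjugate one it shrinks by a factor of at most t(A)
    ([conj_size_le]). Hence H y <= H x ([height_cmp]).

    Equality forces both estimates to be sharp. [block_compare] shows that this leaves only x = 1, y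
    = 0: at any other y the sharpness of f_A makes y a boundary point ([boundary_of_eq]), and then
    either condition (iii) or the equality case of the triangle inequality ([conj_size_eq]) gives a
    contradiction. As no block starts at 0 ([block_start_neq0]), equality can occur only at the last
    index.

    Two inputs are built from the definitions. The product formula requires all places above a prime
    p: absolute values extend from Q to K ([ultra_ext_exists]), uniquely up to conjugation
    ([ultra_ext_unique]), and the local degree is 2 or 1 according to conjugation invariance
    ([local_degreeE]); [nonarch_above] assembles this. The geometry of the nine families of
    intervals is reduced to integer computations in Z[theta] ([chkT], transferred by [mxA_mev]),
    from which [Tmap_branch] shows that every letter of a symbolic orbit inverts the map, even at
    common endpoints. *)

Lemma pow_small (R : realType) (c e : R) : 0 <= c -> c < 1 -> 0 < e ->
  exists N, forall n, (N <= n)%N -> c ^+ n < e.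
Proof.
move=> c0 c1 e0.
have /cvgrPdist_lt/(_ _ e0)[N _ HN] : (c ^+ n @[n --> \oo] --> (0 : R))%classic.
  by apply: cvg_expr; rewrite ger0_norm.
exists N => n /HN /=; rewrite sub0r normrN ger0_norm //; exact: exprn_ge0.
Qed.

Section UltraAbs.
Variables (R : realFieldType) (F : fieldType).

Definition ultra_abs (v : F -> R) : Prop :=
  [/\ forall x, 0 <= v x,
      forall x, v x = 0 <-> x = 0,
      forall x y, v (x * y) = v x * v y &
      forall x y, v (x + y) <= Num.max (v x) (v y)].

Variables (v : F -> R) (hv : ultra_abs v).

Lemma ultra_ge0 x : 0 <= v x. Proof. by case: hv. Qed.
Lemma ultra0 : v 0 = 0. Proof. by case: hv => _ h _ _; apply/h. Qed.
Lemma ultra_neq0 x : x != 0 -> v x != 0.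
Proof. by case: hv => _ h _ _ /eqP x0; apply/eqP => /h. Qed.
Lemma ultra_gt0 x : x != 0 -> 0 < v x.
Proof. by move=> x0; rewrite lt_def ultra_neq0 // ultra_ge0. Qed.
Lemma ultraM x y : v (x * y) = v x * v y. Proof. by case: hv. Qed.
Lemma ultraD x y : v (x + y) <= Num.max (v x) (v y). Proof. by case: hv. Qed.
Lemma ultra1 : v 1 = 1.
Proof.
have h := ultraM 1 1; rewrite mulr1 in h.
by apply: (mulfI (ultra_neq0 (oner_neq0 F))); rewrite -h mulr1.
Qed.
Lemma ultraN x : v (- x) = v x.
Proof.
have hN : v (-1) = 1.
  have := ultraM (-1) (-1); rewrite mulrNN mulr1 ultra1 => /esym/eqP.
  rewrite -expr2 sqrf_eq1 => /orP[/eqP//|/eqP h].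
  by have := ultra_ge0 (-1); rewrite h oppr_ge0 ler10.
by rewrite -mulN1r ultraM hN mul1r.
Qed.
Lemma ultraB x y : v (x - y) <= Num.max (v x) (v y).
Proof. by rewrite -(ultraN y) ultraD. Qed.
Lemma ultraBC x y : v (x - y) = v (y - x).
Proof. by rewrite -ultraN opprB. Qed.
Lemma ultraV x : v x^-1 = (v x)^-1.
Proof.
have [->|x0] := eqVneq x 0; first by rewrite invr0 ultra0 invr0.
by apply: (mulfI (ultra_neq0 x0)); rewrite -ultraM !divff ?ultra1 ?ultra_neq0.
Qed.
Lemma ultraX x n : v (x ^+ n) = v x ^+ n.
Proof. by elim: n => [|n IH]; rewrite ?expr0 ?ultra1 // !exprS ultraM IH. Qed.
Lemma ultra_nat n : v n%:R <= 1.
Proof.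
elim: n => [|n IH]; first by rewrite ultra0.
by rewrite -addn1 natrD (le_trans (ultraD _ _)) // ge_max IH /= ultra1.
Qed.
Lemma ultra_int (n : int) : v n%:~R <= 1.
Proof. by case: n => n; rewrite ?NegzE ?mulrNz ?ultraN -pmulrn ultra_nat. Qed.
Lemma ultraD_lt x y : v y < v x -> v (x + y) = v x.
Proof.
move=> yx; apply/le_anti; rewrite (le_trans (ultraD _ _)) ?ge_max ?lexx ?(ltW yx) //=.
have := ultraB (x + y) y; rewrite addrK le_max => /orP[//|h].
by rewrite ltNge h in yx.
Qed.
Lemma ultraD_le x y r : v x <= r -> v y <= r -> v (x + y) <= r.
Proof. by move=> h1 h2; rewrite (le_trans (ultraD _ _)) // ge_max h1. Qed.
Lemma ultraD_ltr x y r : v x < r -> v y < r -> v (x + y) < r.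
Proof. by move=> h1 h2; rewrite (le_lt_trans (ultraD _ _)) // gt_max h1. Qed.
Lemma ultraB_ltr x y r : v x < r -> v y < r -> v (x - y) < r.
Proof. by move=> h1 h2; apply: ultraD_ltr; rewrite ?ultraN. Qed.

(** By Bezout, if p and m both had value below 1, so would 1. *)
Lemma ultra_coprime (p m : nat) : v p%:R < 1 -> coprime p m -> v m%:R = 1.
Proof.
move=> vp cop; apply/le_anti; rewrite ultra_nat /= leNgt; apply/negP => vm.
have := cop; case: p => [|p] in vp cop *.
  by rewrite /coprime gcd0n => /eqP m1; rewrite m1 ultra1 ltxx in vm.
move=> _.
case: (@egcdnP p.+1 m isT) => km kn e _.
have : v ((km * p.+1)%:R - (kn * m)%:R) < 1.
  apply: ultraB_ltr; rewrite natrM ultraM.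
    rewrite (le_lt_trans _ vp) // ler_piMl ?ultra_ge0 ?ultra_nat //.
  rewrite (le_lt_trans _ vm) // ler_piMl ?ultra_ge0 ?ultra_nat //.
rewrite e (eqP cop) natrD addrAC subrr add0r ultra1 ltxx //.
Qed.

End UltraAbs.

(** * The p-adic absolute value on the rationals *)

Section Padic.
Variables (R : realFieldType) (p : nat).
Hypothesis pp : prime p.

Definition padic (q : rat) : R :=
  if q == 0 then 0
  else p%:R ^- logn p `|numq q|%N * p%:R ^+ logn p `|denq q|%N.

Let p0 : (p%:R : R) != 0. Proof. by rewrite pnatr_eq0 -lt0n prime_gt0. Qed.
Let pg1 : 1 < (p%:R : R). Proof. by rewrite ltr1n prime_gt1. Qed.

Lemma padic_frac (n d : int) : n != 0 -> d != 0 ->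
  padic (n%:~R / d%:~R) = p%:R ^- logn p `|n|%N * p%:R ^+ logn p `|d|%N.
Proof.
move=> n0 d0; set q := _ / _.
have q0 : q != 0 by rewrite /q mulf_neq0 ?invr_eq0 ?intr_eq0.
rewrite /padic (negbTE q0).
have e : (n * denq q = numq q * d)%R.
  apply: (@intr_inj rat); rewrite !rmorphM /=.
  have := divq_num_den q; rewrite {3}/q => /eqP.
  rewrite eqr_div ?intr_eq0 ?denq_neq0 // => /eqP ->.
  by rewrite mulrC.
have /(congr1 (logn p)) := congr1 absz e.
rewrite !abszM !lognM ?absz_gt0 ?denq_neq0 ?numq_eq0 // => el.
apply: (mulfI (expf_neq0 (logn p `|n|%N) p0)).
by rewrite [RHS]mulrA divff ?expf_neq0 // mul1r mulrCA -exprD el exprD mulKf ?expf_neq0.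
Qed.

(** Over a common denominator the ultrametric inequality says that a power of p dividing two
    integers divides their sum. *)
Lemma padic_ultra : ultra_abs padic.
Proof.
have pos x : x != 0 -> 0 < padic x.
  by move=> x0; rewrite /padic (negbTE x0) mulr_gt0 ?invr_gt0 ?exprn_gt0 // ltr0n prime_gt0.
have p0E : padic 0 = 0 by rewrite /padic eqxx.
have frac x : x = (numq x)%:~R / (denq x)%:~R :> rat by rewrite divq_num_den.
split.
- by move=> x; have [->|/pos/ltW//] := eqVneq x 0; rewrite p0E.
- move=> x; split=> [|->//]; have [//|/pos] := eqVneq x 0.
  by move=> h e; rewrite e ltxx in h.
- move=> x y.
  have [->|x0] := eqVneq x 0; first by rewrite mul0r p0E mul0r.
  have [->|y0] := eqVneq y 0; first by rewrite mulr0 p0E mulr0.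
  rewrite (_ : x * y = (numq x * numq y)%:~R / (denq x * denq y)%:~R); last first.
    by rewrite {1}(frac x) {1}(frac y) !intrM mulf_div.
  rewrite padic_frac ?mulf_neq0 ?denq_neq0 ?numq_eq0 //.
  rewrite !abszM !lognM ?absz_gt0 ?denq_neq0 ?numq_eq0 // !exprD.
  by rewrite /padic (negbTE x0) (negbTE y0) invfM mulrACA.
- move=> x y.
  have [->|x0] := eqVneq x 0; first by rewrite add0r p0E le_max lexx orbT.
  have [->|y0] := eqVneq y 0; first by rewrite addr0 p0E le_max lexx.
  have [->|s0] := eqVneq (x + y) 0; first by rewrite p0E le_max ltW ?pos.
  pose c := denq x * denq y; pose a := numq x * denq y; pose b := numq y * denq x.
  have c0 : c != 0 by rewrite mulf_neq0 ?denq_neq0.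
  have a0 : a != 0 by rewrite mulf_neq0 ?denq_neq0 ?numq_eq0.
  have b0 : b != 0 by rewrite mulf_neq0 ?denq_neq0 ?numq_eq0.
  have xE : x = a%:~R / c%:~R.
    by rewrite /a /c !intrM -mulf_div divff ?mulr1 -?frac // intr_eq0 denq_neq0.
  have yE : y = b%:~R / c%:~R.
    rewrite /b /c [denq x * _]mulrC !intrM -mulf_div divff ?mulr1 -?frac //.
    by rewrite intr_eq0 denq_neq0.
  have sE : x + y = (a + b)%:~R / c%:~R by rewrite xE yE intrD mulrDl.
  have ab0 : a + b != 0.
    by apply: contra_neq s0 => e; rewrite sE e mul0r.
  rewrite sE xE yE !padic_frac //.
  set C := p%:R ^+ logn p `|c|%N; have C0 : 0 < C by rewrite exprn_gt0 // ltr0n prime_gt0.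
  rewrite -maxr_pMl ?(ltW C0) // ler_pM2r // le_max.
  have mono m k : (k <= m)%N -> (p%:R ^- m : R) <= p%:R ^- k.
    by move=> km; rewrite lef_pV2 ?posrE ?exprn_gt0 ?ltr0n ?prime_gt0 // ler_weXn2l // ltW.
  have key k : (k <= logn p `|a|%N)%N -> (k <= logn p `|b|%N)%N -> (k <= logn p `|(a + b)%R|%N)%N.
    rewrite -!pfactor_dvdn ?absz_gt0 // => ka kb.
    have : (((p ^ k)%N%:Z) %| (a + b))%Z by rewrite rpredD // dvdzE.
    by rewrite dvdzE.
  case: (leqP (logn p `|a|%N) (logn p `|b|%N)) => h.
    by rewrite mono //; apply: key.
  by rewrite [X in _ || X]mono ?orbT //; apply: key => //; rewrite ltnW.
Qed.

Lemma padic_p : padic p%:R = p%:R^-1.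
Proof.
have -> : (p%:R : rat) = (p%:Z)%:~R / (1%:Z)%:~R by rewrite divr1.
rewrite padic_frac //=; last by rewrite -lt0n prime_gt0.
by rewrite logn_prime // eqxx logn1 expr1 expr0 mulr1.
Qed.

(** Integers prime to p have value 1, so the value at p decides everything. *)
Lemma ultra_rat_unique (w u : rat -> R) : ultra_abs w -> ultra_abs u ->
  w p%:R = u p%:R -> w p%:R < 1 -> w =1 u.
Proof.
move=> hw hu e wp.
have nat_eq (m : nat) : w m%:R = u m%:R.
  have [->|m0] := posnP m; first by rewrite !ultra0.
  case: (@pfactor_coprime p m pp m0) => m' cop ->.
  rewrite natrM natrX (ultraM hw) (ultraM hu) (ultraX hw) (ultraX hu) e.
  by rewrite (ultra_coprime hw wp cop) (ultra_coprime hu _ cop) // -e.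
have int_eq (m : int) : w m%:~R = u m%:~R.
  by case: m => m; rewrite ?NegzE ?mulrNz ?(ultraN hw) ?(ultraN hu) -?pmulrn.
by move=> q; rewrite -(divq_num_den q) (ultraM hw) (ultraM hu) (ultraV hw) (ultraV hu) !int_eq.
Qed.

End Padic.

(** * Extension to a quadratic field *)

(** The Galois-theoretic form in which quadraticity enters the study of absolute values;
    [quad_conjP] supplies it. *)
Definition quad_conj (K : fieldExtType rat) (cj : {rmorphism K -> K}) : Prop :=
  [/\ forall x, cj (cj x) = x,
      forall x, cj x = x -> exists q : rat, x = q%:A &
      exists x, cj x <> x].

Section Quadratic.
Variables (R : realType) (K : fieldExtType rat) (cj : {rmorphism K -> K}).
Hypothesis hcj : quad_conj cj.

Lemma cjK x : cj (cj x) = x. Proof. by case: hcj. Qed.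
Lemma cj_rat (q : rat) : cj q%:A = q%:A.
Proof. by rewrite -!in_algE -[LHS]/((cj \o in_alg K) q) !fmorph_eq_rat. Qed.
Lemma ratA_inj (p q : rat) : p%:A = q%:A :> K -> p = q.
Proof. by move=> /(fmorph_inj (in_alg K)). Qed.
Lemma ratAM (p q : rat) : (p * q)%:A = p%:A * q%:A :> K.
Proof. exact: (rmorphM (in_alg K)). Qed.
Lemma ratAD (p q : rat) : (p + q)%:A = p%:A + q%:A :> K.
Proof. exact: (rmorphD (in_alg K)). Qed.
Lemma ratAB (p q : rat) : (p - q)%:A = p%:A - q%:A :> K.
Proof. exact: (rmorphB (in_alg K)). Qed.
Lemma ratAN (p : rat) : (- p)%:A = - p%:A :> K.
Proof. exact: (rmorphN (in_alg K)). Qed.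
Lemma ratAn (n : nat) : (n%:R : rat)%:A = n%:R :> K.
Proof. exact: (rmorph_nat (in_alg K)). Qed.
Lemma ratA1 : (1 : rat)%:A = 1 :> K. Proof. exact: scale1r. Qed.
Lemma ratA0 : (0 : rat)%:A = 0 :> K. Proof. exact: scale0r. Qed.
Lemma scaleQ (q : rat) (x : K) : q *: x = q%:A * x.
Proof. by rewrite -scalerAl mul1r. Qed.

Lemma natK_neq0 (n : nat) : (0 < n)%N -> n%:R != 0 :> K.
Proof.
by move=> n0; rewrite -ratAn -ratA0; apply/eqP => /ratA_inj /eqP; rewrite pnatr_eq0 => /eqP e; rewrite e in n0.
Qed.

Definition tr (x : K) : rat := xget 0 [set q : rat | x + cj x = q%:A]%classic.
Definition nm (x : K) : rat := xget 0 [set q : rat | x * cj x = q%:A]%classic.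

Lemma trE x : (tr x)%:A = x + cj x.
Proof.
rewrite /tr; case: xgetP => [q _ /= -> //|h].
have [|q hq] := (let: And3 _ h _ := hcj in h) (x + cj x).
  by rewrite rmorphD /= cjK addrC.
by case: (h q).
Qed.
Lemma nmE x : (nm x)%:A = x * cj x.
Proof.
rewrite /nm; case: xgetP => [q _ /= -> //|h].
have [|q hq] := (let: And3 _ h _ := hcj in h) (x * cj x).
  by rewrite rmorphM /= cjK mulrC.
by case: (h q).
Qed.

Lemma nmM x y : nm (x * y) = nm x * nm y.
Proof. by apply: ratA_inj; rewrite ratAM !nmE rmorphM mulrACA. Qed.
Lemma nm1 : nm 1 = 1. Proof. by apply: ratA_inj; rewrite nmE rmorph1 mulr1 ratA1. Qed.
Lemma nmX x n : nm (x ^+ n) = nm x ^+ n.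
Proof. by elim: n => [|n IH]; rewrite ?expr0 ?nm1 // !exprS nmM IH. Qed.
Lemma nm_eq0 x : (nm x == 0) = (x == 0).
Proof.
apply/eqP/eqP => [h|->]; last by apply: ratA_inj; rewrite nmE mul0r ratA0.
by move/eqP: (nmE x); rewrite h ratA0 eq_sym mulf_eq0 fmorph_eq0 orbb => /eqP.
Qed.
Lemma nm_rat (q : rat) : nm q%:A = q ^+ 2.
Proof. by apply: ratA_inj; rewrite nmE cj_rat expr2 ratAM. Qed.
Lemma trD x y : tr (x + y) = tr x + tr y.
Proof. by apply: ratA_inj; rewrite ratAD !trE rmorphD addrACA. Qed.
Lemma trZ (q : rat) x : tr (q%:A * x) = q * tr x.
Proof. by apply: ratA_inj; rewrite ratAM !trE rmorphM cj_rat mulrDr. Qed.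
Lemma nmD x y : nm (x + y) = nm x + tr (x * cj y) + nm y.
Proof.
apply: ratA_inj; rewrite !ratAD !nmE trE !rmorphD rmorphM /= cjK mulrDl !mulrDr.
by rewrite [cj x * y]mulrC !addrA.
Qed.

Section OneAbs.
Variables (v : K -> R) (hv : ultra_abs v).

Lemma ultra_restr : ultra_abs (fun q : rat => v q%:A).
Proof.
split=> [x|x|x y|x y]; first exact: ultra_ge0.
- split=> [|->]; last by rewrite ratA0 ultra0.
  by case: hv => _ h _ _ /h; rewrite -ratA0 => /ratA_inj.
- by rewrite ratAM ultraM.
- by rewrite ratAD ultraD.
Qed.

Lemma ultra_cj : ultra_abs (v \o cj).
Proof.
split=> [x|x|x y|x y] /=; first exact: ultra_ge0.
- split=> [|->]; last by rewrite rmorph0 ultra0.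
  by case: hv => _ h _ _ /h /eqP; rewrite fmorph_eq0 => /eqP.
- by rewrite rmorphM ultraM.
- by rewrite rmorphD ultraD.
Qed.

Lemma ultra_nm x : v (nm x)%:A = v x * v (cj x).
Proof. by rewrite nmE ultraM. Qed.

(** If the values at x and its conjugate differ, the larger one is that of the trace; if they agree,
    their square is the value of the norm and the trace is no larger. *)
Lemma ultra_max_tr_nm x :
  Num.max (v x) (v (cj x)) ^+ 2 = Num.max (v (tr x)%:A ^+ 2) (v (nm x)%:A).
Proof.
have g0 := ultra_ge0 hv.
rewrite ultra_nm trE; case: (ltgtP (v x) (v (cj x))) => h.
- rewrite addrC (ultraD_lt hv h); apply/esym/max_idPl.
  by rewrite expr2 ler_wpM2r // ltW.
- rewrite (ultraD_lt hv h); apply/esym/max_idPl.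
  by rewrite expr2 ler_wpM2l // ltW.
- rewrite -h -expr2; apply/esym/max_idPr.
  rewrite lerXn2r ?nnegrE // (le_trans (ultraD hv _ _)) // -h maxxx //.
Qed.
End OneAbs.

Lemma max_mul_eq (a b c d : R) : Num.max a b = Num.max c d -> a * b = c * d ->
  0 < a -> 0 < b -> a = c \/ a = d.
Proof.
move=> hm hp a0 b0; case: (leP a b) hm; case: (leP c d) => _ _ h; subst.
- by left; apply: (mulIf (lt0r_neq0 b0)).
- by right; apply: (mulIf (lt0r_neq0 b0)); rewrite hp mulrC.
- by right.
- by left.
Qed.

(* For each x the two values at x and its conjugate are determined by the     *)
(* trace and the norm; the x with w x = v x and those with w x = v (cj x) are *)
(* two multiplicative subgroups covering K^*, so that one of them is K^*.     *)
Lemma ultra_ext_unique (v w : K -> R) : ultra_abs v -> ultra_abs w ->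
  (forall q : rat, v q%:A = w q%:A) -> w =1 v \/ w =1 v \o cj.
Proof.
move=> hv hw e.
have pt x : w x = v x \/ w x = v (cj x).
  have [->|x0] := eqVneq x 0; first by left; rewrite !ultra0.
  have cx0 : cj x != 0 by rewrite fmorph_eq0.
  apply: (@max_mul_eq _ (w (cj x))); rewrite -?(ultra_nm hw) -?(ultra_nm hv) -?e ?ultra_gt0 //.
  apply: (pexpIrn (n := 2)); rewrite ?nnegrE ?le_max ?ultra_ge0 //.
  by rewrite (ultra_max_tr_nm hw) (ultra_max_tr_nm hv) !e.
have [h|/existsNP[y hy]] := pselect (forall x, w x = v x); first by left.
right=> x /=; have [//|hx] : w x = v (cj x) \/ w x = v x by case: (pt x); [right|left].
have [->|x0] := eqVneq x 0; first by rewrite rmorph0 !ultra0.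
have y0 : y != 0 by apply/eqP => y0; apply: hy; rewrite y0 !ultra0.
have hy' : w y = v (cj y) by case: (pt y).
have := pt (x * y); rewrite rmorphM (ultraM hw) !(ultraM hv) hx hy'.
case=> [/(mulfI (ultra_neq0 hv x0)) h|/(mulIf _) ->//]; last first.
  by rewrite ultra_neq0 // fmorph_eq0.
by case: hy; rewrite hy' h.
Qed.

(** * Existence of an extension from Q to K *)

Section Existence.
Variables (a : rat -> R) (ha : ultra_abs a).

(** The classical formula for a unique extension. The hypothesis, applied to the mixed term tr (b *
    cj d) in the norm of b + d, is exactly what the ultrametric inequality needs. *)
Lemma ultra_ext_nonsplit : (forall x, a (tr x) ^+ 2 <= a (nm x)) ->
  ultra_abs (fun x => Num.sqrt (a (nm x))).
Proof.
move=> H; have g0 := ultra_ge0 ha; split=> [x|x|x y|x y].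
- exact: sqrtr_ge0.
- split=> [/eqP|->].
    rewrite sqrtr_eq0 => h; apply/eqP; rewrite -nm_eq0; apply/eqP.
    by case: (ha) => _ h1 _ _; apply/(h1 _).1/le_anti; rewrite h g0.
  by rewrite (_ : nm 0 = 0) ?(ultra0 ha) ?sqrtr0 //; apply/eqP; rewrite nm_eq0.
- by rewrite nmM (ultraM ha) sqrtrM.
- have key b c : 0 <= c -> a (nm b) <= c -> forall d, a (nm d) <= c ->
    Num.sqrt (a (nm (b + d))) <= Num.sqrt c.
    move=> c0 hb d hd; rewrite ler_wsqrtr // nmD.
    apply: (ultraD_le ha) => //; apply: (ultraD_le ha) => //.
    rewrite -(@ler_pXn2r _ 2) ?nnegrE // (le_trans (H _)) // nmM (ultraM ha) expr2.
    by rewrite ler_pM // (_ : nm (cj d) = nm d) //; apply: ratA_inj; rewrite !nmE cjK mulrC.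
  rewrite le_max; case: (leP (a (nm x)) (a (nm y))) => h.
    by rewrite (key x (a (nm y)) (g0 _) h y) ?orbT.
  by rewrite (key x (a (nm x)) (g0 _) _ y) // ltW.
Qed.

Section Split.
Variables (z : K) (tz : tr z = 1) (nz : a (nm z) < 1).

Let m := nm z.
(** The value of this sequence is eventually constant, and its eventual value [w] is the extension
    sought. *)
Let u (x : K) n := tr (x * z ^+ n).

Let cz : cj z = 1 - z.
Proof. by rewrite -ratA1 -tz trE addrC addKr. Qed.

Let uS x n : u x n.+2 = u x n.+1 - m * u x n.
Proof.
apply: ratA_inj; rewrite ratAB ratAM !trE nmE !rmorphM !rmorphXn /= cz !exprS.
ring.
Qed.

(** The quadratic form Y^2 - X Y + m X^2 attached to the recurrence [uS] is multiplied by m at each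
    step, starting from nm x * (4 m - 1). *)
Let u_disc x n :
  u x n.+1 ^+ 2 - u x n * u x n.+1 + m * u x n ^+ 2 = nm x * m ^+ n * (4 * m - 1).
Proof.
apply: ratA_inj; rewrite !expr2 !(ratAD, ratAB, ratAM) -nmX !trE !nmE !rmorphM !rmorphXn /=.
rewrite !ratAN ratA1 !ratAM !trE !rmorphM !rmorphXn /= cz !exprS.
ring.
Qed.

Let am4 : a (4 * m - 1) = 1.
Proof.
rewrite (ultraBC ha) (ultraD_lt ha) ?(ultraN ha) ?(ultra1 ha) //.
rewrite (ultraM ha) (le_lt_trans _ nz) // ler_piMl ?(ultra_ge0 ha) //.
exact: (ultra_nat ha).
Qed.

(** Otherwise a (u x n) would decay like (a m)^n, and the left side of [u_disc] like (a m)^(2 n),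
    whereas the right side has exact order (a m)^n. *)
Let u_grow x : x != 0 -> exists n, a m * a (u x n) < a (u x n.+1).
Proof.
move=> x0; apply: contrapT => /forallNP h.
have g0 := ultra_ge0 ha.
have {}h n : a (u x n.+1) <= a m * a (u x n) by rewrite leNgt; apply/negP/h.
have hn n : a (u x n) <= a m ^+ n * a (u x 0%N).
  elim: n => [|n IH]; first by rewrite expr0 mul1r.
  by rewrite (le_trans (h _)) // exprS -mulrA ler_wpM2l.
have b n : a (nm x) * a m ^+ n <= a m * a (u x n) ^+ 2.
  have := congr1 a (u_disc x n).
  rewrite [in RHS](ultraM ha) am4 mulr1 (ultraM ha) (ultraX ha) => <-.
  have m2 : a m * a m <= a m by rewrite ler_piMl // ltW.
  apply: (ultraD_le ha); last by rewrite (ultraM ha) (ultraX ha).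
  rewrite (le_trans (ultraB ha _ _)) // ge_max (ultraX ha) (ultraM ha) !expr2; apply/andP; split.
    rewrite (le_trans (ler_pM _ _ (h n) (h n))) // mulrACA ler_wpM2r //.
    by rewrite mulr_ge0.
  by rewrite (le_trans (ler_wpM2l _ (h n))) // mulrCA.
have m0 : m != 0.
  rewrite /m nm_eq0; apply/eqP => z0; move: tz; rewrite z0 => e.
  by have := congr1 (fun q => q%:A : K) e; rewrite /= trE rmorph0 addr0 ratA1 => /eqP; rewrite eq_sym oner_eq0.
have nx0 : nm x != 0 by rewrite nm_eq0.
have C0 : 0 < a (nm x) / (a (u x 0%N) ^+ 2 + 1).
  by rewrite divr_gt0 ?(ultra_gt0 ha) // ltr_wpDl // exprn_ge0.
have [N /(_ _ (leqnSn N))] := pow_small (g0 m) nz C0.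
rewrite ltr_pdivlMr ?ltr_wpDl ?exprn_ge0 //.
apply/negP; rewrite -leNgt.
have mn : 0 < a m ^+ N by rewrite exprn_gt0 // (ultra_gt0 ha).
rewrite -(ler_pM2r mn) (le_trans (b N)) //.
have : a (u x N) ^+ 2 <= (a m ^+ N * a (u x 0%N)) ^+ 2.
  by rewrite lerXn2r ?nnegrE // mulr_ge0 // exprn_ge0.
move=> /(ler_wpM2l (g0 m)) /le_trans; apply.
set t := a m; set w := a (u x 0%N).
rewrite -subr_ge0 (_ : _ - _ = t * (t ^+ N) ^+ 2); last by rewrite [in LHS]exprS; ring.
by rewrite mulr_ge0 ?sqr_ge0 //; exact: g0.
Qed.

(** Once the inequality of [u_grow] holds, the first term of the recurrence dominates, so the value
    repeats; since a m < 1 the inequality then persists. *)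
Let u_const x : x != 0 -> exists2 l, 0 < l & exists N, forall n, (N <= n)%N -> a (u x n) = l.
Proof.
move=> x0; have [n0 h0] := u_grow x0.
have g0 := ultra_ge0 ha.
have P n : (a m * a (u x (n0 + n)%N) < a (u x (n0 + n).+1)) /\ a (u x (n0 + n).+1) = a (u x n0.+1).
  elim: n => [|n [I1 I2]]; first by rewrite addn0.
  have e : a (u x (n0 + n).+2) = a (u x (n0 + n).+1).
    by rewrite uS (ultraD_lt ha) // (ultraN ha) (ultraM ha).
  rewrite addnS e I2; split=> //.
  rewrite -I2 -[ltRHS]mul1r ltr_pM2r //.
  by rewrite (le_lt_trans _ I1) // mulr_ge0.
exists (a (u x n0.+1)); first by rewrite (le_lt_trans _ h0) // mulr_ge0.
exists n0.+1 => -[//|n] /=; rewrite ltnS => le; rewrite -(subnKC le).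
by case: (P (n - n0)%N).
Qed.

Let lim_of (x : K) (l : R) := exists N, forall n, (N <= n)%N -> a (u x n) = l.

Let lim_ex x : exists2 l, lim_of x l & (0 <= l) /\ (l = 0 <-> x = 0).
Proof.
have [->|x0] := eqVneq x 0.
  exists 0; last by split.
  exists 0%N => n _; rewrite /u mul0r (_ : tr 0 = 0) ?(ultra0 ha) //.
  by apply: ratA_inj; rewrite trE rmorph0 addr0 ratA0.
have [l l0 hl] := u_const x0; exists l => //; split; first exact: ltW.
by split=> h; [rewrite h ltxx in l0|rewrite h eqxx in x0].
Qed.

Let lim_uniq x l l' : lim_of x l -> lim_of x l' -> l = l'.
Proof.
move=> [N h] [N' h']; rewrite -(h (maxn N N')) ?leq_maxl //.
by rewrite h' // leq_maxr.
Qed.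

Let w (x : K) : R := xget 0 [set l | lim_of x l]%classic.
Let wP x : lim_of x (w x).
Proof. by rewrite /w; case: xgetP => [//|h]; have [l hl _] := lim_ex x; case: (h l). Qed.
Let wE x l : lim_of x l -> w x = l. Proof. exact: lim_uniq (wP x). Qed.

Let wM x y : w (x * y) = w x * w y.
Proof.
have z0 : w 0 = 0 by apply: wE; have [l + [_ h]] := lim_ex 0; rewrite (h.2 erefl).
have pos x' : x' != 0 -> 0 < w x'.
  move=> x0; have [l hl [l0 h]] := lim_ex x'; rewrite (wE hl) lt_def l0 andbT.
  by apply: contra_neq x0 => /h.
have [->|x0] := eqVneq x 0; first by rewrite mul0r z0 mul0r.
have [->|y0] := eqVneq y 0; first by rewrite mulr0 z0 mulr0.
have wx := pos x x0; have wy := pos y y0.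
have [Nx hx] := wP x; have [Ny hy] := wP y; have [N hxy] := wP (x * y).
have g0 := ultra_ge0 ha.
pose t := a (tr (x * cj y)); have t0 : 0 <= t by exact: g0.
have C0 : 0 < w x * w y / (t + 1) by rewrite divr_gt0 ?mulr_gt0 // ltr_wpDl.
have [M hM] := pow_small (g0 m) nz C0.
pose n := (Nx + Ny + N + M)%N.
(* The mixed terms in the product of the two traces carry the factor m^n, which is small for large
   n. *)
have e : u (x * y) (n + n)%N = u x n * u y n - m ^+ n * tr (x * cj y).
  apply: ratA_inj; rewrite ratAB !ratAM -nmX !trE nmE !rmorphM !rmorphXn /= cjK; move: n => k; rewrite !exprD.
ring.
have nn : (N <= n + n)%N by rewrite /n; lia.
rewrite -(hxy _ nn).
have ex : a (u x n) = w x by apply: hx; rewrite /n; lia.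
have ey : a (u y n) = w y by apply: hy; rewrite /n; lia.
have eP : a (u x n * u y n) = w x * w y by rewrite (ultraM ha) ex ey.
rewrite e (ultraD_lt ha) ?eP // (ultraN ha) (ultraM ha) (ultraX ha).
have : a m ^+ n < w x * w y / (t + 1) by apply: hM; rewrite /n; lia.
rewrite ltr_pdivlMr ?ltr_wpDl // => /(le_lt_trans _); apply.
by rewrite ler_wpM2l ?exprn_ge0 // lerDl.
Qed.

(* The eventual value of a (tr (x z^n)) is an absolute value at x: it tends    *)
(* to the dominant of the two conjugate terms of the trace.                   *)
Lemma ultra_ext_split : exists v : K -> R, ultra_abs v /\ forall q : rat, v q%:A = a q.
Proof.
have hw : ultra_abs w.
  split.
  - by move=> x; have [l hl [l0 _]] := lim_ex x; rewrite (wE hl).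
  - by move=> x; have [l hl [_ h]] := lim_ex x; rewrite (wE hl).
  - exact: wM.
  - move=> x y; have [Nx hx] := wP x; have [Ny hy] := wP y; have [N hxy] := wP (x + y).
    pose n := (Nx + Ny + N)%N.
    rewrite -(hxy n) -?(hx n) -?(hy n); try by rewrite /n; lia.
    by rewrite /u mulrDl trD ultraD.
exists w; split=> // q.
rewrite -[RHS]mulr1 -(ultra1 hw); apply: wE.
have [N h] := wP 1; exists N => n le; rewrite -(h n le).
by rewrite /u mul1r trZ (ultraM ha).
Qed.
End Split.

(** If some trace is too large for the formula of [ultra_ext_nonsplit], dividing that element by its
    trace gives the [z] of trace 1 and small norm on which the split case is built. *)
Lemma ultra_ext_exists : exists v : K -> R, ultra_abs v /\ forall q : rat, v q%:A = a q.
Proof.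
have [H|/existsNP[x hx]] := pselect (forall x, a (tr x) ^+ 2 <= a (nm x)).
  exists (fun x => Num.sqrt (a (nm x))); split; first exact: ultra_ext_nonsplit.
  by move=> q; rewrite nm_rat (ultraX ha) sqrtr_sqr ger0_norm // ultra_ge0.
have {}hx : a (nm x) < a (tr x) ^+ 2 by rewrite ltNge; apply/negP.
have t0 : tr x != 0.
  apply/eqP => e; move: hx; rewrite e (ultra0 ha) expr0n /= ltNge.
  by rewrite ultra_ge0.
apply: (@ultra_ext_split ((tr x)^-1%:A * x)); first by rewrite trZ mulVf.
rewrite nmM nm_rat (ultraM ha) (ultraX ha) (ultraV ha) exprVn.
by rewrite mulrC ltr_pdivrMr ?mul1r // exprn_gt0 // ultra_gt0.
Qed.
End Existence.
End Quadratic.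

(** * Local degrees *)

Lemma ultra_powR (R : realType) (F : fieldType) (v : F -> R) (r : R) :
  0 < r -> ultra_abs v -> ultra_abs (fun x => v x `^ r).
Proof.
move=> r0 hv; split=> [x|x|x y|x y]; first exact: powR_ge0.
- split=> [/eqP|->]; last by rewrite (ultra0 hv) powR0 // gt_eqF.
  rewrite powR_eq0 => /andP[/eqP h _].
  by case: hv => _ h1 _ _; apply/(h1 _).1.
- by rewrite (ultraM hv) powRM ?ultra_ge0.
- have g0 := ultra_ge0 hv.
  have mono a b : a <= b -> 0 <= a -> a `^ r <= b `^ r.
    by move=> ab a0; rewrite ge0_ler_powR ?nnegrE ?(le_trans a0 ab) // ltW.
  have := ultraD hv x y; case: (leP (v x) (v y)) => h e; rewrite le_max.
    by rewrite (mono _ _ e) ?orbT.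
  by rewrite (mono _ _ e).
Qed.

Section LocalDegree.
Variables (R : realType) (K : fieldExtType rat) (cj : {rmorphism K -> K}).
Hypothesis hcj : quad_conj cj.

Lemma null_forP (v : K -> R) (u : nat -> K) : (forall x, 0 <= v x) ->
  null_for v u <->
  forall e, 0 < e -> exists N, forall k, (N <= k)%N -> v (u k) < e.
Proof.
move=> g0; split.
  move=> /cvgrPdist_lt h e /h [N _ HN]; exists N => k /HN /=.
  by rewrite sub0r normrN ger0_norm.
move=> h; apply/cvgrPdist_lt => e /h [N HN]; exists N => // k /HN /=.
by rewrite sub0r normrN ger0_norm.
Qed.

Definition cj_inv (v : K -> R) := forall x, v (cj x) = v x.

Section Abs.
Variables (v : K -> R) (hv : ultra_abs v).

Let g0 := ultra_ge0 hv.

Lemma cauchy_cst c : cauchy_for v (fun=> c).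
Proof. by move=> e e0; exists 0%N => m n _ _; rewrite subrr (ultra0 hv). Qed.

Lemma spanned_by0 : ~ spanned_by v 0.
Proof.
move=> [b [_ /(_ _ (cauchy_cst 1))[q [_]]]].
move/(null_forP _ g0)/(_ _ ltr01) => [N /(_ _ (leqnn N))].
by rewrite big_ord0 subr0 (ultra1 hv) ltxx.
Qed.

(** If q_k b_k tends to 1 and q'_k b_k tends to x, then q'_k / q_k tends to x. *)
Lemma spanned_by1_dense : spanned_by v 1 ->
  forall x e, 0 < e -> exists q : rat, v (x - q%:A) < e.
Proof.
move=> [b [_ hb]] x e e0.
have [q [_ /(null_forP _ g0) hq]] := hb _ (cauchy_cst 1).
have [q' [_ /(null_forP _ g0) hq']] := hb _ (cauchy_cst x).
have [N1 h1] := hq _ ltr01.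
have d0 : 0 < e / (v x + 1) by rewrite divr_gt0 // ltr_wpDl.
have [N2 h2] := hq _ d0; have [N3 h3] := hq' _ e0.
pose k := (N1 + N2 + N3)%N.
have {}h1 := h1 k (leq_trans (leq_addr _ _) (leq_addr _ _)).
have {}h2 : v (1 - q ord0 k *: b ord0 k) < e / (v x + 1).
  by have := h2 k; rewrite big_ord1; apply; rewrite /k; lia.
have {}h3 : v (x - q' ord0 k *: b ord0 k) < e.
  by have := h3 k; rewrite big_ord1; apply; rewrite /k; lia.
rewrite big_ord1 in h1.
set c := q ord0 k *: b ord0 k in h1 h2; set c' := q' ord0 k *: b ord0 k in h3.
have vc : v c = 1.
  by rewrite -(subKr 1 c) (ultraD_lt hv) ?(ultra1 hv) // (ultraN hv).
have c0 : c != 0 by apply/eqP => c0; move: vc; rewrite c0 (ultra0 hv) => /esym/eqP; rewrite oner_eq0.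
have q0 : q ord0 k != 0 by apply: contra_neq c0; rewrite /c => ->; rewrite scale0r.
have b0 : b ord0 k != 0 by apply: contra_neq c0; rewrite /c => ->; rewrite scaler0.
have q0' : (q ord0 k)%:A != 0 :> K by rewrite scaler_eq0 negb_or q0 oner_eq0.
exists (q' ord0 k / q ord0 k).
have -> : x - (q' ord0 k / q ord0 k)%:A = ((x - c') - x * (1 - c)) / c.
  rewrite /c /c' ![_ *: b _ _]scaleQ.
  have -> : (q' ord0 k / q ord0 k)%:A = (q' ord0 k)%:A / (q ord0 k)%:A :> K.
    by rewrite -!in_algE fmorph_div.
  by field; rewrite b0 q0'.
rewrite (ultraM hv) (ultraV hv) vc invr1 mulr1.
apply: (ultraB_ltr hv) => //; rewrite (ultraM hv).
move: h2; rewrite ltr_pdivlMr ?ltr_wpDl //; apply: le_lt_trans.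
by rewrite mulrC ler_wpM2l // lerDl.
Qed.

Lemma dense_spanned_by1 :
  (forall x e, 0 < e -> exists q : rat, v (x - q%:A) < e) -> spanned_by v 1.
Proof.
move=> dense; exists (fun _ _ => 1); split=> [i|x hx]; first exact: cauchy_cst.
have ex k : exists q : rat, v (x k - q%:A) < k.+1%:R^-1.
  by apply: dense; rewrite invr_gt0 ltr0n.
pose q k := xchoose (ex k); have hq k : v (x k - (q k)%:A) < k.+1%:R^-1 := xchooseP (ex k).
have small e : 0 < e -> exists N, forall k, (N <= k)%N -> v (x k - (q k)%:A) < e.
  move=> e0; exists (Num.trunc e^-1) => k hk; apply: (lt_trans (hq k)).
  rewrite invf_plt ?posrE ?ltr0n //; apply: (lt_le_trans (truncnS_gt _)).
  by rewrite ler_nat ltnS.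
exists (fun _ => q); split.
  move=> _ e e0; have [N h] := small e e0; have [M h'] := hx e e0.
  exists (maxn N M) => m n; rewrite !geq_max => /andP[a1 a2] /andP[b1 b2].
  have -> : (q m)%:A - (q n)%:A = (x m - x n) - ((x m - (q m)%:A) - (x n - (q n)%:A)).
    by ring.
  apply: (ultraB_ltr hv); first exact: h'.
  by apply: (ultraB_ltr hv); exact: h.
by apply/(null_forP _ g0) => e /small[N h]; exists N => k /h; rewrite big_ord1.
Qed.

Let anti : exists s : K, s != 0 /\ cj s = - s.
Proof.
have [_ _ [x hx]] := hcj; exists (x - cj x); split.
  by rewrite subr_eq0; apply/eqP => h; apply: hx.
by rewrite rmorphB /= (cjK hcj) opprB.
Qed.

Let fix_rat x : cj x = x -> exists q : rat, x = q%:A.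
Proof. by case: hcj => _ h _; exact: h. Qed.

Let two0 : 2 != 0 :> K. Proof. exact: natK_neq0. Qed.

(** A rational number close to the anti-invariant element s would by invariance be as close to -s,
    so that 2 s would be small; hence one generator is not enough. With generators 1 and s, the
    coordinates of a Cauchy sequence are combinations of it and its conjugate, again Cauchy by
    invariance. *)
Lemma cj_inv_local_degree : cj_inv v -> local_degree v 2.
Proof.
move=> inv; have [s [s0 cs]] := anti; split; last first.
  case=> [/spanned_by0//|[|//]] /spanned_by1_dense/(_ s (v (2 * s))) [].
    by rewrite (ultra_gt0 hv) // mulf_neq0.
  move=> q hq; have := hq; rewrite -inv rmorphB /= cj_rat cs => hq'.
  have := ultraB_ltr hv hq hq'.
  by rewrite (_ : _ - _ = 2 * s) ?ltxx //; ring.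
exists (fun i _ => if i == ord0 then 1 else s); split=> [i|x hx].
  exact: cauchy_cst.
have ex (y : K) : exists pq : rat * rat, y = pq.1%:A + pq.2%:A * s.
  have [p hp] : exists p : rat, (y + cj y) / 2 = p%:A.
    by apply: fix_rat; rewrite fmorph_div rmorphD /= (cjK hcj) addrC rmorph_nat.
  have [q hq] : exists q : rat, (y - cj y) / (2 * s) = q%:A.
    apply: fix_rat; rewrite fmorph_div rmorphB rmorphM /= (cjK hcj) rmorph_nat cs.
    by field; rewrite s0 two0 oppr_eq0.
  by exists (p, q); rewrite /= -hp -hq; field; rewrite s0 two0.
pose pq y := sval (cid (ex y)); have hpq y : y = (pq y).1%:A + (pq y).2%:A * s := svalP (cid (ex y)).
pose f (i : 'I_2) y : rat := if i == ord0 then (pq y).1 else (pq y).2.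
exists (fun i k => f i (x k)); split; last first.
  apply/(null_forP _ g0) => e e0; exists 0%N => k _.
  rewrite big_ord_recl big_ord1 /f /= scaleQ mulr1 scaleQ -hpq subrr (ultra0 hv) //.
have hxc e : 0 < e -> exists N, forall m n, (N <= m)%N -> (N <= n)%N ->
    v (x m - x n) < e /\ v (cj (x m) - cj (x n)) < e.
  by move=> /hx[N h]; exists N => m n a b; rewrite -rmorphB inv; split; exact: h.
have h1 y : 2 * (pq y).1%:A = y + cj y.
  by have := hpq y; case: (pq y) => p q /= ->; rewrite rmorphD rmorphM /= !cj_rat cs; ring.
have h2 y : 2 * s * (pq y).2%:A = y - cj y.
  by have := hpq y; case: (pq y) => p q /= ->; rewrite rmorphD rmorphM /= !cj_rat cs; ring.
move=> i e e0; rewrite /f; case: (i == ord0).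
  have [N h] := hxc (e * v 2) (mulr_gt0 e0 (ultra_gt0 hv two0)).
  exists N => m n a b; have [ha hb] := h m n a b.
  rewrite -(ltr_pM2r (ultra_gt0 hv two0)) -(ultraM hv).
  have -> : ((pq (x m)).1%:A - (pq (x n)).1%:A) * 2 = (x m - x n) + (cj (x m) - cj (x n)).
    by rewrite mulrC mulrBr !h1; ring.
  exact: (ultraD_ltr hv).
have ts0 : 2 * s != 0 by rewrite mulf_neq0.
have [N h] := hxc (e * v (2 * s)) (mulr_gt0 e0 (ultra_gt0 hv ts0)).
exists N => m n a b; have [ha hb] := h m n a b.
rewrite -(ltr_pM2r (ultra_gt0 hv ts0)) -(ultraM hv).
have -> : ((pq (x m)).2%:A - (pq (x n)).2%:A) * (2 * s) = (x m - x n) - (cj (x m) - cj (x n)).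
  by rewrite mulrC mulrBr !h2; ring.
exact: (ultraB_ltr hv).
Qed.

(* If v x < v (cj x), the ratios of trace and anti-trace of (x / cj x)^n give *)
(* rational approximations of a square root.                                  *)
Lemma not_cj_inv_local_degree : ~ cj_inv v -> local_degree v 1.
Proof.
move=> ninv; have [s [s0 cs]] := anti; split; last by case=> // /spanned_by0.
apply: dense_spanned_by1.
have [z zlt] : exists z, v z < v (cj z).
  move/existsNP: ninv => [z hz]; case: (ltgtP (v z) (v (cj z))) => h.
  - by exists z.
  - by exists (cj z); rewrite (cjK hcj).
  - by case: hz.
have cz0 : cj z != 0.
  by apply/eqP => e; move: zlt; rewrite e (ultra0 hv) ltNge g0.
have z0 : z != 0 by rewrite -(fmorph_eq0 cj).
pose c := z / cj z.
have c0 : c != 0 by rewrite mulf_neq0 ?invr_eq0.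
have ccj : cj c = c^-1 by rewrite fmorph_div /= (cjK hcj) invf_div.
have vc : v c < 1.
  by rewrite (ultraM hv) (ultraV hv) ltr_pdivrMr ?mul1r // (ultra_gt0 hv).
have sdense e : 0 < e -> exists q : rat, v (s - q%:A) < e.
  move=> e0.
  have C0 : 0 < e / v s by rewrite divr_gt0 // (ultra_gt0 hv).
  have [N /(_ _ (leqnSn N))] := pow_small (g0 c) vc C0.
  rewrite ltr_pdivlMr ?(ultra_gt0 hv) // => hN.
  pose w := c ^+ N.+1; pose w' := w^-1.
  have vw : v w < 1 by rewrite (ultraX hv) exprn_ilt1.
  have w0 : w != 0 by rewrite expf_neq0.
  have vw' : 1 < v w' by rewrite (ultraV hv) invf_gt1 // (ultra_gt0 hv).
  have vd : v (w' - w) = v w'.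
    by rewrite (ultraD_lt hv) // (ultraN hv) (lt_trans vw).
  have d0 : w' - w != 0.
    by apply/eqP => d0; move: vd; rewrite d0 (ultra0 hv) => e1; rewrite -e1 ltr10 in vw'.
  have cw : cj w = w' by rewrite rmorphXn /= ccj exprVn.
  have cw' : cj w' = w by rewrite fmorphV /= cw invrK.
  have d0' : w - w' != 0 by rewrite -opprB oppr_eq0.
  have [q hq] : exists q : rat, s * (w' + w) / (w' - w) = q%:A.
    apply: fix_rat; rewrite fmorph_div rmorphM rmorphD rmorphB /= cw cw' cs.
    by field; rewrite d0 d0'.
  exists q; rewrite -hq.
  have -> : s - s * (w' + w) / (w' - w) = s * (- (2%:R)) * w / (w' - w) by field.
  rewrite !(ultraM hv) (ultraN hv) (ultraV hv) vd.
  apply: le_lt_trans hN; rewrite mulrC ler_pdivrMl ?(lt_trans _ vw') //.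
  rewrite -(ultraX hv) -/w.
  have tw := g0 w; have ts := g0 s.
  apply: (@le_trans _ _ (v w * v s)).
    rewrite mulrAC [v s * v w]mulrC ler_piMr ?mulr_ge0 //.
    exact: (ultra_nat hv 2).
  by rewrite ler_peMl ?mulr_ge0 // ltW.
move=> x e e0.
have [p hp] : exists p : rat, (x + cj x) / 2 = p%:A.
  by apply: fix_rat; rewrite fmorph_div rmorphD /= (cjK hcj) addrC rmorph_nat.
have [g hg] : exists q : rat, (x - cj x) / (2 * s) = q%:A.
  apply: fix_rat; rewrite fmorph_div rmorphB rmorphM /= (cjK hcj) rmorph_nat cs.
  by field; rewrite s0 two0 oppr_eq0.
have [q hq] := sdense (e / (v g%:A + 1)) (divr_gt0 e0 (ltr_wpDl (g0 _) ltr01)).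
exists (p + g * q).
have -> : x - (p + g * q)%:A = g%:A * (s - q%:A).
  by rewrite ratAD ratAM -hp -hg; field; rewrite s0 two0.
rewrite (ultraM hv); move: hq; rewrite ltr_pdivlMr ?ltr_wpDl //; apply: le_lt_trans.
by rewrite mulrC ler_wpM2l // lerDl.
Qed.

Lemma local_degreeE n : local_degree v n ->
  n = (if `[< cj_inv v >] then 2 else 1)%N.
Proof.
have uni a b : local_degree v a -> local_degree v b -> a = b.
  by move=> [sa ma] [sb mb]; apply/eqP; rewrite eqn_leq ma // mb.
case: asboolP => h hn; apply: uni hn _; first exact: cj_inv_local_degree.
exact: not_cj_inv_local_degree.
Qed.

End Abs.
End LocalDegree.

(** * Product formula *)

Local Open Scope classical_set_scope.
Local Open Scope ring_scope.

Lemma powR_gt1 (R : realType) (x r : R) : 1 < x -> 0 < r -> 1 < x `^ r.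
Proof.
move=> x1 r0; have := gt0_ltr_powR r0 _ _ x1; rewrite powR1; apply; rewrite nnegrE //.
exact/ltW/(lt_trans ltr01).
Qed.

(** * Products over infinite index sets *)

Section FsProd.
Variables (R : realFieldType) (T : choiceType) (P : set T).

(** A product whose support is infinite collapses to 1 by convention, so multiplicativity requires
    this condition to be carried along. *)
Definition fin_supp (f : T -> R) := finite_set (P `&` [set x | f x <> 1]).

Lemma fin_supp_sub (f g : T -> R) :
  (forall x, P x -> g x = 1 -> f x = 1) -> fin_supp g -> fin_supp f.
Proof.
move=> h; apply: sub_finite_set => x [Px fx]; split=> // gx; exact/fx/h.
Qed.

Lemma fin_supp2 (f g k : T -> R) :
  (forall x, P x -> f x = 1 -> g x = 1 -> k x = 1) ->
  fin_supp f -> fin_supp g -> fin_supp k.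
Proof.
move=> h ff fg; apply: (@sub_finite_set _ _ ((P `&` [set x | f x <> 1]) `|` (P `&` [set x | g x <> 1]))); last first.
  by rewrite finite_setU.
move=> x [Px kx]; have [fx|fx] := pselect (f x = 1); last by left.
by right; split=> // gx; exact/kx/h.
Qed.

Lemma fsprodM (f g : T -> R) : fin_supp f -> fin_supp g ->
  \big[*%R/1]_(x \in P) (f x * g x) =
  \big[*%R/1]_(x \in P) f x * \big[*%R/1]_(x \in P) g x.
Proof.
move=> ff fg; pose D := (P `&` [set x | f x <> 1]) `|` (P `&` [set x | g x <> 1]).
have Df : finite_set D by rewrite finite_setU.
have DP : D `<=` P by move=> x [|] [].
have hf x : (P `\` D) x -> f x = 1.
  by move=> [Px nD]; apply: contrapT => h; apply: nD; left.
have hg x : (P `\` D) x -> g x = 1.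
  by move=> [Px nD]; apply: contrapT => h; apply: nD; right.
rewrite -(fsbig_widen D P) //; last by move=> x h; rewrite /= hf // hg // mulr1.
rewrite -[X in _ = X * _](fsbig_widen D P) //.
rewrite -[X in _ = _ * X](fsbig_widen D P) //.
exact: fsbig_split.
Qed.

Lemma fsprod_ge1 (f : T -> R) : (forall x, P x -> 1 <= f x) ->
  1 <= \big[*%R/1]_(x \in P) f x.
Proof.
move=> h; case: finite_supportP; rewrite ?big_nil // => X XP _ _.
rewrite big_seq_cond; apply: (big_ind (fun y => 1 <= y)) => //; first exact: mulr_ege1.
by move=> x; rewrite andbT => /XP/h.
Qed.

Lemma fsprod_gt0 (f : T -> R) : (forall x, P x -> 0 < f x) ->
  0 < \big[*%R/1]_(x \in P) f x.
Proof.
move=> h; case: finite_supportP; rewrite ?big_nil // => X XP _ _.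
by rewrite big_seq_cond prodr_gt0 // => x; rewrite andbT => /XP/h.
Qed.

Lemma fsprod_add2 (Q : set T) (f : T -> R) (x y : T) :
  Q = [set z | z = x \/ z = y \/ P z] -> x <> y -> ~ P x -> ~ P y -> fin_supp f ->
  \big[*%R/1]_(z \in Q) f z = f x * f y * \big[*%R/1]_(z \in P) f z.
Proof.
move=> QE xy Px Py ff; pose D := P `&` [set z | f z <> 1].
pose D' := x |` (y |` D).
have fD' : finite_set D' by rewrite /D' !finite_setU; do 2! [split => //].
rewrite -(fsbig_widen D' Q); last 2 first.
- by rewrite QE => z [->|[->|[]]] /=; tauto.
- rewrite QE => z [/= hz nD]; apply: contrapT => fz; apply: nD.
  by case: hz => [->|[->|Pz]]; [left|right; left|right; right].
rewrite (fsbigD1 x) //=; last by left.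
rewrite (_ : D' `\ x = y |` D); last first.
  apply/seteqP; split=> z /=; first by case=> -[->//|h _].
  move=> h; split; [by right|move=> /= e]. case: h => [e2|[Pz _]].
    by apply: xy; rewrite -e -e2.
  by apply: Px; rewrite -e.
rewrite (fsbigD1 y) //=; last 2 first.
- by rewrite finite_setU.
- by left.
rewrite (_ : (y |` D) `\ y = D); last first.
  apply/seteqP; split=> z /=; first by case=> -[->//|].
  by move=> h; split; [right|move=> e; apply: Py; rewrite -e; case: h].
rewrite mulrA; congr (_ * _ * _); apply: fsbig_widen; first by move=> z [].
by move=> z [Pz nD] /=; apply: contrapT => h; apply: nD.
Qed.

End FsProd.

(** * Non-archimedean places and their product *)

Section Places.
Variables (R : realType) (K : fieldExtType rat) (cj : {rmorphism K -> K}).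
Hypothesis hcj : quad_conj cj.
Hypothesis dimK : \dim {:K} = 2%N.

Definition nonarch_places : set (K -> R) :=
  [set v | nonarch_abs v /\
     exists p n, [/\ prime p, local_degree v n &
       v p%:R = p%:R `^ (- (n%:R / (\dim {:K})%:R))]].

Lemma nonarch_ultra v : nonarch_places v -> ultra_abs v. Proof. by case. Qed.

Lemma ultra_abs_nonarch_place v p n : ultra_abs v -> prime p -> local_degree v n ->
  v p%:R = p%:R `^ (- (n%:R / 2)) -> nonarch_places v.
Proof. by move=> hv pp hn e; split=> //; exists p, n; rewrite dimK. Qed.

(** The normalization of a place refers to some prime q; it must be p, since v p would otherwise be
    1 by coprimality. *)
Lemma nonarch_nat_lt1 v p : nonarch_places v -> prime p -> v p%:R != 1 ->
  exists n, [/\ local_degree v n, (0 < n)%N & v p%:R = p%:R `^ (- (n%:R / 2))].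
Proof.
move=> [hv [q [n [pq hn e]]]] pp vp1; rewrite dimK in e.
have n0 : (0 < n)%N.
  by rewrite lt0n; apply/eqP => n0; move: hn; rewrite n0 => -[/(spanned_by0 hv)].
exists n; suff -> : p = q by [].
apply/eqP; apply: contraNT vp1 => pq'.
apply/eqP/(ultra_coprime (p := q) hv).
  by rewrite e powRN invf_lt1 ?powR_gt0 ?ltr0n ?prime_gt0 // powR_gt1 ?ltr1n ?prime_gt1 // divr_gt0 ?ltr0n.
by rewrite prime_coprime // dvdn_prime2 // eq_sym.
Qed.

Let pow_pow (x a b : R) : a * b = 1 -> 0 <= x -> (x `^ a) `^ b = x.
Proof. by move=> ab x0; rewrite -powRrM ab powRr1. Qed.

(** Let v0 extend the p-adic absolute value. If v0 is conjugation invariant, the local degree is 2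
    and v0 itself is the only place above p. Otherwise the local degree is 1 and the places are the
    square roots of v0 and of its conjugate. Either way the values at p multiply to 1/p. *)
Lemma nonarch_above p : prime p -> exists l : seq (K -> R),
  [/\ uniq l, forall v, v \in l <-> nonarch_places v /\ v p%:R != 1 & \prod_(v <- l) v p%:R = p%:R^-1].
Proof.
move=> pp.
have p1 : 1 < p%:R :> R by rewrite ltr1n prime_gt1.
have p0 : 0 < p%:R :> R by rewrite ltr0n prime_gt0.
have [v0 [hv0 ev0]] := ultra_ext_exists hcj (padic_ultra R pp).
have v0p : v0 p%:R = p%:R^-1 by rewrite -ratAn ev0 padic_p.
have v0g := ultra_ge0 hv0.
(* A place above p, rescaled to the value 1/p at p, is v0 or its conjugate. *)
have rescale v : nonarch_places v -> v p%:R != 1 -> exists n, [/\ local_degree v n, (0 < n)%N &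
    (fun x => v x `^ (2 / n%:R)) =1 v0 \/ (fun x => v x `^ (2 / n%:R)) =1 v0 \o cj].
  move=> hv vp1; have [n [hn n0 e]] := nonarch_nat_lt1 hv pp vp1.
  exists n; split=> //.
  have n0R : n%:R != 0 :> R by rewrite pnatr_eq0 -lt0n.
  have hw : ultra_abs (fun x => v x `^ (2 / n%:R)).
    by apply: ultra_powR; [rewrite divr_gt0 ?ltr0n|exact: nonarch_ultra].
  apply: (ultra_ext_unique hcj hv0 hw).
  have wp : v (p%:R)%:A `^ (2 / n%:R) = p%:R^-1.
    rewrite ratAn e -powRrM (_ : _ * _ = -1) ?powRN ?powRr1 ?ltW //.
    by field; rewrite n0R.
  move=> q; rewrite ev0.
  apply: (ultra_rat_unique pp (padic_ultra R pp) (ultra_restr hw)).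
    by rewrite padic_p // wp.
  by rewrite padic_p // invf_lt1.
have deg v n : nonarch_places v -> local_degree v n -> n = (if `[< cj_inv cj v >] then 2 else 1)%N.
  by move=> hv; exact: local_degreeE hcj _ (nonarch_ultra hv) _.
have [inv|ninv] := pselect (cj_inv cj v0).
- exists [:: v0]; split=> //; last by rewrite big_seq1.
  move=> v; rewrite inE; split=> [/eqP ->|[hv vp1]].
    split; last by rewrite v0p invr_eq1 gt_eqF.
    apply: (ultra_abs_nonarch_place hv0 pp (cj_inv_local_degree hcj hv0 inv)).
    by rewrite v0p divff ?pnatr_eq0 // powRN powRr1 ?ltW.
  have [n [hn n0 e]] := rescale v hv vp1.
  have vg := ultra_ge0 (nonarch_ultra hv).
  have {}e x : v x `^ (2 / n%:R) = v0 x by case: e => -> //=; rewrite inv.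
  have nR : n%:R != 0 :> R by rewrite pnatr_eq0 -lt0n.
  have back x : v x = v0 x `^ (n%:R / 2).
    by rewrite -e pow_pow //; field; rewrite nR.
  have vi : cj_inv cj v by move=> x; rewrite !back inv.
  have n2 := deg v n hv hn; rewrite asboolT // in n2.
  by apply/eqP/funext => x; rewrite -e n2 divff ?pnatr_eq0 // powRr1.
- pose v1 x := v0 x `^ (1 / 2); pose v2 x := v1 (cj x).
  have half0 : 0 < 1 / 2 :> R by rewrite divr_gt0.
  have hv1 : ultra_abs v1 by exact: ultra_powR.
  have hv2 : ultra_abs v2 by exact: ultra_cj.
  have sq x : v1 x `^ 2 = v0 x by rewrite /v1 pow_pow //; field.
  have n1 : ~ cj_inv cj v1 by move=> h; apply: ninv => x; rewrite -!sq h.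
  have n2 : ~ cj_inv cj v2.
    by move=> h; apply: n1 => x; have := h x; rewrite /v2 (cjK hcj) => ->.
  have v1p : v1 p%:R = p%:R `^ (- (1 / 2)).
    by rewrite /v1 v0p -powR_inv1 ?ltW // -powRrM mulN1r.
  have v2p : v2 p%:R = p%:R `^ (- (1 / 2)) by rewrite /v2 rmorph_nat.
  have neq1 : p%:R `^ (- (1 / 2)) != 1 :> R.
    by rewrite powRN invr_eq1 gt_eqF // powR_gt1.
  exists [:: v1; v2]; split.
  - rewrite /= andbT inE; apply/eqP => e; apply: n1 => x.
    by rewrite [in RHS]e /v2.
  - move=> v; rewrite !inE; split=> [/orP[]/eqP ->|[hv vp1]].
    + split; last by rewrite v1p.
      exact: (ultra_abs_nonarch_place hv1 pp (not_cj_inv_local_degree hcj hv1 n1)).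
    + split; last by rewrite v2p.
      exact: (ultra_abs_nonarch_place hv2 pp (not_cj_inv_local_degree hcj hv2 n2)).
    + have [n [hn n0 e]] := rescale v hv vp1.
      have vg := ultra_ge0 (nonarch_ultra hv).
      have ni : ~ cj_inv cj v.
        move=> h; apply: ninv => x; case: e => e; first by rewrite -!e h.
        by have := e x; have := e (cj x); rewrite /= (cjK hcj) h => -> .
      have nn := deg v n hv hn; rewrite asboolF // in nn; subst n.
      have back x : v x = (v x `^ (2 / 1%:R)) `^ (1 / 2) by rewrite pow_pow //; field.
      by case: e => e; apply/orP; [left|right]; apply/eqP/funext => x; rewrite back e.
  - rewrite big_cons big_seq1 v1p v2p -powRD; last by apply/implyP => _; rewrite gt_eqF.
    by rewrite -opprD -splitr powRN powRr1 // ltW.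
Qed.

Lemma nonarch_fin_supp_prime p : prime p -> fin_supp nonarch_places (fun v => v p%:R).
Proof.
move=> /nonarch_above[l [_ hl _]].
rewrite /fin_supp (_ : nonarch_places `&` [set v | v p%:R <> 1] = [set` l]); first exact: finite_seq.
  apply/seteqP; split=> v /= h.
    by apply/hl; case: h => h1 /eqP.
  by have [h1 /eqP h2] := (hl v).1 h.
Qed.

Lemma nonarch_prime p : prime p -> \big[*%R/1]_(v \in nonarch_places) v p%:R = p%:R^-1 :> R.
Proof.
move=> /nonarch_above[l [ul hl <-]]; rewrite fsbig_supp.
apply: fsbig_fwiden => //.
  by move=> v [h1 h2]; apply/hl; split=> //; apply/eqP.
move=> v [/= /hl[h1 h2] h3] /=; apply: contrapT => h4; exact: h3.
Qed.

Lemma nonarch_fin_suppM x y : fin_supp nonarch_places (fun v => v x) -> fin_supp nonarch_places (fun v => v y) ->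
  fin_supp nonarch_places (fun v => v (x * y)).
Proof.
by apply: fin_supp2 => v /nonarch_ultra hv e1 e2; rewrite (ultraM hv) e1 e2 mulr1.
Qed.

Lemma nonarch_prodM x y : fin_supp nonarch_places (fun v => v x) -> fin_supp nonarch_places (fun v => v y) ->
  \big[*%R/1]_(v \in nonarch_places) v (x * y) =
  \big[*%R/1]_(v \in nonarch_places) v x * \big[*%R/1]_(v \in nonarch_places) v y.
Proof.
move=> hx hy; rewrite -fsprodM //; apply: eq_fsbigr => v.
by rewrite inE => /nonarch_ultra hv; rewrite (ultraM hv).
Qed.

Lemma nonarch_nat n : (0 < n)%N -> fin_supp nonarch_places (fun v => v n%:R) /\
  \big[*%R/1]_(v \in nonarch_places) v n%:R = n%:R^-1 :> R.
Proof.
have v1 v : nonarch_places v -> v 1 = 1 by move=> /nonarch_ultra/ultra1.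
elim/ltn_ind: n => n IH n0; have [n1|n1] := leqP n 1.
  have -> : n = 1%N by lia.
  split; last by rewrite invr1; apply: fsbig1 => v /v1.
  by rewrite /fin_supp (_ : _ `&` _ = set0) // -subset0 => v [/v1].
have pn := pdiv_prime n1; have dn := pdiv_dvd n.
have k0 : (0 < n %/ pdiv n)%N by rewrite divn_gt0 ?prime_gt0 // pdiv_leq.
have [|f1 f2] := IH (n %/ pdiv n)%N _ k0; first by rewrite ltn_Pdiv ?prime_gt1.
rewrite -(divnK dn) !natrM; split; first exact/nonarch_fin_suppM/nonarch_fin_supp_prime.
by rewrite nonarch_prodM // ?f2 ?nonarch_prime ?invfM //; exact: nonarch_fin_supp_prime.
Qed.

Lemma nonarch_inv x : x != 0 -> fin_supp nonarch_places (fun v => v x) ->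
  fin_supp nonarch_places (fun v => v x^-1) /\
  \big[*%R/1]_(v \in nonarch_places) v x * \big[*%R/1]_(v \in nonarch_places) v x^-1 = 1.
Proof.
move=> x0 h.
have h' : fin_supp nonarch_places (fun v => v x^-1).
  by apply: fin_supp_sub h => v /nonarch_ultra hv e; rewrite (ultraV hv) e invr1.
split=> //; rewrite -nonarch_prodM // divff //; apply: fsbig1 => v /nonarch_ultra; exact: ultra1.
Qed.

Lemma nonarch_rat (q : rat) : q != 0 -> fin_supp nonarch_places (fun v => v q%:A) /\
  \big[*%R/1]_(v \in nonarch_places) v q%:A * `|ratr q| = 1 :> R.
Proof.
move=> q0.
pose n := `|numq q|%N; pose d := `|denq q|%N.
have n0 : (0 < n)%N by rewrite absz_gt0 numq_eq0.
have d0 : (0 < d)%N by rewrite absz_gt0 denq_neq0.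
have e v : nonarch_places v -> v q%:A = v (n%:R / d%:R).
  move=> /nonarch_ultra hv.
  have int_abs (z : int) : v z%:~R = v `|z|%N%:R.
    by case: z => z; rewrite ?NegzE ?mulrNz ?(ultraN hv) ?abszN.
  rewrite -{1}(divq_num_den q) -in_algE fmorph_div !rmorph_int.
  by rewrite !(ultraM hv) !(ultraV hv) !int_abs.
have [fn pn] := nonarch_nat n0; have [fd pd] := nonarch_nat d0.
have [fd' pd'] := nonarch_inv (natK_neq0 K d0) fd.
split.
  by apply: fin_supp_sub (nonarch_fin_suppM fn fd') => v /e ->.
rewrite (eq_fsbigr (fun v => v (n%:R / d%:R))); last by move=> v; rewrite inE => /e.
rewrite nonarch_prodM // pn.
have qR : `|ratr q| = n%:R / d%:R :> R.
  rewrite /ratr normrM normfV -!intr_norm /n /d; congr (_ / _).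
have dR : d%:R != 0 :> R by rewrite pnatr_eq0 -lt0n.
have nR : n%:R != 0 :> R by rewrite pnatr_eq0 -lt0n.
have -> : \big[*%R/1]_(v \in nonarch_places) v d%:R^-1 = d%:R.
  by apply: (mulfI (invr_neq0 dR)); rewrite mulVf // -pd; exact: pd'.
by rewrite qR; field; rewrite dR nR.
Qed.

Lemma nonarch_cj v : nonarch_places v -> nonarch_places (v \o cj).
Proof.
move=> [hv [p [n [pp hn e]]]]; have hvc := ultra_cj cj hv.
split=> //; exists p, n; split=> //=; last by rewrite rmorph_nat.
rewrite (local_degreeE hcj hv hn).
case: asboolP => h.
  apply: (cj_inv_local_degree hcj hvc) => x /=; rewrite (cjK hcj) h //.
apply: (not_cj_inv_local_degree hcj hvc) => h'; apply: h => x.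
by have := h' x; rewrite /= (cjK hcj) => ->.
Qed.

(** If the norm of x has value 1 but x does not, then x or its conjugate has value above 1, and so
    has the trace. Thus the support is covered by those of two rational numbers, the norm and the
    trace. *)
Lemma nonarch_fin_supp x : x != 0 -> fin_supp nonarch_places (fun v => v x).
Proof.
move=> x0; have nx0 : nm cj x != 0 by rewrite (nm_eq0 hcj).
have [fn _] := nonarch_rat nx0.
have key v : nonarch_places v -> v (nm cj x)%:A = 1 -> v x <> 1 ->
    v (tr cj x)%:A <> 1 /\ tr cj x != 0.
  move=> /nonarch_ultra hv e vx.
  have := ultra_max_tr_nm hcj hv x; rewrite e.
  have := e; rewrite (ultra_nm hcj hv) => e'.
  have vx0 := ultra_gt0 hv x0.
  have cx0 : cj x != 0 by rewrite fmorph_eq0.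
  have vcx0 := ultra_gt0 hv cx0.
  have M1 : 1 < Num.max (v x) (v (cj x)).
    rewrite lt_max; case: (ltgtP (v x) 1) => h //=.
    rewrite -(ltr_pM2l vx0) e' mulr1 //.
  move=> E.
  have : 1 < v (tr cj x)%:A ^+ 2.
    have : 1 < Num.max (v (tr cj x)%:A ^+ 2) 1 by rewrite -E exprn_egt1.
    by rewrite lt_max ltxx orbF.
  move=> h; split=> [h1|]; first by rewrite h1 expr1n ltxx in h.
  by apply/eqP => t0; move: h; rewrite t0 ratA0 (ultra0 hv) expr0n /= ltNge ler01.
have [t0|t0] := eqVneq (tr cj x) 0.
  apply: fin_supp_sub fn => v hv e; apply: contrapT => h.
  by have [_] := key v hv e h; rewrite t0 eqxx.
have [ft _] := nonarch_rat t0.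
apply: fin_supp2 fn ft => v hv e1 e2; apply: contrapT => h.
by have [] := key v hv e1 h.
Qed.

(* The set of places is stable under conjugation, so the square of the product *)
(* at x is the product at the norm of x.                                       *)
Lemma nonarch_product x : x != 0 ->
  (\big[*%R/1]_(v \in nonarch_places) v x) ^+ 2 * `|ratr (nm cj x)| = 1 :> R.
Proof.
move=> x0; have cx0 : cj x != 0 by rewrite fmorph_eq0.
have e : \big[*%R/1]_(v \in nonarch_places) v (cj x) = \big[*%R/1]_(v \in nonarch_places) v x.
  rewrite (@reindex_fsbig _ _ _ _ _ (fun v : K -> R => v \o cj) nonarch_places nonarch_places (fun v => v x)) //; split.
  - by move=> v hv; exact: nonarch_cj.
  - move=> v w _ _ h; apply/funext => y; have := congr1 (fun f => f (cj y)) h.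
    by rewrite /= (cjK hcj).
  - move=> v hv; exists (v \o cj); first exact: nonarch_cj.
    by apply/funext => y /=; rewrite (cjK hcj).
rewrite expr2 -{2}e -nonarch_prodM; try exact: nonarch_fin_supp.
by rewrite -(nmE hcj); apply: (nonarch_rat _).2; rewrite (nm_eq0 hcj).
Qed.

End Places.

(** * Heights *)

Lemma not_square_rat (p D : nat) : prime p -> odd (logn p D) ->
  forall q : rat, q ^+ 2 <> D%:R.
Proof.
move=> pp oD q e.
have D0 : (0 < D)%N by case: D oD {e}; rewrite ?logn0.
have q0 : q != 0 by apply/eqP => q0; move: e; rewrite q0 expr0n => /esym/eqP; rewrite pnatr_eq0; lia.
have : (numq q) ^+ 2 = D%:Z * (denq q) ^+ 2.
  apply: (@intr_inj rat); rewrite !expr2 !intrM.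
  have d0 : (denq q)%:~R != 0 :> rat by rewrite intr_eq0 denq_neq0.
  have -> : (numq q)%:~R = q * (denq q)%:~R by rewrite -{2}(divq_num_den q) divfK.
  by rewrite -[D%:~R]/(D%:R) -e; ring.
move=> /(congr1 absz); rewrite abszM !abszX => /(congr1 (logn p)).
rewrite lognX (lognM _ D0) ?lognX ?expn_gt0 ?absz_gt0 ?denq_neq0 // => /(congr1 odd).
by rewrite oddD oD !oddM.
Qed.

Section QuadraticField.
Variables (R : realType) (K : fieldExtType rat).
Variables (iota : {rmorphism K -> R}) (cj : {rmorphism K -> K}).
Hypothesis dimK : \dim {:K} = 2%N.
Hypothesis cj_neq : exists x : K, cj x <> x.
Variables (s : K) (D : nat).
Hypothesis ss : s ^+ 2 = D%:R.
Hypothesis irr : forall q : rat, q ^+ 2 <> D%:R.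

Lemma quad_basis x : exists p q : rat, x = p%:A + q%:A * s.
Proof.
have s1 : s \notin <<[:: 1%R]>>%VS.
  rewrite span_seq1; apply/vlineP => -[q e]; apply: (irr (q := q)).
  by apply: (@ratA_inj K); rewrite expr2 ratAM -expr2 -e ss ratAn.
have fr : free [:: s; 1%R] by rewrite free_cons s1 seq1_free oner_eq0.
have bs : basis_of {:K} [:: s; 1%R] by rewrite basisEfree fr subvf dimK.
have := coord_basis (X := [tuple s; 1%R]) bs (memvf x).
rewrite big_ord_recl big_ord1 /= => ->.
exists (coord [tuple s; 1] (lift ord0 ord0) x), (coord [tuple s; 1] ord0 x).
by rewrite addrC (scaleQ _ s).
Qed.

Lemma s_neq0 : s != 0.
Proof.
apply/eqP => s0; apply: (irr (q := 0)); apply: (@ratA_inj K).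
by rewrite ratAn -ss s0 !expr0n ratA0.
Qed.

Lemma root_pm (F : fieldType) (f g : {rmorphism K -> F}) :
  f s = g s \/ f s = - g s.
Proof.
have : f s ^+ 2 == g s ^+ 2 by rewrite -!rmorphXn ss !rmorph_nat.
by rewrite eqf_sqr => /orP[]/eqP; tauto.
Qed.

Lemma morph_ext (F : fieldType) (f g : {rmorphism K -> F}) : f s = g s -> f =1 g.
Proof.
move=> e x; have [p [q ->]] := quad_basis x.
have fq (r : rat) : f r%:A = g r%:A.
  by rewrite -in_algE -[LHS]/((f \o in_alg K) r) -[RHS]/((g \o in_alg K) r) !fmorph_eq_rat.
by rewrite !rmorphD !rmorphM e !fq.
Qed.

Lemma cj_s : cj s = - s.
Proof.
case: (root_pm cj idfun) => // e; case: cj_neq => x; case.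
exact: (morph_ext (f := cj) (g := idfun)).
Qed.

Lemma quad_conjP : quad_conj cj.
Proof.
have cjE p q : cj (p%:A + q%:A * s) = p%:A - q%:A * s.
  by rewrite rmorphD rmorphM !cj_rat cj_s mulrN.
split=> // x; have [p [q ->]] := quad_basis x.
  by rewrite cjE rmorphB rmorphM !cj_rat cj_s mulrN opprK.
rewrite cjE => e; exists p.
have : q%:A * s *+ 2 = 0.
  apply: (addrI (p%:A - q%:A * s)); rewrite addr0 [RHS]e mulr2n; ring.
move/eqP; rewrite -mulr_natr !mulf_eq0 (negbTE s_neq0) (negbTE (natK_neq0 K (n := 2) isT)).
by rewrite !orbF => /eqP ->; rewrite mul0r addr0.
Qed.

Let hcj := quad_conjP.

Definition arch1 (x : K) : R := `|iota x| `^ (1 / 2).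
Definition arch2 (x : K) : R := `|iota (cj x)| `^ (1 / 2).

Lemma arch_absE (f : {rmorphism K -> R}) :
  arch_abs (real_complex R \o f : {rmorphism K -> R[i]}) = fun x => `|f x| `^ (1 / 2).
Proof.
apply/funext => x; rewrite /arch_abs dimK asboolT //.
by rewrite /ComplexField.Normc.normc /= expr0n /= addr0 sqrtr_sqr.
Qed.

Lemma arch_abs_ext (phi : {rmorphism K -> R[i]}) (g : {rmorphism K -> R}) :
  phi s = (g s)%:C%C -> arch_abs phi = fun x => `|g x| `^ (1 / 2).
Proof.
move=> e0; have e := @morph_ext _ phi (real_complex R \o g : {rmorphism K -> R[i]}) e0.
apply/funext => x; rewrite /arch_abs dimK asboolT; last by move=> y; rewrite e.
by rewrite e /ComplexField.Normc.normc /= expr0n /= addr0 sqrtr_sqr.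
Qed.

(** An embedding into the complex numbers is determined by the sign it gives to s, so there are two
    archimedean places, both real and with exponent 1/2. *)
Lemma placesE : @places R K = [set v | v = arch1 \/ v = arch2 \/ nonarch_places v].
Proof.
apply/seteqP; split=> v /=.
  case=> [[phi ->]|h]; last by right; right.
  case: (root_pm phi (real_complex R \o iota : {rmorphism K -> R[i]})) => e.
    by left; rewrite (@arch_abs_ext phi iota e).
  right; left; rewrite (@arch_abs_ext phi (iota \o cj : {rmorphism K -> R})) //.
  by rewrite e /= cj_s !rmorphN.
case=> [->|[->|h]]; last by right.
  by left; exists (real_complex R \o iota : {rmorphism K -> R[i]}); rewrite arch_absE.
left; exists (real_complex R \o (iota \o cj : {rmorphism K -> R}) : {rmorphism K -> R[i]}).
by rewrite arch_absE.
Qed.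

Lemma iota_s_neq0 : iota s != 0. Proof. by rewrite fmorph_eq0 s_neq0. Qed.

Lemma arch1_neq_arch2 : arch1 <> arch2.
Proof.
(* The test element is 1 + s because the two places agree at s. *)
move=> /(congr1 (fun f => f (1 + s) `^ 2)); rewrite /arch1 /arch2 -!powRrM.
have -> : 1 / 2 * 2 = 1 :> R by field.
rewrite !powRr1 // !rmorphD /= cj_s !rmorphN !rmorph1 => /eqP.
rewrite eqr_norm2 => /orP[]/eqP e; have := iota_s_neq0.
  by move/eqP; apply; lra.
by exfalso; lra.
Qed.

Let arch_not_nonarch (v : K -> R) (f : {rmorphism K -> R}) :
  (v = fun x => `|f x| `^ (1 / 2)) -> ~ nonarch_places v.
Proof.
move=> -> /nonarch_ultra /ultra_nat/(_ 2); rewrite rmorph_nat leNgt => /negP; apply.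
by rewrite powR_gt1 // ger0_norm // ltr1n.
Qed.

Lemma arch1_not_nonarch : ~ nonarch_places arch1. Proof. exact: (arch_not_nonarch (f := iota)). Qed.
Lemma arch2_not_nonarch : ~ nonarch_places arch2.
Proof. exact: (arch_not_nonarch (f := iota \o cj : {rmorphism K -> R})). Qed.

Definition fin_size (x1 x2 : K) : R :=
  \big[*%R/1]_(v \in @nonarch_places R K) Num.max (v x1) (v x2).

(** Taken without the exponents 1/2, hence the archimedean factor of the squared height. *)
Definition arch_size (x1 x2 : K) : R :=
  Num.max `|iota x1| `|iota x2| * Num.max `|iota (cj x1)| `|iota (cj x2)|.

Lemma fin_supp_max x1 x2 : (x1 != 0) || (x2 != 0) ->
  fin_supp (@nonarch_places R K) (fun v => Num.max (v x1) (v x2)).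
Proof.
have [->|x10] := eqVneq x1 0 => /= x20; have [x20'|x20'] := eqVneq x2 0.
- by rewrite x20' eqxx in x20.
- apply: (fin_supp_sub _ (nonarch_fin_supp R hcj dimK x20')) => v /nonarch_ultra hv e.
  by rewrite (ultra0 hv) e; apply/max_idPr.
- apply: (fin_supp_sub _ (nonarch_fin_supp R hcj dimK x10)) => v /nonarch_ultra hv e.
  by rewrite x20' (ultra0 hv) e; apply/max_idPl.
- apply: (fin_supp2 _ (nonarch_fin_supp R hcj dimK x10) (nonarch_fin_supp R hcj dimK x20')).
  by move=> v _ -> ->; rewrite maxxx.
Qed.

Lemma max_powR (a b r : R) : 0 <= a -> 0 <= b -> 0 <= r ->
  Num.max (a `^ r) (b `^ r) = Num.max a b `^ r.
Proof.
move=> a0 b0 r0; case: (leP a b) => h.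
  by apply/max_idPr; rewrite ge0_ler_powR.
by apply/max_idPl; rewrite ge0_ler_powR // ltW.
Qed.

Lemma height_coord_ge0 (x1 x2 : K) : (x1 != 0) || (x2 != 0) -> 0 <= height_coord R x1 x2.
Proof.
move=> x0; apply/ltW; rewrite /height_coord placesE; apply: fsprod_gt0 => v hv.
rewrite lt_max.
have pos x : x != 0 -> 0 < v x.
  move=> x0'; case: hv => [->|[->|/nonarch_ultra/ultra_gt0]]; last exact.
    by rewrite powR_gt0 // normr_gt0 fmorph_eq0.
  by rewrite powR_gt0 // normr_gt0 !fmorph_eq0.
by case/orP: x0 => /pos -> //; rewrite orbT.
Qed.

Lemma height_coord_sq (x1 x2 : K) : (x1 != 0) || (x2 != 0) ->
  height_coord R x1 x2 ^+ 2 = arch_size x1 x2 * fin_size x1 x2 ^+ 2.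
Proof.
move=> x0; rewrite /height_coord.
rewrite (fsprod_add2 placesE arch1_neq_arch2 arch1_not_nonarch arch2_not_nonarch (fin_supp_max x0)).
rewrite exprMn -/(fin_size x1 x2); congr (_ * _).
rewrite /arch1 /arch2 !max_powR // exprMn -!powR_mulrn ?powR_ge0 //.
rewrite -!powRrM (_ : 1 / 2 * 2 = 1); last by field.
by rewrite !powRr1 // le_max normr_ge0.
Qed.

Lemma iota_nm x : ratr (nm cj x) = iota x * iota (cj x) :> R.
Proof.
rewrite -rmorphM -(nmE hcj); exact: esym (fmorph_eq_rat (iota \o in_alg K : {rmorphism rat -> R}) _).
Qed.

Lemma fin_sizeZ k x1 x2 : k != 0 -> (x1 != 0) || (x2 != 0) ->
  `|iota k * iota (cj k)| * fin_size (k * x1) (k * x2) ^+ 2 = fin_size x1 x2 ^+ 2.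
Proof.
move=> k0 x0.
have -> : fin_size (k * x1) (k * x2) = \big[*%R/1]_(v \in @nonarch_places R K) v k * fin_size x1 x2.
  rewrite -fsprodM; [|exact: (nonarch_fin_supp R hcj)|exact: fin_supp_max].
  apply: eq_fsbigr => v; rewrite inE => /nonarch_ultra hv.
  by rewrite !(ultraM hv) maxr_pMr // ultra_ge0.
rewrite exprMn mulrA [X in X * _ = _](_ : _ = 1) ?mul1r // -iota_nm mulrC.
exact: nonarch_product.
Qed.

Lemma height_coordZ (k x1 x2 : K) : k != 0 -> (x1 != 0) || (x2 != 0) ->
  height_coord R (k * x1) (k * x2) = height_coord R x1 x2.
Proof.
move=> k0 x0; have kx0 : (k * x1 != 0) || (k * x2 != 0).
  by rewrite !mulf_eq0 (negbTE k0).
apply: (pexpIrn (n := 2)); rewrite ?nnegrE ?height_coord_ge0 //.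
rewrite !height_coord_sq // -(fin_sizeZ k0 x0) [RHS]mulrA; congr (_ * _ ^+ 2).
by rewrite /arch_size !rmorphM !normrM -!maxr_pMr //; ring.
Qed.

Definition fin_integral (x : K) := forall v, @nonarch_places R K v -> v x <= 1.

(** Up to sign the inverse matrix is integral too, so at each place neither maximum can exceed the
    other. *)
Lemma fin_size_GL a b c d x1 x2 :
  fin_integral a -> fin_integral b -> fin_integral c -> fin_integral d ->
  a * d - b * c = 1 \/ a * d - b * c = -1 ->
  fin_size (a * x1 + b * x2) (c * x1 + d * x2) = fin_size x1 x2.
Proof.
move=> ia ib ic id hdet; apply: eq_fsbigr => v; rewrite inE => hv.
have hu := nonarch_ultra hv; have g0 := ultra_ge0 hu.
have le a' b' y1 y2 : v a' <= 1 -> v b' <= 1 ->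
    v (a' * y1 + b' * y2) <= Num.max (v y1) (v y2).
  move=> ha hb; rewrite (le_trans (ultraD hu _ _)) // !(ultraM hu) ge_max.
  by rewrite !le_max (ler_piMl (g0 y1) ha) (ler_piMl (g0 y2) hb) orbT.
have [va vb vc vd] := And4 (ia v hv) (ib v hv) (ic v hv) (id v hv).
apply/le_anti; rewrite ge_max !le //=.
set u1 := a * x1 + _; set u2 := c * x1 + _.
have e1 : v x1 = v (d * u1 + (- b) * u2).
  have -> : d * u1 + (- b) * u2 = (a * d - b * c) * x1 by rewrite /u1 /u2; ring.
  by case: hdet => ->; rewrite ?mulN1r ?mul1r ?(ultraN hu).
have e2 : v x2 = v ((- c) * u1 + a * u2).
  have -> : (- c) * u1 + a * u2 = (a * d - b * c) * x2 by rewrite /u1 /u2; ring.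
  by case: hdet => ->; rewrite ?mulN1r ?mul1r ?(ultraN hu).
by rewrite ge_max e1 e2 !le ?(ultraN hu).
Qed.

Lemma weil_height_some (y : K) : weil_height R (Some y : P1 K) = height_coord R y 1.
Proof. by []. Qed.

Lemma weil_height_div (u w : K) : w != 0 ->
  weil_height R (Some (u / w) : P1 K) = height_coord R u w.
Proof.
move=> w0; rewrite weil_height_some -(height_coordZ w0); last by rewrite oner_eq0 orbT.
by rewrite mulr1 mulrC divfK.
Qed.

Lemma height_coord_ge1 (y : K) : 1 <= height_coord R y 1.
Proof.
apply: fsprod_ge1 => v; rewrite placesE le_max => hv.
suff -> : v 1 = 1 by rewrite lexx orbT.
case: hv => [->|[->|/nonarch_ultra/ultra1//]]; rewrite /arch1 /arch2 !rmorph1 normr1 powR1 //.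
Qed.

Lemma fin_size_ge1 y : 1 <= fin_size y 1.
Proof. by apply: fsprod_ge1 => v /nonarch_ultra/ultra1 e; rewrite le_max e lexx orbT. Qed.

Lemma height_coordC (x1 x2 : K) : height_coord R x1 x2 = height_coord R x2 x1.
Proof. by apply: eq_fsbigr => v _; rewrite maxC. Qed.

Lemma height_coord_le1 (y : K) : height_coord R y 1 = 1 -> `|iota y| <= 1.
Proof.
move=> h; have := height_coord_sq (x1 := y) (x2 := 1).
rewrite oner_eq0 orbT h expr1n => /(_ isT) e.
have f1 := fin_size_ge1 y; rewrite leNgt; apply/negP => y1.
have : 1 < arch_size y 1 * fin_size y 1 ^+ 2; last by rewrite -e ltxx.
rewrite /arch_size !rmorph1 normr1.
have m1 : 1 < Num.max `|iota y| 1 by rewrite lt_max y1.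
have m2 : 1 <= Num.max `|iota (cj y)| 1 by rewrite le_max lexx orbT.
have f2 : 1 <= fin_size y 1 ^+ 2 by rewrite exprn_ege1.
have m3 : 1 < Num.max `|iota y| 1 * Num.max `|iota (cj y)| 1.
  by rewrite (lt_le_trans m1) // ler_peMr // (le_trans _ (ltW m1)).
by rewrite (lt_le_trans m3) // ler_peMr // (le_trans _ (ltW m3)).
Qed.

(** Height 1 bounds the real absolute value by 1, and y and its inverse have the same height. *)
Lemma height1_eq1 (y : K) : 0 < iota y -> height_coord R y 1 = 1 -> y = 1.
Proof.
move=> y0 h; have yn0 : y != 0 by rewrite -(fmorph_eq0 iota) gt_eqF.
have h1 := height_coord_le1 h.
have h2 : height_coord R y^-1 1 = 1.
  rewrite -h -(height_coordZ yn0); last by rewrite oner_eq0 orbT.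
  by rewrite divff // mulr1 height_coordC.
have := height_coord_le1 h2; rewrite fmorphV normfV invf_le1 ?normr_gt0 ?fmorph_eq0 // => h3.
apply: (fmorph_inj iota); rewrite rmorph1 -(ger0_norm (ltW y0)); apply/le_anti.
by rewrite h1 h3.
Qed.

Lemma height_0 : weil_height R (Some 0 : P1 K) = 1.
Proof.
rewrite weil_height_some; apply: fsbig1 => v; rewrite placesE => hv.
suff [-> ->] : v 0 = 0 /\ v 1 = 1 by apply/max_idPr.
have h0 : 0 `^ (1 / 2) = 0 :> R by rewrite powR0 // divr1 // invr_eq0 pnatr_eq0.
case: hv => [->|[->|/nonarch_ultra hv]].
- by rewrite /arch1 rmorph0 rmorph1 normr0 normr1 powR1.
- by rewrite /arch2 !rmorph0 !rmorph1 normr0 normr1 powR1.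
- by rewrite (ultra0 hv) (ultra1 hv).
Qed.

Lemma height_1 : weil_height R (Some 1 : P1 K) = 1.
Proof.
rewrite weil_height_some; apply: fsbig1 => v; rewrite placesE => hv.
suff -> : v 1 = 1 by rewrite maxxx.
case: hv => [->|[->|/nonarch_ultra/ultra1//]]; rewrite /arch1 /arch2 !rmorph1 normr1 powR1 //.
Qed.

Lemma fin_integral_nat n : fin_integral n%:R.
Proof. by move=> v /nonarch_ultra/ultra_nat; exact. Qed.
Lemma fin_integralD x y : fin_integral x -> fin_integral y -> fin_integral (x + y).
Proof. by move=> hx hy v hv; apply: (ultraD_le (nonarch_ultra hv)); [apply: hx|apply: hy]. Qed.
Lemma fin_integralM x y : fin_integral x -> fin_integral y -> fin_integral (x * y).
Proof.
move=> hx hy v hv; have hu := nonarch_ultra hv; rewrite (ultraM hu).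
by apply: mulr_ile1; rewrite ?(ultra_ge0 hu) //; [exact: hx|exact: hy].
Qed.
Lemma fin_integral_root x b c : fin_integral b -> fin_integral c ->
  x ^+ 2 = b * x + c -> fin_integral x.
Proof.
move=> hb hc e v hv; have hu := nonarch_ultra hv; rewrite leNgt; apply/negP => x1.
have : v (x ^+ 2) <= v x.
  rewrite e; apply: (ultraD_le hu); last by rewrite (le_trans (hc v hv)) // ltW.
  by rewrite (ultraM hu) ler_piMl ?(ultra_ge0 hu) //; exact: hb.
have vx0 : 0 < v x := lt_trans ltr01 x1.
by rewrite (ultraX hu) expr2 leNgt ltr_pMr // x1.
Qed.

End QuadraticField.

(** * Matrices over quadratic integers *)

Section Cosines.
Variable R : realType.

Lemma cos_pi_div_gt0 (k : nat) : (2 < k)%N -> 0 < cos (pi / k%:R) :> R.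
Proof.
move=> k2; have p0 := pi_gt0 R; have k0 : 0 < k%:R :> R by rewrite ltr0n; lia.
have pk : 0 < pi / k%:R :> R by rewrite divr_gt0.
apply: cos_gt0_pihalf; apply/andP; split.
  by rewrite (lt_trans _ pk) // oppr_lt0 divr_gt0.
by rewrite ltr_pM2l // ltf_pV2 ?posrE ?ltr_nat.
Qed.

Lemma cos_triple (x : R) : cos (x + x + x) = 4 * cos x ^+ 3 - 3 * cos x.
Proof.
rewrite !(cosD, sinD); have := cos2Dsin2 x => h.
have -> : (cos x * cos x - sin x * sin x) * cos x - (sin x * cos x + cos x * sin x) * sin x
   = cos x ^+ 3 - 3 * cos x * (sin x ^+ 2) by ring.
have -> : sin x ^+ 2 = 1 - cos x ^+ 2 by rewrite -h; ring.
ring.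
Qed.

Lemma two_cos_pi3 : 2 * cos (pi / 3%:R) = 1 :> R.
Proof.
have c0 := cos_pi_div_gt0 (k := 3) isT; have := cos_triple (pi / 3%:R).
rewrite (_ : _ + _ + _ = pi); last by field.
rewrite cospi; set c := cos _ in c0 *; move=> e.
have : (c + 1) * (2 * c - 1) ^+ 2 = 0.
  rewrite (_ : _ * _ = 4 * c ^+ 3 - 3 * c + 1); last by ring.
  by rewrite -e addNr.
move/eqP; rewrite mulf_eq0 expf_eq0 /= subr_eq0 => /orP[|/eqP//].
by rewrite gt_eqF // addr_gt0.
Qed.

Lemma two_cos_pi4 : 2 * cos (pi / 4%:R) = Num.sqrt 2%:R :> R.
Proof.
have c0 := cos_pi_div_gt0 (k := 4) isT; have := cosD (pi / 4%:R) (pi / 4%:R : R).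
rewrite (_ : pi / 4%:R + pi / 4%:R = pi / 2); last by field.
rewrite cos_pihalf; have := cos2Dsin2 (pi / 4%:R : R).
set c := cos _ in c0 *; set s := sin _ => h e.
rewrite -[LHS]ger0_norm ?mulr_ge0 ?ltW // -sqrtr_sqr; congr Num.sqrt.
have -> : (2 * c) ^+ 2 = 2 * (c ^+ 2 + s ^+ 2) + 2 * (c * c - s * s) by ring.
by rewrite -e h mulr0 addr0 mulr1.
Qed.

Lemma two_cos_pi6 : 2 * cos (pi / 6%:R) = Num.sqrt 3%:R :> R.
Proof.
have c0 := cos_pi_div_gt0 (k := 6) isT; have := cos_triple (pi / 6%:R).
rewrite (_ : _ + _ + _ = pi / 2); last by field.
rewrite cos_pihalf; set c := cos _ in c0 *; move=> e.
rewrite -[LHS]ger0_norm ?mulr_ge0 ?ltW // -sqrtr_sqr; congr Num.sqrt.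
apply: (mulfI (lt0r_neq0 c0)); apply/eqP; rewrite -subr_eq0; apply/eqP.
by rewrite [RHS]e; ring.
Qed.

Lemma two_cos_pi5 : 2 * cos (pi / 5%:R) = (1 + Num.sqrt 5%:R) / 2 :> R.
Proof.
have c0 := cos_pi_div_gt0 (k := 5) isT.
pose t : R := pi / 5%:R.
have s0 : 0 < sin t.
  have p0 := pi_gt0 R.
  by apply: sin_gt0_pi; rewrite /t divr_gt0 //= ltr_pdivrMr // ltr_pMr // ltr1n.
(* As 5 t = pi, the angles 3 t and 2 t are supplementary; cancelling sin t leaves a quadratic
   equation for cos t. *)
have : sin (t + t + t) = sin (t + t).
  rewrite (_ : t + t + t = - (t + t) + pi); last by rewrite /t; field.
  by rewrite sinDpi sinN opprK.
rewrite !(cosD, sinD); have := cos2Dsin2 t; rewrite -/t in c0 *.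
set c := cos t in c0 *; set s := sin t in s0 * => h e.
have e1 : 4 * c ^+ 2 - 1 = 2 * c.
  apply: (mulfI (lt0r_neq0 s0)).
  have -> : s * (2 * c) = s * c + c * s by ring.
  rewrite -e -[X in _ - X]h; ring.
have q5 : Num.sqrt 5%:R ^+ 2 = 5%:R :> R by rewrite sqr_sqrtr ?ler0n.
have g5 : 0 <= Num.sqrt 5%:R :> R by exact: sqrtr_ge0.
have : (4 * c - 1) ^+ 2 = Num.sqrt 5%:R ^+ 2.
  by rewrite q5 (_ : _ ^+ 2 = 4 * (4 * c ^+ 2 - 1 - 2 * c) + 5%:R); [rewrite e1; ring|ring].
move/eqP; rewrite eqf_sqr => /orP[]/eqP e2; first by lra.
exfalso; have : Num.sqrt 5%:R < 1 :> R by lra.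
nra.
Qed.

End Cosines.

Lemma mx2E (F : Type) (A : 'M[F]_2) : A = mx2 (A 0 0) (A 0 1) (A 1 0) (A 1 1).
Proof.
apply/matrixP => i j; rewrite mxE.
case: i => -[|[|//]] hi; case: j => -[|[|//]] hj /=; congr (A _ _); exact: val_inj.
Qed.

Lemma mx2_ext (F : Type) (A B : 'M[F]_2) :
  A 0 0 = B 0 0 -> A 0 1 = B 0 1 -> A 1 0 = B 1 0 -> A 1 1 = B 1 1 -> A = B.
Proof. by move=> e1 e2 e3 e4; rewrite (mx2E A) (mx2E B) e1 e2 e3 e4. Qed.

Lemma mx2M (F : pzRingType) (A B : 'M[F]_2) i j :
  (A * B) i j = A i 0 * B 0 j + A i 1 * B 1 j.
Proof.
by rewrite mxE big_ord_recl big_ord1; congr (_ + A i _ * B _ j); exact: val_inj.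
Qed.

(* A pair (p, q) stands for p + q theta, where theta^2 = u theta + w.         *)
Definition qz := (Z * Z)%type.
Inductive mz := Mz of qz & qz & qz & qz.

(** * Computable arithmetic and matrices over Z[theta] *)

Section QuadraticIntegers.
Variables u w : Z.

Definition qadd (x y : qz) : qz := (Z.add x.1 y.1, Z.add x.2 y.2).
Definition qopp (x : qz) : qz := (Z.opp x.1, Z.opp x.2).
Definition qmul (x y : qz) : qz :=
  (Z.add (Z.mul x.1 y.1) (Z.mul w (Z.mul x.2 y.2)),
   Z.add (Z.add (Z.mul x.1 y.2) (Z.mul x.2 y.1)) (Z.mul u (Z.mul x.2 y.2))).
Definition qeq (x y : qz) : bool := Z.eqb x.1 y.1 && Z.eqb x.2 y.2.
Definition q0 : qz := (Z0, Z0).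
Definition q1 : qz := (Zpos xH, Z0).

(* 2 (p + q theta) = P + q r with P = 2 p + u q and r^2 = u^2 + 4 w.          *)
Definition qpos (x : qz) : bool :=
  let P := Z.add (Z.add x.1 x.1) (Z.mul u x.2) in
  let q := x.2 in
  let dq := Z.mul (Z.add (Z.mul u u) (Z.mul (Zpos 4) w)) (Z.mul q q) in
  [|| Z.ltb Z0 P && Z.leb Z0 q, Z.leb Z0 P && Z.ltb Z0 q,
      Z.ltb Z0 P && Z.ltb dq (Z.mul P P) | Z.ltb Z0 q && Z.ltb (Z.mul P P) dq].
Definition qnn (x : qz) : bool := qeq x q0 || qpos x.

Definition zmul (A B : mz) : mz :=
  let: Mz a b c d := A in let: Mz a' b' c' d' := B in
  Mz (qadd (qmul a a') (qmul b c')) (qadd (qmul a b') (qmul b d'))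
     (qadd (qmul c a') (qmul d c')) (qadd (qmul c b') (qmul d d')).
Definition zid := Mz q1 q0 q0 q1.
Definition zpow (A : mz) (n : nat) : mz := iter n (zmul A) zid.
Definition zopp (A : mz) : mz :=
  let: Mz a b c d := A in Mz (qopp a) (qopp b) (qopp c) (qopp d).
Definition znn (A : mz) : bool :=
  let: Mz a b c d := A in [&& qnn a, qnn b, qnn c & qnn d].
Definition zdet (A : mz) : qz :=
  let: Mz a b c d := A in qadd (qmul a d) (qopp (qmul b c)).
Definition zcol0 (A : mz) : qz * qz := let: Mz a b c d := A in (a, c).
Definition zcol1 (A : mz) : qz * qz := let: Mz a b c d := A in (b, d).

Section Eval.
Variables (K : fieldType) (theta : K).

Definition zev (z : Z) : K := (int_of_Z z)%:~R.
Definition qev (x : qz) : K := zev x.1 + zev x.2 * theta.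
Definition mev (A : mz) : 'M[K]_2 :=
  let: Mz a b c d := A in mx2 (qev a) (qev b) (qev c) (qev d).

Lemma zevD a b : zev (Z.add a b) = zev a + zev b.
Proof. by rewrite /zev -[Z.add a b]/(a + b)%R rmorphD intrD. Qed.
Lemma zevM a b : zev (Z.mul a b) = zev a * zev b.
Proof. by rewrite /zev -[Z.mul a b]/(a * b)%R rmorphM intrM. Qed.
Lemma zevN a : zev (Z.opp a) = - zev a.
Proof. by rewrite /zev -[Z.opp a]/(- a)%R rmorphN mulrNz. Qed.

Lemma qevD x y : qev (qadd x y) = qev x + qev y.
Proof. by rewrite /qev !zevD; ring. Qed.
Lemma qevN x : qev (qopp x) = - qev x.
Proof. by rewrite /qev !zevN; ring. Qed.
Lemma qev0 : qev q0 = 0. Proof. by rewrite /qev mul0r addr0. Qed.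
Lemma qev1 : qev q1 = 1. Proof. by rewrite /qev mul0r addr0. Qed.
Lemma qeqP x y : qeq x y -> x = y.
Proof. by case: x y => [a b] [c d] /andP[/Z.eqb_eq /= -> /Z.eqb_eq /= ->]. Qed.

Lemma mevN A : mev (zopp A) = - mev A.
Proof. by case: A => a b c d; apply: mx2_ext; rewrite !mxE /= qevN. Qed.
Lemma mev1 : mev zid = 1.
Proof. by apply: mx2_ext; rewrite !mxE /= ?qev0 ?qev1. Qed.

Hypothesis theta2 : theta ^+ 2 = zev u * theta + zev w.

Lemma qevM x y : qev (qmul x y) = qev x * qev y.
Proof.
rewrite /qev /= !zevD !zevM.
have -> : (zev x.1 + zev x.2 * theta) * (zev y.1 + zev y.2 * theta) =
  zev x.1 * zev y.1 + (zev x.1 * zev y.2 + zev x.2 * zev y.1) * theta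
  + zev x.2 * zev y.2 * theta ^+ 2 by ring.
by rewrite theta2; ring.
Qed.

Lemma mevM A B : mev (zmul A B) = mev A * mev B.
Proof.
case: A B => a b c d [a' b' c' d'].
by apply: mx2_ext; rewrite mx2M !mxE /= qevD !qevM.
Qed.

Lemma mevX A n : mev (zpow A n) = mev A ^+ n.
Proof. by elim: n => [|n IH]; rewrite ?mev1 // exprS -IH -mevM. Qed.

Lemma zdetE a b c d : qev (zdet (Mz a b c d)) = qev a * qev d - qev b * qev c.
Proof. by rewrite /zdet qevD qevN !qevM. Qed.

End Eval.

Lemma zev_lt (R : realFieldType) a b : Z.ltb a b -> zev R a < zev R b.
Proof. by move=> h; rewrite /zev ltr_int; lia. Qed.
Lemma zev_le (R : realFieldType) a b : Z.leb a b -> zev R a <= zev R b.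
Proof. by move=> h; rewrite /zev ler_int; lia. Qed.
Lemma zev0 (R : fieldType) : zev R Z0 = 0. Proof. by []. Qed.

Lemma qposP (R : realFieldType) (theta : R) x :
  theta ^+ 2 = zev R u * theta + zev R w -> 0 < 2 * theta - zev R u ->
  qpos x -> 0 < qev theta x.
Proof.
move=> th2 r0; set r := 2 * theta - zev R u in r0.
have r2 : r ^+ 2 = zev R u ^+ 2 + 4 * zev R w.
  by rewrite /r (_ : _ ^+ 2 = 4 * theta ^+ 2 - 4 * zev R u * theta + zev R u ^+ 2); [rewrite th2; ring|ring].
case: x => p q; rewrite /qpos; cbv zeta; cbn [fst snd].
set P := Z.add _ (Z.mul u q); set dq := Z.mul _ (Z.mul q q).
have Pe : 2 * qev theta (p, q) = zev R P + zev R q * r.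
  by rewrite /qev /P /r /= !zevD zevM; ring.
have dqe : zev R dq = (zev R q * r) ^+ 2.
  by rewrite exprMn r2 /dq !zevM zevD !zevM -[zev R (Zpos 4)]/(4%:R); ring.
rewrite -(pmulr_rgt0 _ (ltr0n _ 2)) Pe.
have PP : zev R (Z.mul P P) = zev R P ^+ 2 by rewrite zevM.
have qr0 a : 0 < a -> 0 < a * r by move=> ?; rewrite mulr_gt0.
case/or4P => /andP[] h1 h2.
- have := zev_lt R h1; have := zev_le R h2; rewrite !zev0 => a b.
  by rewrite ltr_wpDr // mulr_ge0 // ltW.
- have := zev_le R h1; have := zev_lt R h2; rewrite !zev0 => a b.
  by rewrite ltr_wpDl // mulr_gt0.
- have := zev_lt R h1; have := zev_lt R h2; rewrite PP dqe zev0 => a b.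
  rewrite -ltrBlDr sub0r; apply: (le_lt_trans (ler_norm _)); rewrite normrN.
  by rewrite -(ger0_norm (ltW b)) -ltr_sqr ?nnegrE // -!normrX !ger0_norm ?sqr_ge0.
- have := zev_lt R h1; have := zev_lt R h2; rewrite PP dqe zev0 => a b.
  have b' := qr0 _ b.
  rewrite -ltrBlDl sub0r; apply: (le_lt_trans (ler_norm _)); rewrite normrN.
  by rewrite -(ger0_norm (ltW b')) -ltr_sqr ?nnegrE // -!normrX !ger0_norm ?sqr_ge0.
Qed.

Lemma qnnP (R : realFieldType) (theta : R) x :
  theta ^+ 2 = zev R u * theta + zev R w -> 0 < 2 * theta - zev R u ->
  qnn x -> 0 <= qev theta x.
Proof.
move=> th2 r0 /orP[/qeqP ->|/(qposP th2 r0)/ltW//]; by rewrite qev0.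
Qed.

Definition zmxI (l m : nat) (ll lm : qz) (a : nat) : mz :=
  let F := Mz q0 q1 q1 q0 in
  let Q := Mz ll q1 (qopp q1) q0 in
  let R := Mz q0 q1 (qopp q1) lm in
  let i := ((a - 1) %/ (l - 1) + 1)%N in
  let j := ((a - 1) %% (l - 1) + 1)%N in
  if odd a then zmul (zmul (zpow R i) (zpow Q j)) F else zmul (zpow R i) (zpow Q j).

Definition zmxII (beta : qz) (a : nat) : mz :=
  let J := Mz (qopp q1) q0 q0 q1 in
  let P := Mz (qopp q1) q1 q0 q1 in
  let M := Mz q1 q0 beta (qopp q1) in
  let q := ((a - 1) %/ 2)%N in
  if odd a then zmul (zmul (zpow (zmul M P) q) M) J
  else zmul (zpow (zmul M P) q.+1) J.

Definition zmxIII (alpha beta gamma delta : qz) (a : nat) : mz :=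
  let P x := Mz (qopp q1) x q0 q1 in
  let M x := Mz q1 q0 x (qopp q1) in
  let U1 := P gamma in
  let U2 := zmul (P gamma) (M delta) in
  let U3 := zmul (zmul (P gamma) (M delta)) (P gamma) in
  let j := ((a - 1) %/ 3 + 1)%N in
  let s := ((a - 1) %% 3)%N in
  let V := if odd j then zmul (zpow (zmul (M beta) (P alpha)) ((j - 1) %/ 2)) (M beta)
           else zpow (zmul (M beta) (P alpha)) (j %/ 2) in
  zmul V (nth zid (if odd j then [:: U3; U2; U1] else [:: U1; U2; U3]) s).

End QuadraticIntegers.

(** For radicand 5 the generator is the golden ratio, with theta^2 = theta + 1; otherwise it is the
    square root, with theta^2 = D. *)
Definition alg_u (T : algorithm) : Z :=
  if radicand T == 5%N then Zpos xH else Z0.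
Definition alg_w (T : algorithm) : Z :=
  if radicand T == 5%N then Zpos xH else Z.of_nat (radicand T).

Definition zmx (T : algorithm) (a : nat) : mz :=
  let u := alg_u T in let w := alg_w T in
  let z (p q : Z) : qz := (p, q) in
  let n2 := Z.of_nat 2 in let n3 := Z.of_nat 3 in let n1 := Z.of_nat 1 in
  match T with
  | I_2_5 => zmxI u w 2 5 q0 (z Z0 n1) a
  | I_3_4 => zmxI u w 3 4 q1 (z Z0 n1) a
  | I_3_5 => zmxI u w 3 5 q1 (z Z0 n1) a
  | I_3_6 => zmxI u w 3 6 q1 (z Z0 n1) a
  | II_4 | II_5 | II_6 => zmxII u w (z n2 n1) a
  | III_6 => zmxIII u w (z n3 (Z.opp n1)) (z n3 n1) (z n2 (Z.opp n1)) (z (Z.opp n2) (Z.opp n1)) a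
  | III_12 => zmxIII u w q1 (z n2 n1) (z n1 (Z.opp n1)) (z (Z.opp n1) (Z.opp n1)) a
  end.

Definition zA (T : algorithm) (a : nat) : mz :=
  let M := zmx T a in if znn (alg_u T) (alg_w T) M then M else zopp M.

(** Determinant +1 means that the branch preserves orientation, so that oo goes to the upper
    endpoint. *)
Definition zsgn (T : algorithm) (a : nat) : bool :=
  qeq (zdet (alg_u T) (alg_w T) (zA T a)) q1.
(* The endpoints of the interval of the letter a, in homogeneous coordinates. *)
Definition zlow (T : algorithm) (a : nat) : qz * qz :=
  if zsgn T a then zcol1 (zA T a) else zcol0 (zA T a).
Definition zupp (T : algorithm) (a : nat) : qz * qz :=
  if zsgn T a then zcol0 (zA T a) else zcol1 (zA T a).

(** The last two clauses keep oo out of every interval but the last, and 0 out of every interval but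
    the first. *)
Definition chk_letter (T : algorithm) (a : nat) : bool :=
  let u := alg_u T in let w := alg_w T in
  let: Mz x y z t := zA T a in
  [&& znn u w (zA T a),
      zsgn T a || qeq (zdet u w (zA T a)) (qopp q1),
      (a == nletters T) || (qpos u w z && qpos u w t) &
      (a == 1%N) || (qpos u w x && qpos u w y)].

(** Neighbouring intervals share an endpoint and their branches have opposite orientations; this is
    the continuity of T. *)
Definition chk_next (T : algorithm) (a : nat) : bool :=
  let eqc (c d : qz * qz) := qeq c.1 d.1 && qeq c.2 d.2 in
  [&& zsgn T a.+1 == ~~ zsgn T a & eqc (zupp T a) (zlow T a.+1)].

(** A positive cross product expresses a strict gap between the upper endpoint of a and the lower
    endpoint of b. *)
Definition chk_far (T : algorithm) (a b : nat) : bool :=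
  let u := alg_u T in let w := alg_w T in
  let l := zlow T b in let p := zupp T a in
  qpos u w (qadd (qmul u w l.1 p.2) (qopp (qmul u w l.2 p.1))).

(** The last branch fixes oo. The first one either takes oo to 0, so that T sends 0 to oo, or has a
    matrix [1 0; z 1] with z > 0 and fixes 0. *)
Definition chk_ends (T : algorithm) : bool :=
  (let: Mz x y z t := zA T (nletters T) in qeq z q0) &&
  (let: Mz x y z t := zA T 1 in
   qeq x q0 || [&& qeq x q1, qeq y q0, qeq t q1 & qpos (alg_u T) (alg_w T) z]).

Definition chk (T : algorithm) : bool :=
  let L := seq.iota 1 (nletters T) in
  [&& all (chk_letter T) L,
      all (fun a => (a == nletters T) || chk_next T a) L,
      all (fun a => all (fun b => (b < a.+2)%N || chk_far T a b) L) L &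
      chk_ends T].

Lemma chkT (T : algorithm) : chk T.
Proof. by case: T; vm_compute. Qed.

(** * The branches of the algorithms *)

Section Moebius.
Variable F : fieldType.

Definition pt (x : P1 F) : F * F := if x is Some y then (y, 1) else (1, 0).
Definition det2 (A : 'M[F]_2) : F := A 0 0 * A 1 1 - A 0 1 * A 1 0.

(** This division-free form treats finite points and oo alike and turns statements about [moebius]
    into polynomial identities. The determinant prevents both image coordinates from vanishing. *)
Lemma moebiusP (A : 'M[F]_2) (x y : P1 F) : det2 A != 0 ->
  moebius A x = y <->
  (A 0 0 * (pt x).1 + A 0 1 * (pt x).2) * (pt y).2 =
  (A 1 0 * (pt x).1 + A 1 1 * (pt x).2) * (pt y).1.
Proof.
move=> dA; rewrite /moebius /pt.
have -> : (let: (x1, x2) := if x is Some y then (y, 1) else (1, 0) in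
  let u := A 0 0 * x1 + A 0 1 * x2 in let v := A 1 0 * x1 + A 1 1 * x2 in
  if v == 0 then None else Some (u / v)) =
  (let u := A 0 0 * (pt x).1 + A 0 1 * (pt x).2 in
   let v := A 1 0 * (pt x).1 + A 1 1 * (pt x).2 in
   if v == 0 then None else Some (u / v)) :> P1 F by case: x.
rewrite -/(pt x) /=; set u := A 0 0 * _ + _; set v := A 1 0 * _ + _.
have uv : v = 0 -> u <> 0.
  move=> v0 u0; have e1 : det2 A * (pt x).1 = A 1 1 * u - A 0 1 * v by rewrite /det2 /u /v; ring.
  have e2 : det2 A * (pt x).2 = A 0 0 * v - A 1 0 * u by rewrite /det2 /u /v; ring.
  move: e1 e2; rewrite u0 v0 !mulr0 subrr => /eqP + /eqP.
  by rewrite !mulf_eq0 (negbTE dA) /=; case: x {u v v0 u0} => [y'|] /=; rewrite oner_eq0.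
have [v0|v0] := eqVneq v 0; case: y => [y|] /=; rewrite ?mulr1 ?mulr0 ?mul0r.
- by split=> // u0; case: (uv v0); rewrite u0 v0 mul0r.
- by rewrite v0.
- split=> [[<-]|->]; first by rewrite mulrCA divff // mulr1.
  by rewrite mulrAC divff // mul1r.
- by split=> // /eqP; rewrite eq_sym (negbTE v0).
Qed.

Lemma det2N (A : 'M[F]_2) : det2 (- A) = det2 A.
Proof. by rewrite /det2 !mxE; ring. Qed.

Lemma det2M (A B : 'M[F]_2) : det2 (A * B) = det2 A * det2 B.
Proof. by rewrite /det2 !mx2M; ring. Qed.

Lemma det2_1 : det2 1 = 1.
Proof. by rewrite /det2 !mxE /=; ring. Qed.

Lemma moebiusN (A : 'M[F]_2) x : det2 A != 0 -> moebius (- A) x = moebius A x.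
Proof.
move=> dA; apply/moebiusP; first by rewrite det2N.
have e := (moebiusP x _ dA).1 erefl.
by rewrite !mxE !mulNr -!opprD !mulNr e.
Qed.

Lemma moebius1 x : moebius (1 : 'M[F]_2) x = x.
Proof. by apply/moebiusP; rewrite ?det2_1 ?oner_eq0 // !mxE /=; ring. Qed.

Lemma moebiusM (A B : 'M[F]_2) x : det2 A != 0 -> det2 B != 0 ->
  moebius (A * B) x = moebius A (moebius B x).
Proof.
move=> dA dB; apply/moebiusP; first by rewrite det2M mulf_neq0.
set y := moebius B x; have ey := (moebiusP x y dB).1 erefl.
set z := moebius A y; have := (moebiusP y z dA).1 erefl; rewrite !mx2M.
set x1 := (pt x).1 in ey *; set x2 := (pt x).2 in ey *.
set u := B 0 0 * x1 + B 0 1 * x2 in ey; set v := B 1 0 * x1 + B 1 1 * x2 in ey.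
move=> ez.
have -> : (A 0 0 * B 0 0 + A 0 1 * B 1 0) * x1 + (A 0 0 * B 0 1 + A 0 1 * B 1 1) * x2 =
  A 0 0 * u + A 0 1 * v by rewrite /u /v; ring.
have -> : (A 1 0 * B 0 0 + A 1 1 * B 1 0) * x1 + (A 1 0 * B 0 1 + A 1 1 * B 1 1) * x2 =
  A 1 0 * u + A 1 1 * v by rewrite /u /v; ring.
(* The cross product in question vanishes after multiplication by either coordinate of the
   intermediate point, and one of them is nonzero. *)
have k : (pt y).1 != 0 \/ (pt y).2 != 0.
  by case: (y) => [?|] /=; [right|left]; exact: oner_neq0.
apply/eqP; rewrite -subr_eq0; apply/eqP.
set y1 := (pt y).1 in ey ez k; set y2 := (pt y).2 in ey ez k.
set z1 := (pt z).1 in ez *; set z2 := (pt z).2 in ez *.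
have e1 : ((A 0 0 * u + A 0 1 * v) * z2 - (A 1 0 * u + A 1 1 * v) * z1) * y1 = 0.
  rewrite (_ : _ * y1 = u * ((A 0 0 * y1 + A 0 1 * y2) * z2 - (A 1 0 * y1 + A 1 1 * y2) * z1)
      - (A 0 1 * z2 - A 1 1 * z1) * (u * y2 - v * y1)); last by ring.
  by rewrite ez ey !subrr !mulr0 subrr.
have e2 : ((A 0 0 * u + A 0 1 * v) * z2 - (A 1 0 * u + A 1 1 * v) * z1) * y2 = 0.
  rewrite (_ : _ * y2 = v * ((A 0 0 * y1 + A 0 1 * y2) * z2 - (A 1 0 * y1 + A 1 1 * y2) * z1)
      + (A 0 0 * z2 - A 1 0 * z1) * (u * y2 - v * y1)); last by ring.
  by rewrite ez ey !subrr !mulr0 addr0.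
by case: k => k; [move/eqP: e1|move/eqP: e2]; rewrite mulf_eq0 (negbTE k) orbF => /eqP.
Qed.

Lemma det2E (A : 'M[F]_2) : det2 A = \det A.
Proof.
rewrite (expand_det_row _ ord0) big_ord_recl big_ord1 /cofactor !det_mx11 !mxE /= expr0 expr1 mul1r.
rewrite /det2 mulN1r mulrN; congr (_ * A _ _ - A _ _ * A _ _); exact: val_inj.
Qed.

Lemma moebius_invmx (A : 'M[F]_2) x y : det2 A != 0 ->
  moebius (invmx A) x = y <-> moebius A y = x.
Proof.
move=> dA; have uA : A \in unitmx by rewrite unitmxE -det2E unitfE.
have dI : det2 (invmx A) != 0.
  by rewrite det2E det_inv invr_eq0 -det2E.
split=> <-; rewrite -moebiusM //.
  by rewrite -[A * _]/(A *m invmx A) mulmxV // moebius1.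
by rewrite -[_ * A]/(invmx A *m A) mulVmx // moebius1.
Qed.

End Moebius.

Lemma pt_map (F G : fieldType) (f : {rmorphism F -> G}) (x : P1 F) :
  pt (omap f x : P1 G) = (f (pt x).1, f (pt x).2).
Proof. by case: x => [y|] /=; rewrite ?rmorph1 ?rmorph0. Qed.

Section Branches.
Variables (R : realType) (T : algorithm).
Variables (K : fieldExtType rat) (iota : {rmorphism K -> R}).
Variables (s : K) (hs : iota s = Num.sqrt (radicand T)%:R).

Lemma s_sq : s ^+ 2 = (radicand T)%:R.
Proof.
apply: (fmorph_inj iota); rewrite rmorphXn /= hs sqr_sqrtr ?ler0n //.
by rewrite rmorph_nat.
Qed.

Lemma radicand_not_square (q : rat) : q ^+ 2 <> (radicand T)%:R.
Proof.
by case: T; [apply: (@not_square_rat 5)|apply: (@not_square_rat 2)|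
  apply: (@not_square_rat 5)|apply: (@not_square_rat 3)|apply: (@not_square_rat 2)|
  apply: (@not_square_rat 5)|apply: (@not_square_rat 3)|apply: (@not_square_rat 2)|
  apply: (@not_square_rat 3)].
Qed.

Definition theta : K := if radicand T == 5%N then (1 + s) / 2 else s.

Let u := alg_u T.
Let w := alg_w T.

Lemma zev_nat (F : fieldType) n : zev F (Z.of_nat n) = n%:R.
Proof.
rewrite /zev pmulrn; congr (_%:~R); lia.
Qed.

Lemma theta_sq : theta ^+ 2 = zev K u * theta + zev K w.
Proof.
rewrite /theta /u /w /alg_u /alg_w; have := s_sq; have := natK_neq0 K (isT : 0 < 2)%N.
case: (boolP (radicand T == 5%N)) => [/eqP ->|_] n2 e; last by rewrite zev_nat zev0 mul0r add0r e.
rewrite -[zev K _]/(1 : K) exprMn sqrrD e expr1n.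
by field.
Qed.

Lemma theta_gt : 0 < 2 * iota theta - zev R u.
Proof.
have D0 : 0 < Num.sqrt (radicand T)%:R :> R.
  by rewrite sqrtr_gt0 ltr0n; case: (T).
rewrite /theta /u /alg_u; case: (radicand T == 5%N).
  rewrite fmorph_div rmorphD rmorph1 rmorph_nat hs -[zev R _]/(1 : R).
  by rewrite mulrCA divff ?pnatr_eq0 // mulr1 addrC addKr.
by rewrite -[zev R _]/(0 : R) subr0 hs mulr_gt0.
Qed.

Lemma iota_zev z : iota (zev K z) = zev R z.
Proof. by rewrite /zev rmorph_int. Qed.
Lemma iota_qev x : iota (qev theta x) = qev (iota theta) x.
Proof. by rewrite /qev rmorphD rmorphM !iota_zev. Qed.

Lemma iota_theta_sq : iota theta ^+ 2 = zev R u * iota theta + zev R w.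
Proof. by rewrite -rmorphXn /= theta_sq rmorphD rmorphM !iota_zev. Qed.

Lemma iota_qpos x : qpos u w x -> 0 < iota (qev theta x).
Proof. rewrite iota_qev; exact: qposP iota_theta_sq theta_gt. Qed.
Lemma iota_qnn x : qnn u w x -> 0 <= iota (qev theta x).
Proof. rewrite iota_qev; exact: qnnP iota_theta_sq theta_gt. Qed.

Lemma of_realE (x : R) (y : K) : iota y = x -> of_real iota x = y.
Proof.
move=> e; rewrite /of_real; case: xgetP => [z _ /= ez|/(_ y)/=].
  by apply: (fmorph_inj iota); rewrite ez.
by rewrite e.
Qed.

Lemma lambda2 : lambda iota 2 = 0.
Proof. by apply: of_realE; rewrite cos_pihalf mulr0 rmorph0. Qed.
Lemma lambda3 : lambda iota 3 = 1.
Proof. by apply: of_realE; rewrite two_cos_pi3 rmorph1. Qed.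

Lemma mev_zmxI l m ll lm a :
  lambda iota l = qev theta ll -> lambda iota m = qev theta lm ->
  mxI iota l m a = mev theta (zmxI u w l m ll lm a).
Proof.
move=> el em; rewrite /mxI /zmxI el em.
by case: (odd a); rewrite !(mevM theta_sq) !(mevX theta_sq) /= !qevN !qev1 !qev0.
Qed.

Lemma mev_zmxII b zb a : b = qev theta zb -> mxII b a = mev theta (zmxII u w zb a).
Proof.
move=> ->; rewrite /mxII /zmxII.
case: (odd a); rewrite !(mevM theta_sq) !(mevX theta_sq) !(mevM theta_sq) /= !qevN !qev1 !qev0 => //; by rewrite exprS.
Qed.

Lemma mev_zmxIII al be ga de zal zbe zga zde a :
  al = qev theta zal -> be = qev theta zbe -> ga = qev theta zga -> de = qev theta zde ->
  mxIII al be ga de a = mev theta (zmxIII u w zal zbe zga zde a).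
Proof.
move=> -> -> -> ->; rewrite /mxIII /zmxIII.
have mod3 : ((a - 1) %% 3 < 3)%N by rewrite ltn_mod.
case: (odd _); case: (_ %% 3)%N mod3 => [|[|[|//]]] _;
 rewrite /nth !(mevM theta_sq) ?(mevX theta_sq) ?(mevM theta_sq) /= !qevN !qev1 !qev0 //.
Qed.

Lemma qev_pair p q : qev theta (p, q) = zev K p + zev K q * theta. Proof. by []. Qed.

(** Matches the matrices written with cosines and real square roots with those over Z[theta], so
    that [chkT] applies to them. *)
Lemma mxA_mev a : mxA iota T a = mev theta (zmx T a).
Proof.
have rtE : rt iota (radicand T) = s by apply: of_realE.
have th5 : radicand T = 5%N -> theta = (1 + s) / 2 by move=> e; rewrite /theta e eqxx.
have thn : radicand T <> 5%N -> theta = s by move/eqP/negbTE => e; rewrite /theta e.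
have l5 : radicand T = 5%N -> lambda iota 5 = theta.
  move=> e; apply: of_realE; rewrite th5 // fmorph_div rmorphD rmorph1 rmorph_nat hs e.
  by rewrite two_cos_pi5.
have l4 : radicand T = 2%N -> lambda iota 4 = theta.
  by move=> e; apply: of_realE; rewrite thn ?e // hs e two_cos_pi4.
have l6 : radicand T = 3%N -> lambda iota 6 = theta.
  by move=> e; apply: of_realE; rewrite thn ?e // hs e two_cos_pi6.
have thE : theta = qev theta (Z0, Zpos 1) by rewrite qev_pair zev0 add0r mul1r.
move: rtE th5 thn l5 l4 l6 thE; rewrite /mxA /zmx -/u -/w.
have qE := qev_pair; have lam2 := lambda2; have lam3 := lambda3.
have e1 := qev1 theta; have e0 := qev0 theta.
have z1 : zev K (Zpos 1) = 1 by [].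
have z2 : zev K (Zpos 2) = 2 by [].
have z3 : zev K (Zpos 3) = 3 by [].
have m1 : zev K (Zneg 1) = - 1 by [].
have m2 : zev K (Zneg 2) = - 2 by [].
have zE := (z1, z2, z3, m1, m2, zev0, mulN1r, mul1r, mul0r, add0r, addr0).
have mI := mev_zmxI; have mII := mev_zmxII; have mIII := mev_zmxIII.
case: (T) => /= rtE th5 thn l5 l4 l6 thE.
- by apply: mI; rewrite ?lam2 ?e0 // l5.
- by apply: mI; rewrite ?lam3 ?e1 // l4.
- by apply: mI; rewrite ?lam3 ?e1 // l5.
- by apply: mI; rewrite ?lam3 ?e1 // l6.
- by apply: mII; rewrite qE !zE rtE thn.
- by apply: mII; rewrite qE !zE /tau rtE th5.
- by apply: mII; rewrite qE !zE rtE thn.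
- by apply: mIII; rewrite qE !zE rtE thn.
- by apply: mIII; rewrite ?e1 // qE !zE ?rtE thn.
Qed.

End Branches.

Lemma moebius_inj (F : fieldType) (A : 'M[F]_2) (x y : P1 F) : det2 A != 0 ->
  moebius A x = moebius A y -> x = y.
Proof.
by move=> dA h; rewrite -((moebius_invmx _ _ dA).2 h) ((moebius_invmx _ y dA).2 erefl).
Qed.

(** A non-negative matrix preserves the cone of non-negative coordinates, so passing to normalized
    coordinates costs only a positive factor, and signs can be read off. *)
Lemma moebius_cone (R : realFieldType) (A : 'M[R]_2) (w z : P1 R) :
  det2 A != 0 -> (forall i j, 0 <= A i j) -> 0 <= (pt w).1 -> 0 <= (pt w).2 ->
  moebius A w = z ->
  exists2 k, 0 < k & (pt z).1 = k * (A 0 0 * (pt w).1 + A 0 1 * (pt w).2) /\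
    (pt z).2 = k * (A 1 0 * (pt w).1 + A 1 1 * (pt w).2).
Proof.
move=> dA A0 w10 w20 /(moebiusP _ _ dA).
set N := A 0 0 * _ + _; set D := A 1 0 * _ + _.
have N0 : 0 <= N by rewrite addr_ge0 ?mulr_ge0.
have D0 : 0 <= D by rewrite addr_ge0 ?mulr_ge0.
have ND : D = 0 -> N <> 0.
  move=> d0 n0; have e1 : det2 A * (pt w).1 = A 1 1 * N - A 0 1 * D by rewrite /det2 /N /D; ring.
  have e2 : det2 A * (pt w).2 = A 0 0 * D - A 1 0 * N by rewrite /det2 /N /D; ring.
  move: e1 e2; rewrite n0 d0 !mulr0 subrr => /eqP + /eqP.
  by rewrite !mulf_eq0 (negbTE dA) /=; case: (w) => [y'|] /=; rewrite oner_eq0.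
case: z => [z|] /=; rewrite ?mulr1 ?mulr0 => e.
  have Dn : D != 0 by apply/eqP => d0; case: (ND d0); rewrite e d0 mul0r.
  exists D^-1; first by rewrite invr_gt0 lt_def Dn.
  by split; rewrite ?mulVf // e mulrA mulVf // mul1r.
have Nn : N != 0 by apply/eqP => n0; exact: (ND (esym e)).
exists N^-1; first by rewrite invr_gt0 lt_def Nn.
by rewrite mulVf // -e mulr0.
Qed.

Section Branches.
Variables (R : realType) (T : algorithm).
Variables (K : fieldExtType rat) (iota : {rmorphism K -> R}).
Variables (s : K) (hs : iota s = Num.sqrt (radicand T)%:R).

Local Notation th := (theta T s).
Local Notation u := (alg_u T).
Local Notation w := (alg_w T).
Local Notation ev := (qev th).

Definition pos_mx (B : 'M[K]_2) : Prop :=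
  [/\ forall i j, 0 <= iota (B i j), forall i j, fin_integral R (B i j) &
      det2 B = 1 \/ det2 B = -1].

Lemma pos_mx_det B : pos_mx B -> det2 B != 0.
Proof. by case=> _ _ [->|->]; rewrite ?oppr_eq0 oner_eq0. Qed.

Definition Bm (a : nat) : 'M[K]_2 := mev th (zA T a).

Lemma mxA_Bm a : mxA iota T a = Bm a \/ mxA iota T a = - Bm a.
Proof.
rewrite (mxA_mev hs) /Bm /zA; case: ifP => _; first by left.
by right; rewrite mevN opprK.
Qed.

Lemma chk_allP (P : pred nat) (n : nat) : all P (seq.iota 1 n) ->
  forall a, (0 < a <= n)%N -> P a.
Proof. by move=> /allP h a ha; apply: h; rewrite mem_iota; lia. Qed.

Lemma letterP a : letter T a -> chk_letter T a.
Proof. by move=> ha; case/and4P: (chkT T) => h _ _ _; exact: chk_allP h a ha. Qed.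

Lemma fin_integral_int z : fin_integral R (zev K z).
Proof. by move=> v /nonarch_ultra hv; exact: ultra_int. Qed.

Lemma fin_integral_qev x : fin_integral R (ev x).
Proof.
have hth : fin_integral R th.
  by apply: (fin_integral_root _ _ (theta_sq hs)); exact: fin_integral_int.
apply: fin_integralD; first exact: fin_integral_int.
by apply: fin_integralM => //; exact: fin_integral_int.
Qed.

Lemma Bm_det a : letter T a -> det2 (Bm a) = if zsgn T a then 1 else -1.
Proof.
move=> /letterP; rewrite /chk_letter /zsgn /Bm.
case E : (zA T a) => [x y z t] => /and4P[_ h _ _].
have dE : det2 (mev th (Mz x y z t)) = ev (zdet u w (Mz x y z t)).
  by rewrite (zdetE (theta_sq hs)) /det2 !mxE.
rewrite dE; move: h; case: ifP => [/qeqP -> _|_ /= /qeqP ->]; first by rewrite qev1.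
by rewrite qevN qev1.
Qed.

Lemma Bm_pos a : letter T a -> pos_mx (Bm a).
Proof.
move=> la; split; last by rewrite Bm_det //; case: ifP; [left|right].
  move: (letterP la); rewrite /chk_letter /Bm.
  case: (zA T a) => x y z t => /and4P[/and4P[hx hy hz ht] _ _ _] i j; rewrite mxE.
  by case: ifP => _; case: ifP => _; exact: (iota_qnn hs).
rewrite /Bm; case: (zA T a) => x y z t i j; rewrite mxE.
by case: ifP => _; case: ifP => _; exact: fin_integral_qev.
Qed.

Lemma mxA_det a : letter T a -> det2 (mxA iota T a) != 0.
Proof.
by move=> la; have := pos_mx_det (Bm_pos la); case: (mxA_Bm a) => ->; rewrite ?det2N.
Qed.

Definition low (a : nat) : K * K := (ev (zlow T a).1, ev (zlow T a).2).
Definition upp (a : nat) : K * K := (ev (zupp T a).1, ev (zupp T a).2).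

Lemma low_uppE a : letter T a ->
  if zsgn T a then low a = (Bm a 0 1, Bm a 1 1) /\ upp a = (Bm a 0 0, Bm a 1 0)
  else low a = (Bm a 0 0, Bm a 1 0) /\ upp a = (Bm a 0 1, Bm a 1 1).
Proof.
move=> la; rewrite /low /upp /zlow /zupp /Bm; case: (zsgn T a);
by case: (zA T a) => x y z t; rewrite !mxE.
Qed.

(** Membership becomes sign conditions: writing z as a positive multiple of the image of x, the
    determinant turns each cross product with an endpoint into a positive multiple of a coordinate
    of x. *)
Lemma itvA_P a (z : P1 K) : letter T a -> itvA iota T a (real_point iota z) ->
  [/\ 0 <= iota (pt z).1, 0 <= iota (pt z).2,
      0 <= iota ((pt z).1 * (low a).2 - (pt z).2 * (low a).1) &
      0 <= iota ((upp a).1 * (pt z).2 - (upp a).2 * (pt z).1)].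
Proof.
move=> la [x Ix]; have [B0 _ _] := Bm_pos la.
have dB := pos_mx_det (Bm_pos la).
set B := map_mx iota (Bm a).
have dBR : det2 B != 0 by rewrite /det2 !mxE -!rmorphM -rmorphB fmorph_eq0.
have -> : moebius (map_mx iota (mxA iota T a)) x = moebius B x.
  by case: (mxA_Bm a) => -> //; rewrite map_mxN moebiusN.
have x1 : 0 <= (pt x).1 by case: (x) Ix => [y|] //= _; exact: ler01.
have x2 : 0 <= (pt x).2 by case: (x) => [y|] //=; exact: ler01.
have BR0 i j : 0 <= B i j by rewrite mxE.
move=> /(moebius_cone dBR BR0 x1 x2)[k k0].
rewrite pt_map !mxE; cbn [fst snd]; move=> [e1 e2].
have z1 : 0 <= iota (pt z).1 by rewrite e1 mulr_ge0 ?(ltW k0) ?addr_ge0 ?mulr_ge0.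
have z2 : 0 <= iota (pt z).2 by rewrite e2 mulr_ge0 ?(ltW k0) ?addr_ge0 ?mulr_ge0.
have dt := Bm_det la; have := low_uppE la; move: dt; rewrite /det2.
case: (zsgn T a) => /(congr1 iota); rewrite rmorphB !rmorphM ?rmorphN rmorph1 => dt [-> ->] /=;
split=> //; rewrite rmorphB !rmorphM e1 e2; move: dt;
set b00 := iota (Bm a 0 0); set b01 := iota (Bm a 0 1); set b10 := iota (Bm a 1 0);
set b11 := iota (Bm a 1 1) => dt.
- have -> : k * (b00 * (pt x).1 + b01 * (pt x).2) * b11 - k * (b10 * (pt x).1 + b11 * (pt x).2) * b01
    = (b00 * b11 - b01 * b10) * k * (pt x).1 by ring.
  by rewrite dt mul1r mulr_ge0 // ltW.
- have -> : b00 * (k * (b10 * (pt x).1 + b11 * (pt x).2)) - b10 * (k * (b00 * (pt x).1 + b01 * (pt x).2))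
    = (b00 * b11 - b01 * b10) * k * (pt x).2 by ring.
  by rewrite dt mul1r mulr_ge0 // ltW.
- have -> : k * (b00 * (pt x).1 + b01 * (pt x).2) * b10 - k * (b10 * (pt x).1 + b11 * (pt x).2) * b00
    = - (b00 * b11 - b01 * b10) * k * (pt x).2 by ring.
  by rewrite dt opprK mul1r mulr_ge0 // ltW.
- have -> : b01 * (k * (b10 * (pt x).1 + b11 * (pt x).2)) - b11 * (k * (b00 * (pt x).1 + b01 * (pt x).2))
    = - (b00 * b11 - b01 * b10) * k * (pt x).1 by ring.
  by rewrite dt opprK mul1r mulr_ge0 // ltW.
Qed.

Lemma Tmap_first a (z : P1 K) : letter T a -> itvA iota T a (real_point iota z) ->
  exists b, [/\ letter T b, itvA iota T b (real_point iota z), (b <= a)%N &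
    Tmap iota T z = moebius (invmx (mxA iota T b)) z].
Proof.
move=> la ha; rewrite /Tmap.
set L := [seq _ <- _ | _].
have aL : a \in L.
  by rewrite mem_filter asboolT //= mem_iota; move: la; rewrite /letter; lia.
have sL : sorted ltn L by apply: sorted_filter; [exact: ltn_trans|exact: iota_ltn_sorted].
case E : L aL sL => [//|b l] aL /= sL; exists b.
have : b \in L by rewrite E mem_head.
rewrite mem_filter mem_iota => /andP[/asboolP hb lb]; split=> //.
move: aL; rewrite inE => /orP[/eqP -> //|/(allP (order_path_min ltn_trans sL))].
exact: ltnW.
Qed.

(** [Tmap] uses the first interval b containing z, which may differ from a. Then a and b are
    neighbours and z is their common endpoint, where both branches agree. *)
Lemma Tmap_branch a (z : P1 K) : letter T a -> itvA iota T a (real_point iota z) ->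
  moebius (mxA iota T a) (Tmap iota T z) = z.
Proof.
move=> la ha; have [b [lb hb ba ->]] := Tmap_first la ha.
have hA c x y : letter T c -> moebius (mxA iota T c) x = y <-> moebius (Bm c) x = y.
  by move=> lc; have := pos_mx_det (Bm_pos lc); case: (mxA_Bm c) => -> // d; rewrite moebiusN.
have dA := mxA_det lb.
have [e|ne] := eqVneq b a.
  by subst b; apply/(moebius_invmx _ _ dA).
have [z1 z2 lz _] := itvA_P la ha; have [_ _ _ uz] := itvA_P lb hb.
have blt : (b < a)%N by lia.
case/and4P: (chkT T) => _ hn hf _.
have [e|e] := eqVneq a b.+1.
  have := chk_allP hn lb; have -> /= : (b == nletters T) = false.
    by apply/eqP => br; move: la; rewrite /letter; lia.
  rewrite /chk_next -e => /andP[/eqP sg /andP[/qeqP c1 /qeqP c2]].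
  have ul : upp b = low a by rewrite /upp /low c1 c2.
  have cr : (upp b).1 * (pt z).2 = (upp b).2 * (pt z).1.
    apply/eqP; rewrite -subr_eq0 -(fmorph_eq0 iota); apply/eqP/le_anti.
    rewrite uz andbT -oppr_ge0 -rmorphN ul.
    by move: lz; rewrite (_ : _ - _ = - ((low a).1 * (pt z).2 - (low a).2 * (pt z).1)) //; ring.
  (* The upper endpoint of b is the image of oo or of 0 according to the determinant; as the
     orientation alternates, the lower endpoint of a is the image of the same point. *)
  pose v : P1 K := if zsgn T b then None else Some 0.
  have -> : moebius (invmx (mxA iota T b)) z = v.
    apply/(moebius_invmx _ _ dA)/hA => //; apply/moebiusP; first exact/pos_mx_det/Bm_pos.
    move: (low_uppE lb) cr; rewrite /v; case: (zsgn T b) => -[_ ->] /= cr.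
      by rewrite !mulr1 !mulr0 !addr0.
    by rewrite !mulr1 !mulr0 !add0r.
  apply/hA => //; apply/moebiusP; first exact/pos_mx_det/Bm_pos.
  move: (low_uppE la) cr; rewrite ul /v sg; case: (zsgn T b) => -[-> _] /= cr.
    by rewrite !mulr1 !mulr0 !addr0.
  by rewrite !mulr1 !mulr0 !add0r.
(* For non-neighbours the strict gap would make both coordinates of z non-positive, although one of
   them is 1. *)
have := chk_allP (chk_allP hf lb) la; have -> /= : (a < b.+2)%N = false by lia.
move=> /(iota_qpos hs).
rewrite qevD qevN !(qevM (theta_sq hs)) -/(low a).1 -/(low a).2 -/(upp b).1 -/(upp b).2.
rewrite -[ev _]/((low a).1) -[X in _ * X - _]/((upp b).2) -[X in _ - X * _]/((low a).2) -[X in _ - _ * X]/((upp b).1).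
move=> pos; exfalso.
have nn c : letter T c -> [/\ 0 <= iota (low c).1, 0 <= iota (low c).2,
    0 <= iota (upp c).1 & 0 <= iota (upp c).2].
  move=> lc; have [B0 _ _] := Bm_pos lc; have := low_uppE lc.
  by case: (zsgn T c) => -[-> ->] /=; split.
have [l1 l2 _ _] := nn a la; have [_ _ p1 p2] := nn b lb.
move: pos lz uz; rewrite !rmorphB !rmorphM /=.
move: l1 l2 p1 p2 z1 z2.
set L1 := iota (low a).1; set L2 := iota (low a).2; set P1' := iota (upp b).1.
set P2 := iota (upp b).2; set Z1 := iota (pt z).1; set Z2 := iota (pt z).2.
move=> l1 l2 p1 p2 z1 z2 pos lz uz.
have Z1e : Z1 * (L1 * P2 - L2 * P1') = - L1 * (P1' * Z2 - P2 * Z1) - P1' * (Z1 * L2 - Z2 * L1).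
  ring.
have Z2e : Z2 * (L1 * P2 - L2 * P1') = - L2 * (P1' * Z2 - P2 * Z1) - P2 * (Z1 * L2 - Z2 * L1).
  ring.
have h1 : Z1 * (L1 * P2 - L2 * P1') <= 0.
  by rewrite Z1e mulNr -opprD oppr_le0 addr_ge0 // mulr_ge0.
have h2 : Z2 * (L1 * P2 - L2 * P1') <= 0.
  by rewrite Z2e mulNr -opprD oppr_le0 addr_ge0 // mulr_ge0.
move: h1 h2; rewrite !pmulr_lle0 //; rewrite /Z1 /Z2.
by case: (z) => [y|] /=; rewrite rmorph1 ler10.
Qed.

Lemma itvA_None a : letter T a -> itvA iota T a None -> a = nletters T.
Proof.
move=> la ha; have [_ _ /= hl hu] := itvA_P (z := None) la ha.
apply/eqP; apply/negPn/negP => ne.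
have : let: Mz x y z t := zA T a in qpos u w z && qpos u w t.
  move: (letterP la); rewrite /chk_letter (negbTE ne).
  by case: (zA T a) => x y z t /and4P[_ _ h _].
move: hl hu; rewrite /low /upp /zlow /zupp.
case: (zsgn T a); case: (zA T a) => x y z t /= hl hu /andP[p1 p2]; move: hl hu;
rewrite !(mul1r, mul0r, mulr1, mulr0, subr0, sub0r, add0r) rmorphN oppr_ge0 !leNgt;
by rewrite ?(iota_qpos hs p1) ?(iota_qpos hs p2).
Qed.

Lemma itvA_0 a : letter T a -> itvA iota T a (Some 0) -> a = 1%N.
Proof.
move=> la ha; have ha' : itvA iota T a (real_point iota (Some 0)) by rewrite /= rmorph0.
have [_ _ /= hl hu] := itvA_P la ha'.
apply/eqP; apply/negPn/negP => ne.
have : let: Mz x y z t := zA T a in qpos u w x && qpos u w y.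
  move: (letterP la); rewrite /chk_letter (negbTE ne).
  by case: (zA T a) => x y z t /and4P[_ _ _ h].
move: hl hu; rewrite /low /upp /zlow /zupp.
case: (zsgn T a); case: (zA T a) => x y z t /= hl hu /andP[p1 p2]; move: hl hu;
rewrite !(mul1r, mul0r, mulr1, mulr0, subr0, sub0r, add0r) rmorphN oppr_ge0 !leNgt;
by rewrite ?(iota_qpos hs p1) ?(iota_qpos hs p2).
Qed.

Lemma letter_1 : letter T 1.
Proof. by rewrite /letter; case: (T). Qed.

Lemma Tmap_None a : letter T a -> itvA iota T a None -> Tmap iota T None = None.
Proof.
move=> la ha; have e := Tmap_branch (z := None) la ha.
have ar := itvA_None la ha; apply: (moebius_inj (mxA_det la)); rewrite e.
have d := pos_mx_det (Bm_pos la).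
have -> : moebius (mxA iota T a) None = moebius (Bm a) None.
  by case: (mxA_Bm a) => -> //; rewrite moebiusN.
apply/esym/moebiusP => //=; rewrite !mulr0 !mulr1 addr0.
case/and4P: (chkT T) => _ _ _ /andP[+ _]; rewrite -ar /Bm.
by case: (zA T a) => x y z t /qeqP ->; rewrite mxE /= qev0.
Qed.

Lemma Tmap_0 a : letter T a -> itvA iota T a (Some 0) ->
  Tmap iota T (Some 0) = None \/
  Tmap iota T (Some 0) = Some 0 /\ exists2 c, 0 < iota c & Bm 1 = mx2 1 0 c 1.
Proof.
move=> la ha; have ha' : itvA iota T a (real_point iota (Some 0)) by rewrite /= rmorph0.
have e := Tmap_branch la ha'.
have a1 := itvA_0 la ha; subst a.
have d := pos_mx_det (Bm_pos la).
have eB v : moebius (mxA iota T 1) v = moebius (Bm 1) v.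
  by case: (mxA_Bm 1) => -> //; rewrite moebiusN.
case/and4P: (chkT T) => _ _ _ /andP[_]; move: d eB; rewrite /Bm.
case: (zA T 1) => x y z t /= d eB /orP[/qeqP x0|/and4P[/qeqP ex /qeqP ey /qeqP et hz]].
  left; apply: (moebius_inj (mxA_det la)); rewrite e eB.
  by apply/esym/moebiusP => //=; rewrite !mxE /= x0 qev0 !mulr0 mul0r addr0 mul0r.
right; split; last first.
  by exists (ev z); [exact: (iota_qpos hs)|rewrite ex ey et qev0 qev1].
apply: (moebius_inj (mxA_det la)); rewrite e eB.
by apply/esym/moebiusP => //=; rewrite !mxE /= ey qev0 !mulr0 mul0r addr0 mul0r.
Qed.

Definition good_mx (A : 'M[K]_2) : Prop :=
  exists2 B, A = B \/ A = - B & pos_mx B.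

Lemma pos_mxM A B : pos_mx A -> pos_mx B -> pos_mx (A * B).
Proof.
move=> [A0 iA dA] [B0 iB dB]; split=> [i j|i j|].
- by rewrite mx2M rmorphD !rmorphM addr_ge0 ?mulr_ge0.
- by rewrite mx2M; apply: fin_integralD; apply: fin_integralM.
- by rewrite det2M; case: dA => ->; case: dB => ->; rewrite ?mulN1r ?opprK ?mul1r; tauto.
Qed.

Lemma good_mx_prod (l : seq nat) : all (letter T) l ->
  good_mx (\prod_(c <- l) mxA iota T c).
Proof.
elim: l => [|c l IH] /=.
  move=> _; rewrite big_nil; exists 1; first by left.
  split=> [i j|i j|]; last by rewrite det2_1; left.
    by rewrite mxE; case: (_ == _); rewrite ?rmorph1 ?rmorph0.
  by rewrite mxE; exact: fin_integral_nat.
move=> /andP[lc /IH[B hB pB]]; rewrite big_cons.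
exists (Bm c * B); last exact: pos_mxM (Bm_pos lc) pB.
by case: (mxA_Bm c) => ->; case: hB => ->; rewrite ?mulNr ?mulrN ?opprK; tauto.
Qed.

Lemma good_mx_det A : good_mx A -> det2 A != 0.
Proof. by case=> B [->|->] /pos_mx_det; rewrite ?det2N. Qed.

Lemma orbit_prod (z : P1 K) (b : nat -> nat) n :
  (forall i, (i < n)%N -> letter T (b i) /\
     itvA iota T (b i) (real_point iota (iter i (Tmap iota T) z))) ->
  z = moebius (\prod_(c <- [seq b i | i <- seq.iota 0 n]) mxA iota T c)
        (iter n (Tmap iota T) z).
Proof.
elim: n => [|n IH] h; first by rewrite /= big_nil moebius1.
have h' i : (i < n)%N -> _ := fun hi => h i (ltnW hi).
have -> : [seq b i | i <- seq.iota 0 n.+1] = [seq b i | i <- seq.iota 0 n] ++ [:: b n].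
  by rewrite -addn1 iotaD map_cat.
rewrite big_cat big_seq1.
have [lb hb] := h n (ltnSn n).
rewrite moebiusM ?mxA_det //; last first.
  apply: good_mx_det; apply: good_mx_prod; apply/allP => c /mapP; case=> i.
  by rewrite mem_iota => /andP[_ hi] ->; have [] := h' i hi.
by rewrite iterS Tmap_branch //; exact: IH.
Qed.

End Branches.

(** * The sets E^sharp *)

Section QuasiConcave.
Variable R : realType.
Variables (a b c d : R).
Hypotheses (a0 : 0 <= a) (b0 : 0 <= b) (c0 : 0 <= c) (d0 : 0 <= d).

Definition fmax (z : R) : R := Num.max (a * z + b) (c * z + d) / Num.max z 1.

Lemma max1_gt0 (z : R) : 0 < Num.max z 1.
Proof. by rewrite lt_max ltr01 orbT. Qed.

Lemma fmax_homo (y z : R) : 0 <= y -> y <= z -> z <= 1 -> fmax y <= fmax z.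
Proof.
move=> y0 yz z1; rewrite /fmax.
rewrite (max_idPr (le_trans yz z1)) (max_idPr z1) !divr1.
by rewrite ge_max !le_max !lerD2r !(ler_wpM2l _ yz) ?orbT.
Qed.

Lemma fmax_anti (y z : R) : 1 <= y -> y <= z -> fmax z <= fmax y.
Proof.
move=> y1 yz; rewrite /fmax.
have z1 := le_trans y1 yz.
have y0 : 0 < y := lt_le_trans ltr01 y1; have z0 : 0 < z := lt_le_trans ltr01 z1.
rewrite (max_idPl y1) (max_idPl z1) ler_pdivrMr // mulrAC ler_pdivlMr //.
rewrite maxr_pMl ?(ltW y0) // maxr_pMl ?(ltW z0) //.
rewrite ge_max !le_max; apply/andP; split; apply/orP; [left|right].
  by rewrite !mulrDl mulrAC lerD2l ler_wpM2l.
by rewrite !mulrDl mulrAC lerD2l ler_wpM2l.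
Qed.

Lemma fmax_le1 (z : R) : 0 <= z -> fmax z <= fmax 1.
Proof.
move=> z0; case: (leP z 1) => z1; first exact: fmax_homo.
exact/fmax_anti/ltW.
Qed.

(** Clearing the positive denominator leaves the sign of a continuous function. Hence f >= t passes
    from E^sharp to its closure. *)
Lemma fmax_lt_near (t y : R) : fmax y < t -> \forall z \near y, fmax z < t.
Proof.
pose h (z : R) : R := Num.max (a * z + b) (c * z + d) - t * Num.max z 1.
have hE z : (fmax z < t) = (h z < 0).
  by rewrite /fmax ltr_pdivrMr ?max1_gt0 // /h subr_lt0.
rewrite hE => hy.
have lin (p q : R) : {for y, continuous (fun z : R => p * z + q : R^o)}.
  by apply: cvgD; [apply: cvgM; [exact: cvg_cst|exact: cvg_id]|exact: cvg_cst].
have hc : {for y, continuous (h : R -> R^o)}.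
  apply: cvgB.
    exact: (continuous_max (lin a b) (lin c d)).
  apply: cvgM; first exact: cvg_cst.
  apply: (@continuous_max R R id (fun=> 1)); [exact: cvg_id|exact: cvg_cst].
by apply: filterS (cvgr_lt (h y) hc _ hy) => z; rewrite hE.
Qed.

End QuasiConcave.

(** * Closures at finite points of the compactified line *)

Section Topology.
Variable R : realType.

Lemma closure_I0_meets (S : set (P1 R)) (y : R) (U : set R) :
  closure_I0 S (Some y) -> nbhs y U -> exists2 z, U z & S (Some z).
Proof.
move=> cl nU.
have [p [Sp [z Uz e]]] := cl _ (one_point_compactification_some_nbhs _ _ nU).
by exists z => //; rewrite e.
Qed.

Lemma closure_I0_none (S : set (P1 R)) (y : R) :
  ~ closure_I0 S (Some y) -> exists2 U : set R, nbhs y U & forall z, U z -> ~ S (Some z).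
Proof.
move=> ncl; apply: contrapT => h; apply: ncl => V nV.
have nU : nbhs y (Some @^-1` V) by exact: nV.
apply: contrapT => h'; apply: h; exists (Some @^-1` V) => // z Vz Sz.
by apply: h'; exists (Some z).
Qed.

End Topology.

(** * Decreasing blocks *)

(** Equality in the triangle inequality with nonzero coefficients forces both |x| and |y| to attain
    the bound m. *)
Lemma norm_comb_eq (R : realFieldType) (p q x y m t : R) :
  p != 0 -> q != 0 -> `|x| <= m -> `|y| <= m -> `|p| + `|q| <= t ->
  t * m <= `|p * x + q * y| -> `|x| = `|y|.
Proof.
move=> p0 q0 xm ym pqt e.
have pp : 0 < `|p| by rewrite normr_gt0.
have qp : 0 < `|q| by rewrite normr_gt0.
have m0 : 0 <= m := le_trans (normr_ge0 x) xm.
have h1 : `|p * x + q * y| <= `|p| * `|x| + `|q| * `|y|.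
  by rewrite -!normrM ler_normD.
have h2 : (`|p| + `|q|) * m <= t * m by rewrite ler_wpM2r.
have h3 : `|p| * `|x| <= `|p| * m by rewrite ler_wpM2l.
have h4 : `|q| * `|y| <= `|q| * m by rewrite ler_wpM2l.
have e1 : `|p| * `|x| = `|p| * m by lra.
have e2 : `|q| * `|y| = `|q| * m by lra.
by rewrite (mulfI (lt0r_neq0 pp) e1) (mulfI (lt0r_neq0 qp) e2).
Qed.

Lemma norm_comb_le (R : realFieldType) (p q x y m t : R) :
  `|x| <= m -> `|y| <= m -> `|p| + `|q| <= t -> `|p * x + q * y| <= t * m.
Proof.
move=> xm ym pqt; have m0 : 0 <= m := le_trans (normr_ge0 x) xm.
rewrite (le_trans (ler_normD _ _)) // !normrM.
rewrite (le_trans (lerD (ler_wpM2l (normr_ge0 p) xm) (ler_wpM2l (normr_ge0 q) ym))) //.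
by rewrite -mulrDl ler_wpM2r.
Qed.

Section Blocks.
Variables (R : realType) (T : algorithm) (K : fieldExtType rat).
Variables (iota : {rmorphism K -> R}) (cj : {rmorphism K -> K}).
Hypothesis dimK : \dim {:K} = 2%N.
Hypothesis cj_neq : exists x : K, cj x <> x.
Variables (s : K) (hs : iota s = Num.sqrt (radicand T)%:R).

Let ss : s ^+ 2 = (radicand T)%:R := s_sq hs.
Let irr := @radicand_not_square T.

Lemma pos_rep_eq (A B : 'M[K]_2) : A = B \/ A = - B -> pos_mx iota B ->
  pos_rep iota A = B.
Proof.
move=> AB [B0 iB dB]; rewrite /pos_rep; case: ifP => [/forallP h|h].
  case: AB h => // -> h.
  have z i j : B i j = 0.
    apply: (fmorph_inj iota); rewrite rmorph0; apply/le_anti; rewrite B0 andbT.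
    by have /forallP/(_ j) := h i; rewrite mxE rmorphN oppr_ge0.
  by case: dB; rewrite /det2 !z mul0r subrr => /esym/eqP; rewrite ?oppr_eq0 oner_eq0.
case: AB h => -> h; last by rewrite opprK.
by move/negP: h; case; apply/forallP => i; apply/forallP => j; exact: B0.
Qed.

Section OneBlock.
Variables (A B : 'M[K]_2) (AB : A = B \/ A = - B) (pB : pos_mx iota B).

Local Notation a := (iota (B 0 0)).
Local Notation b := (iota (B 0 1)).
Local Notation c := (iota (B 1 0)).
Local Notation d := (iota (B 1 1)).
Local Notation f := (fmax a b c d).
Local Notation t := (t_of iota cj A).

Let B0 i j : 0 <= iota (B i j). Proof. by case: pB. Qed.

Lemma f_of_some z : f_of iota A (Some z) = f z.
Proof. by rewrite /f_of (pos_rep_eq AB pB) !mxE. Qed.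

Lemma f_of_none : f_of iota A None = Num.max a c.
Proof. by rewrite /f_of (pos_rep_eq AB pB) !mxE. Qed.

Lemma E_sharp_some z : E_sharp iota cj A (Some z) -> 0 <= z /\ t < f z.
Proof. by case=> h1 h2; split=> //; rewrite -f_of_some. Qed.

Lemma closure_E_ge z : closure_I0 (E_sharp iota cj A) (Some z) -> t <= f z.
Proof.
move=> cl; rewrite leNgt; apply/negP => /fmax_lt_near h.
have [z' /= h1 /E_sharp_some[_ h2]] := closure_I0_meets cl h.
by rewrite ltNge ltW in h1.
Qed.

(** f_A attains its maximum over [0, oo] at 1. *)
Lemma E_sharp_empty : f 1 <= t -> E_sharp iota cj A = set0.
Proof.
move=> h; rewrite -subset0 => -[z|] /=.
  move=> /E_sharp_some[z0]; rewrite ltNge => /negP; apply.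
  by rewrite (le_trans _ h) // fmax_le1.
case=> _; rewrite f_of_none ltNge => /negP; apply.
rewrite (le_trans _ h) // /fmax maxxx divr1 !mulr1 ge_max !le_max.
by rewrite !lerDl !B0 orbT.
Qed.

(** If y were interior to I, points slightly farther from 1 on the same side would lie in the
    closure of E^sharp; but there f_A is at most f_A(y) <= t by monotonicity. *)
Lemma boundary_of_eq (I : set (P1 R)) (y : R) : 0 < y -> f y <= t -> I (Some y) ->
  I `<=` closure_I0 (E_sharp iota cj A) ->
  (boundary_I0 (E_sharp iota cj A) `&` boundary_I0 I) (Some y).
Proof.
move=> y0 fy Iy IE; split; split.
- exact: IE.
- apply: subset_closure; split; first exact: ltW.
  by move=> /E_sharp_some[_]; rewrite ltNge fy.
- exact: subset_closure.
apply: contrapT => /closure_I0_none[U nU hU].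
have inE z : U z -> 0 <= z -> closure_I0 (E_sharp iota cj A) (Some z).
  move=> Uz z0; apply: IE; apply: contrapT => nI; exact: (hU z Uz).
have [e e0 hb] : exists2 e : R, 0 < e & forall z, `|y - z| < e -> U z.
  by case/nbhs_ballP: nU => e /= e0 h; exists e => // z hz; apply: h.
have [y1|y1] := leP y 1.
  (* The term y / 2 keeps z non-negative and y - e / 2 keeps it within e of y. *)
  pose z := Num.max (y / 2) (y - e / 2).
  have zy : z < y by rewrite gt_max; apply/andP; split; lra.
  have z0 : 0 <= z by rewrite le_max; apply/orP; left; lra.
  have yz : `|y - z| < e.
    rewrite ger0_norm ?subr_ge0 ?ltW // ltrBlDl -ltrBlDr lt_max; apply/orP; right; lra.
  have nz : nbhs z [set x : R | x < y] by exact: lt_nbhsl.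
  have [x xy /E_sharp_some[x0]] := closure_I0_meets (inE z (hb z yz) z0) nz.
  by rewrite ltNge => /negP; apply; rewrite (le_trans _ fy) // fmax_homo // ltW.
pose z := y + e / 2.
have yz : `|y - z| < e by rewrite /z opprD addrA subrr sub0r normrN ger0_norm; lra.
have zy : y < z by rewrite /z; lra.
have z0 : 0 <= z by rewrite ltW // (lt_trans y0).
have nz : nbhs z [set x : R | y < x] by exact: lt_nbhsr.
have [x xy /E_sharp_some[x0]] := closure_I0_meets (inE z (hb z yz) z0) nz.
by rewrite ltNge => /negP; apply; rewrite (le_trans _ fy) // fmax_anti // ltW.
Qed.

Let ci (x : K) : R := iota (cj x).

Lemma t_ofE : t = Num.max (`|ci (B 0 0)| + `|ci (B 1 0)|) (`|ci (B 0 1)| + `|ci (B 1 1)|).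
Proof.
by rewrite /t_of /conj_abs; case: AB => -> //; rewrite !mxE !rmorphN !normrN.
Qed.

Section Point.
Variable y : K.
Hypothesis y0 : 0 <= iota y.
Let N := B 0 0 * y + B 0 1.
Let D := B 1 0 * y + B 1 1.
Let tau := Num.max `|ci N| `|ci D|.
Let sig := Num.max `|ci y| 1.

Let det_pm : det2 B = 1 \/ det2 B = -1. Proof. by case: pB. Qed.

Let e1 : det2 B * y = B 1 1 * N + (- B 0 1) * D.
Proof. by rewrite /det2 /N /D; ring. Qed.
Let e2 : det2 B = (- B 1 0) * N + B 0 0 * D.
Proof. by rewrite /det2 /N /D; ring. Qed.

Let norm_det x : `|ci (det2 B * x)| = `|ci x|.
Proof. by rewrite /ci; case: det_pm => ->; rewrite ?mulN1r ?mul1r ?rmorphN ?normrN. Qed.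
Let norm_det1 : `|ci (det2 B)| = 1.
Proof. by rewrite -(mulr1 (det2 B)) norm_det /ci !rmorph1 normr1. Qed.

Let ciL p q x z : ci (p * x + q * z) = ci p * ci x + ci q * ci z.
Proof. by rewrite /ci !rmorphD !rmorphM. Qed.
Let ciN x : ci (- x) = - ci x. Proof. by rewrite /ci !rmorphN. Qed.

Let tauN : `|ci N| <= tau. Proof. by rewrite le_max lexx. Qed.
Let tauD : `|ci D| <= tau. Proof. by rewrite le_max lexx orbT. Qed.

(** Inverting the conjugate matrix expresses y' and 1 through N' and D'. Up to sign, the rows of the
    inverse consist of entries of the columns of the matrix, which is why t(A) is formed from column
    sums. *)
Lemma conj_size_le : sig <= t * tau.
Proof.
rewrite ge_max t_ofE; apply/andP; split.
  rewrite -norm_det e1 ciL ciN; apply: norm_comb_le => //.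
  by rewrite normrN le_max [X in _ || (X <= _)]addrC lexx orbT.
rewrite -norm_det1 e2 ciL ciN; apply: norm_comb_le => //.
by rewrite normrN le_max [X in (X <= _)]addrC lexx.
Qed.

Lemma conj_size_eq : (forall i j, A i j != 0) -> sig = t * tau -> `|ci N| = `|ci D|.
Proof.
move=> nz e.
have nB i j : ci (B i j) != 0.
  by rewrite /ci !fmorph_eq0; have := nz i j; case: AB => ->; rewrite ?mxE ?oppr_eq0.
have : t * tau <= `|ci y| \/ t * tau <= 1.
  by rewrite -e /sig; case: (leP `|ci y| 1); [right|left].
have t1 : `|ci (B 1 1)| + `|- ci (B 0 1)| <= t by rewrite t_ofE normrN le_max addrC lexx orbT.
have t2 : `|- ci (B 1 0)| + `|ci (B 0 0)| <= t by rewrite t_ofE normrN le_max addrC lexx.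
case=> h.
  apply: (norm_comb_eq (nB 1 1) _ tauN tauD t1); first by rewrite oppr_eq0.
  by move: h; rewrite -norm_det e1 ciL ciN.
apply: (norm_comb_eq _ (nB 0 0) tauN tauD t2); first by rewrite oppr_eq0.
by move: h; rewrite -norm_det1 e2 ciL ciN.
Qed.

Hypothesis D0 : D != 0.

Let ND_ge0 : 0 <= iota N /\ 0 < iota D.
Proof.
have h : 0 <= iota D by rewrite rmorphD rmorphM addr_ge0 ?mulr_ge0.
split; first by rewrite rmorphD rmorphM addr_ge0 ?mulr_ge0.
by rewrite lt_def h fmorph_eq0 D0.
Qed.

Let P := fin_size R y 1 ^+ 2.
Let M := Num.max (iota y) 1.

Lemma height_sq_y : weil_height R (Some y : P1 K) ^+ 2 = M * sig * P.
Proof.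
rewrite weil_height_some (height_coord_sq iota dimK cj_neq ss irr); last by rewrite oner_eq0 orbT.
by rewrite /arch_size !rmorph1 normr1 ger0_norm.
Qed.

Lemma height_sq_x : weil_height R (Some (N / D) : P1 K) ^+ 2 = f (iota y) * M * tau * P.
Proof.
have [N0 D0'] := ND_ge0.
rewrite (weil_height_div iota dimK cj_neq ss irr) //.
rewrite (height_coord_sq iota dimK cj_neq ss irr); last by rewrite D0 orbT.
have -> : fin_size R N D = fin_size R y 1.
  have [_ iB dB] := pB.
  have := fin_size_GL y 1 (iB 0 0) (iB 0 1) (iB 1 0) (iB 1 1) dB.
  by rewrite !mulr1.
congr (_ * _); rewrite /arch_size -/(ci N) -/(ci D) -/tau; congr (_ * _).
rewrite (ger0_norm N0) (ger0_norm (ltW D0')) /fmax /M divfK ?lt0r_neq0 ?max1_gt0 //.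
by rewrite /N /D !rmorphD !rmorphM.
Qed.

Let M0 : 0 < M. Proof. exact: max1_gt0. Qed.
Let sig0 : 0 < sig. Proof. exact: max1_gt0. Qed.
Let P0 : 0 < P.
Proof.
by rewrite exprn_gt0 // (lt_le_trans ltr01) // fin_size_ge1.
Qed.

Let t0 : 0 <= t. Proof. by rewrite t_ofE le_max addr_ge0. Qed.
Let tau0 : 0 < tau.
Proof.
rewrite lt_def le_max normr_ge0 andbT; apply/eqP => h.
by have := conj_size_le; rewrite h mulr0 leNgt sig0.
Qed.

Lemma height_ge1 z : 1 <= weil_height R (Some z : P1 K).
Proof. exact: (height_coord_ge1 iota dimK cj_neq ss irr). Qed.

(** Cancelling the common positive factor M P of the squared heights leaves sig against f_A(y) tau,
    and sig <= t tau <= f_A(y) tau. *)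
Lemma height_cmp : t <= f (iota y) ->
  weil_height R (Some y : P1 K) < weil_height R (Some (N / D) : P1 K) \/
  [/\ weil_height R (Some y : P1 K) = weil_height R (Some (N / D) : P1 K),
      f (iota y) = t & sig = t * tau].
Proof.
move=> tf.
have hy := height_ge1 y; have hx := height_ge1 (N / D).
have g z : 1 <= z :> R -> 0 <= z by move=> h; rewrite (le_trans _ h).
have le1 : sig <= t * tau := conj_size_le.
have le2 : t * tau <= f (iota y) * tau by rewrite ler_wpM2r // ltW.
have sqE : (weil_height R (Some y : P1 K) ^+ 2 <= weil_height R (Some (N / D) : P1 K) ^+ 2)
   = (sig <= f (iota y) * tau) /\
   ((weil_height R (Some y : P1 K) ^+ 2 == weil_height R (Some (N / D) : P1 K) ^+ 2)
   = (sig == f (iota y) * tau)).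
  rewrite height_sq_y height_sq_x.
  have -> : M * sig * P = sig * (M * P) by ring.
  have -> : f (iota y) * M * tau * P = f (iota y) * tau * (M * P) by ring.
  have MP : 0 < M * P by rewrite mulr_gt0.
  by rewrite ler_pM2r //; split=> //; rewrite (inj_eq (mulIf (lt0r_neq0 MP))).
case: sqE; rewrite (le_trans le1 le2) ler_sqr ?nnegrE ?g // eqrXn2 ?g // => hle heq.
have [e|ne] := eqVneq sig (f (iota y) * tau).
  right; split; first by apply/eqP; rewrite heq e.
    apply/le_anti; rewrite tf andbT -(ler_pM2r tau0) -e //.
  by apply/le_anti; rewrite le1 e le2.
by left; rewrite lt_neqAle hle andbT heq.
Qed.

End Point.

Lemma block_compare (I : set (P1 R)) (x y : P1 K) :
  I (real_point iota y) -> y <> None -> x <> None -> x <> Some 0 ->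
  I `<=` closure_I0 (E_sharp iota cj A) -> @I0 R (real_point iota y) ->
  ((exists i j, A i j = 0) ->
      forall beta : K,
        (boundary_I0 (E_sharp iota cj A) `&` boundary_I0 I) (Some (iota beta)) ->
        t * Num.max (conj_abs iota cj (A 0 0 * beta + A 0 1))
                    (conj_abs iota cj (A 1 0 * beta + A 1 1))
          > Num.max (conj_abs iota cj beta) 1) ->
  moebius A y = x ->
  weil_height R y < weil_height R x \/
  [/\ weil_height R y = weil_height R x, x = Some 1 & y = Some 0].
Proof.
case: y => [y|//] Iy _ xn x0 IE II0 h3 exy.
have {}exy : moebius B (Some y) = x.
  by rewrite -exy; case: AB => -> //; rewrite moebiusN // (pos_mx_det pB).
have y0 : 0 <= iota y := II0.
move: exy; rewrite /moebius !mulr1; case: eqP => [_ e|/eqP D0 e]; first by case: xn.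
move: x0 xn; rewrite -{x}e => x0 _.
have tf : t <= f (iota y) := closure_E_ge (IE _ Iy).
have [|[eH ef es]] := height_cmp y0 D0 tf; first by left.
right.
set N := B 0 0 * y + B 0 1 in eH es x0 *; set D := B 1 0 * y + B 1 1 in D0 eH es x0 *.
have x1 : 0 < iota (N / D).
  rewrite lt_def fmorph_eq0 fmorph_div; apply/andP; split.
    by apply/eqP => h; apply: x0; rewrite h.
  by rewrite divr_ge0 // rmorphD rmorphM addr_ge0 ?mulr_ge0.
have H1 z : 0 < iota z -> weil_height R (Some z : P1 K) = 1 -> z = 1.
  move=> z0; rewrite weil_height_some; move: z0; exact: (height1_eq1 dimK cj_neq ss irr).
have [yz|yn] := eqVneq y 0.
  have Hx : weil_height R (Some (N / D) : P1 K) = 1.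
    by rewrite -eH yz (height_0 iota dimK cj_neq ss irr).
  by rewrite eH yz (H1 _ x1 Hx); split.
exfalso.
have yp : 0 < iota y by rewrite lt_def y0 andbT fmorph_eq0.
have fle : f (iota y) <= t by rewrite ef.
have bd := boundary_of_eq yp fle Iy IE.
(* With a zero entry, condition (iii) at y contradicts sig = t tau. Without one, [conj_size_eq]
   gives N = D or N = -D, and positivity of x selects x = 1. *)
have [hz|nz] := pselect (exists i j, A i j = 0).
  have := h3 hz y bd; rewrite -[X in X < _]/(Num.max `|ci y| 1) es.
  suff -> : Num.max (conj_abs iota cj (A 0 0 * y + A 0 1)) (conj_abs iota cj (A 1 0 * y + A 1 1))
    = Num.max `|ci N| `|ci D| by rewrite ltxx.
  by rewrite /conj_abs; case: AB => -> //; rewrite !mxE !mulNr -!opprD !rmorphN !normrN.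
have {}nz i j : A i j != 0 by apply/eqP => h; apply: nz; exists i, j.
have xE : N / D = 1.
  have := conj_size_eq nz es; rewrite -/N -/D /ci => /eqP; rewrite eqr_norm2 => /orP[]/eqP h.
    have -> : N = D by apply: (fmorph_inj cj); apply: (fmorph_inj iota).
    by rewrite divff.
  have ND : N = - D by apply: (fmorph_inj cj); apply: (fmorph_inj iota); rewrite !rmorphN.
  by move: x1; rewrite ND mulNr divff // rmorphN rmorph1 oppr_gt0 ltr10.
(* Now y > 0 has height 1, hence equals 1, where f_A is maximal. Since f_A(1) = t, the set E^sharp
   is empty, yet y lies in its closure. *)
have yE : y = 1.
  by apply: H1 => //; rewrite eH xE (height_1 iota dimK cj_neq ss irr).
have E0 : E_sharp iota cj A = set0.
  by apply: E_sharp_empty; rewrite -ef yE rmorph1.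
have := IE _ Iy; rewrite E0 /closure_I0 closure0 //.
Qed.

End OneBlock.

Lemma good_mx_fix0 n c : 0 < iota c -> Bm T s 1 = mx2 1 0 c 1 ->
  exists2 C, 0 < iota C &
    \prod_(i <- nseq n.+1 1%N) mxA iota T i = mx2 1 0 C 1 \/
    \prod_(i <- nseq n.+1 1%N) mxA iota T i = - mx2 1 0 C 1.
Proof.
move=> c0 e1; elim: n => [|n [C C0 IH]].
  by exists c => //; rewrite big_seq1 -e1; exact: (mxA_Bm hs).
exists (c + C); first by rewrite rmorphD addr_gt0.
have -> : mx2 1 0 (c + C) 1 = mx2 1 0 c 1 * mx2 1 0 C 1.
  by apply: mx2_ext; rewrite mx2M !mxE /=; ring.
rewrite -[nseq _ _]/(1%N :: nseq n.+1 1%N) big_cons.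
by case: (mxA_Bm hs 1) => ->; rewrite e1; case: IH => ->;
  rewrite ?mulNr ?mulrN ?opprK; tauto.
Qed.

(* If T fixes 0 the word of a block starting at 0 is 1...1, and its matrix    *)
(* [1 0; C 1] satisfies f(0) = 1 < t; otherwise 0 goes to oo and stays there. *)
Lemma block_start_neq0 (b : nat -> nat) (m : nat) (z : P1 K) : (0 < m)%N ->
  (forall i, (i <= m)%N -> letter T (b i) /\
     itvA iota T (b i) (real_point iota (iter i (Tmap iota T) z))) ->
  b m <> nletters T ->
  itvA iota T (b m) `<=`
    closure_I0 (E_sharp iota cj (\prod_(c <- [seq b i | i <- seq.iota 0 m]) mxA iota T c)) ->
  z <> Some 0.
Proof.
case: m => [//|m] _ h bm IE z0.
have [l0 h0] := h 0%N isT.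
have {}h0 : itvA iota T (b 0%N) (Some 0) by move: h0; rewrite z0 /= rmorph0.
have [T0|[T0 [c c0 e1]]] := Tmap_0 hs l0 h0.
  apply: bm; have [lm hm] := h m.+1 (leqnn _).
  apply: (itvA_None hs lm); suff e i : (i <= m)%N -> iter i.+1 (Tmap iota T) z = None.
    by move: hm; rewrite e.
  elim: i => [|i IH] hi; first by rewrite z0.
  rewrite iterS IH ?(ltnW hi) //.
  have [li] := h i.+1 (ltnW hi); rewrite IH ?(ltnW hi) //; exact: (Tmap_None hs li).
have it i : iter i (Tmap iota T) z = Some 0 by elim: i => [|i IH] //; rewrite iterS IH.
have b1 i : (i <= m.+1)%N -> b i = 1%N.
  by move=> /h[li]; rewrite it /= rmorph0; exact: (itvA_0 hs li).
have bE : [seq b i | i <- seq.iota 0 m.+1] = nseq m.+1 1%N.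
  have /all_pred1P : all (pred1 1%N) [seq b i | i <- seq.iota 0 m.+1].
    by apply/allP => j /mapP; case=> i; rewrite mem_iota => /andP[_ hi] ->; apply/eqP/b1/ltnW.
  by rewrite size_map size_iota.
have [C C0 hC] := good_mx_fix0 m c0 e1.
have pC : pos_mx iota (mx2 1 0 C 1).
  have all1 : all (letter T) (nseq m.+1 1%N) by rewrite all_nseq letter_1 orbT.
  have [B hB pB] := good_mx_prod hs all1.
  (* The non-negative representative is one of the two signs of [1 0; C 1], and the entry 1 decides
     which. *)
  have [<- //|eB] : B = mx2 1 0 C 1 \/ B = - mx2 1 0 C 1.
    case: hC hB => -> [] e; [left|right|right|left].
    - by rewrite e.
    - by rewrite e opprK.
    - by rewrite -e.
    - exact/esym/oppr_inj.
  have [B0 _ _] := pB; have := B0 0 0.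
  by rewrite eB !mxE /= rmorphN rmorph1 oppr_ge0 ler10.
have [lm hm] := h m.+1 (leqnn _).
have := IE _ hm; rewrite bE it /= rmorph0 => /(closure_E_ge hC pC).
rewrite (t_ofE hC) !mxE /= /fmax !rmorph0 !rmorph1 !mulr0 !add0r normr0 normr1 add0r.
rewrite (max_idPr ler01) ?maxxx ?divr1 ge_max => /andP[+ _].
by rewrite gerDl leNgt normr_gt0 !fmorph_eq0 -(fmorph_eq0 iota) gt_eqF.
Qed.


End Blocks.

Theorem mainTheorem2 (R : realType) (T : algorithm)
  (* K = Q(sqrt D), a subfield of R through iota, with automorphism cj <> id *)
  (K : fieldExtType rat) (iota : {rmorphism K -> R}) (cj : {rmorphism K -> K})
  (dimK : \dim {:K} = 2%N)
  (sqrtK : exists s : K, iota s = Num.sqrt (radicand T)%:R)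
  (cj_neq : exists x : K, cj x <> x)
  (a : nat -> nat) (a_letter : forall i, letter T (a i))
  (a_tail_r : ~ exists N, forall i, (N <= i)%N -> a i = nletters T)
  (a_tail_1 : \det (mxA iota T 1) = 1 ->
     ~ exists N, forall i, (N <= i)%N -> a i = 1%N)
  (t : nat -> nat) (t_incr : forall k, (t k < t k.+1)%N)
  (t_block : forall k, decreasing_block iota cj T
     [seq a i | i <- seq.iota (t k) (t k.+1 - t k).+1])
  (* w = a_0 ... a_(n-1), and h is the largest l with t_l < n *)
  (n h : nat) (t_h : (t h < n)%N) (h_max : forall l, (t l < n)%N -> (l <= h)%N)
  (alpha : K)
  (alpha_orbit : exists c : nat -> nat,
     symbolic_orbit iota T (Some alpha) c /\ forall i, (i < n)%N -> c i = a i) :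
  let x (k : nat) : P1 K := iter (t k) (Tmap iota T) (Some alpha) in
  let H (k : nat) : R := weil_height R (x k) in
  (forall k, (k < h)%N -> H k > H k.+1 \/ (k = h.-1 /\ H k = H k.+1)) /\
  ((0 < h)%N ->
     (H h.-1 = H h <-> x h.-1 = Some 1) /\
     (H h.-1 = H h -> x h = Some 0)).
Proof.
move=> x H; have [s hs] := sqrtK; have [c [orb ca]] := alpha_orbit.
have ss := s_sq hs; have irr := @radicand_not_square T.
have t_le k l : (k <= l)%N -> (t k <= t l)%N.
  move=> /subnKC <-; elim: (l - k)%N => [|d IH]; first by rewrite addn0.
  by rewrite addnS (leq_trans IH) // ltnW.
have key k : (k < h)%N -> [/\ x k <> Some 0,
    H k.+1 < H k \/ [/\ H k.+1 = H k, x k = Some 1 & x k.+1 = Some 0] &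
    x k.+1 <> None].
  move=> kh.
  pose m := (t k.+1 - t k)%N; have m0 : (0 < m)%N by rewrite subn_gt0.
  have tm : (t k + m)%N = t k.+1 by rewrite subnKC // ltnW.
  pose b i := a (t k + i)%N.
  have xi i : iter i (Tmap iota T) (x k) = iter (t k + i) (Tmap iota T) (Some alpha).
    by rewrite addnC iterD.
  have hb i : (i <= m)%N -> letter T (b i) /\
      itvA iota T (b i) (real_point iota (iter i (Tmap iota T) (x k))).
    (* The block ends at time t_(k+1) <= t_h < n, so all its letters lie in w, where the orbit
       follows [a]. *)
    move=> im; have lt : (t k + i < n)%N.
      by rewrite (leq_ltn_trans _ t_h) // (leq_trans _ (t_le _ _ kh)) // -tm leq_add2l.
    by have := orb (t k + i)%N; rewrite ca // xi.
  have wE : [seq a i | i <- seq.iota (t k) m.+1] = [seq b i | i <- seq.iota 0 m.+1].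
    by rewrite -[X in seq.iota X _](addn0 (t k)) iotaDl -map_comp.
  have := t_block k; rewrite /decreasing_block -/m wE.
  have -> : last 0%N [seq b i | i <- seq.iota 0 m.+1] = b m.
    by rewrite -addn1 iotaD map_cat last_cat.
  have -> : take (size [seq b i | i <- seq.iota 0 m.+1]).-1 [seq b i | i <- seq.iota 0 m.+1] =
      [seq b i | i <- seq.iota 0 m].
    rewrite size_map size_iota -map_take take_iota; congr (map b (seq.iota 0 _)).
    exact/minn_idPl/leqnSn.
  case=> _ [hd bm] IE h3.
  have hdE : head 0%N [seq b i | i <- seq.iota 0 m.+1] = b 0%N by [].
  rewrite hdE in hd.
  have xm : iter m (Tmap iota T) (x k) = x k.+1 by rewrite xi tm.
  have exy := orbit_prod hs (z := x k) (b := b) (n := m) (fun i hi => hb i (ltnW hi)).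
  have xk0 : x k <> Some 0 := block_start_neq0 hs m0 hb bm IE.
  have [lm hm] := hb m (leqnn m); rewrite xm in hm exy.
  have xk1 : x k.+1 <> None.
    by move=> e; apply: bm; rewrite e in hm; exact: (itvA_None hs lm hm).
  have xkn : x k <> None.
    have [l0 h0] := hb 0%N (leq0n m).
    by move=> e; apply: hd; rewrite /= e in h0; exact: (itvA_None hs l0 h0).
  split=> //.
  have lw : all (letter T) [seq b i | i <- seq.iota 0 m].
    by apply/allP => i /mapP; case=> j _ ->; exact: a_letter.
  have [B hB pB] := good_mx_prod hs lw.
  have I0y : @I0 R (real_point iota (x k.+1)).
    by have [+ _ _ _] := itvA_P hs lm hm; case: (x k.+1).
  have [|[e1 e2 e3]] := block_compare dimK cj_neq hs hB pB hm xk1 xkn xk0 IE I0y h3 (esym exy).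
    by left.
  by right.
split=> [k kh|h0].
  have [_ [lt|[e1 e2 e3]] _] := key k kh; first by left.
  (* Before the last index, equality would give x_(k+1) = 0 at the start of a further block, which
     [key] excludes. *)
  right; split=> //; apply/eqP; apply: contraT => ne.
  have kh' : (k.+1 < h)%N by lia.
  by have [] := key k.+1 kh'; rewrite e3.
have hh : (h.-1 < h)%N by lia.
have hS : h.-1.+1 = h by lia.
have [_ cmp yn] := key h.-1 hh; rewrite hS in cmp yn.
split; last first.
  by move=> e; case: cmp => [|[_ _ //]]; rewrite e ltxx.
split=> [e|e]; first by case: cmp => [|[_ //]]; rewrite e ltxx.
(* If x = 1, its height is already the minimum 1, so a strict decrease is impossible. *)
case: cmp => [lt|[-> //]].
exfalso; move: lt; rewrite /H e (height_1 iota dimK cj_neq ss irr).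
case: (x h) yn => [y|//] _; rewrite ltNge => /negP; apply.
exact: (height_coord_ge1 iota dimK cj_neq ss irr).
Qed.
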